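(* Let $G=(V,E)$ be an undirected graph with $n=|V|$, let $r\in V$ be a root and $R\subseteq V$ a set of $k=|R|$ terminals. Given a feasible fractional solution of value $L=L_1+L_2$ to the linear program POISE-LP described below, there is a polynomial-time algorithm that constructs a tree in $G$ spanning $\{r\}\cup R$ whose poise is $O(L\log k)$.
   Context: The poise of an undirected tree is the sum of its diameter (maximum number of hops on a path between two of its nodes) and the maximum degree of any of its nodes. For $t\in R$, let $\mathcal{P}(t,r)$ be the set of all simple paths in $G$ between $t$ and $r$, and for a path $P$ let $\ell(P)$ be its number of edges. POISE-LP (the linear relaxation of the minimum poise problem for connecting $r$ to $R$) has variables $x(e)\ge 0$ for $e\in E$, $y_t(P)\ge 0$ for $t\in R$, $P\in\mathcal{P}(t,r)$, and $L_1,L_2$; it minimizes $L=L_1+L_2$ subject to: $\sum_{e\in\delta(v)}x(e)\le L_1$ for all $v\in V$ (where $\delta(v)$ is the set of edges incident to $v$); $\sum_{P\in\mathcal{P}(t,r)}y_t(P)=1$ for all $t\in R$; $\sum_{P\in\mathcal{P}(t,r)}\ell(P)\,y_t(P)\le L_2$ for all $t\in R$; and $\sum_{P\in\mathcal{P}(t,r):\,e\in P}y_t(P)\le x(e)$ for all $e\in E$, $t\in R$. *)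

(* Defs.v *)
From mathcomp Require Import all_boot all_order all_algebra.
From Corelib Require Import BinNums.
Set Implicit Arguments.
Unset Strict Implicit.
Unset Printing Implicit Defensive.
Import Order.TTheory GRing.Theory Num.Theory.

(* A graph with vertex set {0, ..., n-1} is given by its set E of edges, each
   edge being a set of two vertices. *)
Section Graphs.

Variable n : nat.
Notation V := 'I_n.
Implicit Types (E F : {set {set V}}) (S : {set V}) (P : seq V).

Definition simple_graph E : bool := [forall e in E, #|e| == 2].

Definition adj E : rel V := fun u v => [set u; v] \in E.

Definition delta E (v : V) : {set {set V}} := [set e in E | v \in e].

(* A path is the sequence of all its vertices, endpoints included. *)
Definition simple_path E (u v : V) P : bool :=
  if P is a :: p then [&& a == u, last a p == v, path (adj E) a p & uniq (a :: p)]
  else false.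

(* A simple path has at most n vertices, so the bound in n.-bseq loses nothing
   and makes the set of all simple paths finite. *)
Definition simple_paths E (u v : V) : {set n.-bseq V} :=
  [set P : n.-bseq V | simple_path E u v P].

Definition hops P : nat := (size P).-1.

Definition path_edges P : seq {set V} :=
  [seq [set uv.1; uv.2] | uv <- zip P (behead P)].

Definition connected S F : Prop := {in S &, forall u v, connect (adj F) u v}.

(* ucycle also accepts the sequence [:: u; v] that crosses one edge twice, which
   is not a cycle of the graph. *)
Definition acyclic F : Prop :=
  forall c : seq V, ucycle (adj F) c -> size c <= 2.

Definition is_tree S F : Prop :=
  [/\ simple_graph F, cover F \subset S, S != set0, connected S F & acyclic F].

Definition diameter S F : nat :=
  \max_(u in S) \max_(v in S) \max_(P in simple_paths F u v) hops P.

Definition max_degree S F : nat := \max_(v in S) #|delta F v|.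

Definition poise S F : nat := diameter S F + max_degree S F.

Local Open Scope ring_scope.

Record poise_lp_feasible (E : {set {set V}}) (r : V) (R : {set V})
    (x : {set V} -> rat) (y : V -> n.-bseq V -> rat) (L1 L2 : rat) : Prop :=
  PoiseLPFeasible {
    lp_x_ge0 : forall e, e \in E -> 0 <= x e;
    lp_y_ge0 : forall t (P : n.-bseq V), t \in R -> P \in simple_paths E t r -> 0 <= y t P;
    lp_degree : forall v, \sum_(e in delta E v) x e <= L1;
    lp_unit : forall t, t \in R -> \sum_(P in simple_paths E t r) y t P = 1;
    lp_length : forall t, t \in R ->
      \sum_(P in simple_paths E t r) (hops P)%:R * y t P <= L2;
    lp_capacity : forall e t, e \in E -> t \in R ->
      \sum_(P in simple_paths E t r | e \in path_edges P) y t P <= x e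
  }.

(* The LP has exponentially many path variables, so y is presented to an
   algorithm sparsely: ys lists, in any order and without repetition, indices of
   variables y_t(P) among which are all those with a nonzero value. *)
Definition lists_support (E : {set {set V}}) (r : V) (R : {set V})
    (y : V -> n.-bseq V -> rat) (ys : seq (V * n.-bseq V)) : Prop :=
  [/\ uniq ys,
      forall t (P : n.-bseq V), (t, P) \in ys -> t \in R /\ P \in simple_paths E t r
    & forall t (P : n.-bseq V), t \in R -> P \in simple_paths E t r -> y t P != 0 ->
        (t, P) \in ys].

End Graphs.

(* Model of computation: while-programs over binary trees, as in Jones,
   "Computability and Complexity".  A program denotes a partial function on
   trees; [run p a b t] says that p maps a to b in time t.  Every operation is
   charged the sizes of its argument and of its result, so that a run of time t
   only handles trees of size at most t.  Hence multitape Turing machines and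
   these programs simulate each other with polynomial overhead, and polynomial
   time has its usual meaning. *)
Inductive data : Type := Leaf | Node of data & data.

Fixpoint dsize (a : data) : nat :=
  if a is Node b c then (dsize b + dsize c).+1 else 1.

Definition dfst (a : data) : data := if a is Node b _ then b else Leaf.
Definition dsnd (a : data) : data := if a is Node _ c then c else Leaf.

Inductive prog : Type :=
  | Id
  | Const_leaf
  | Fst
  | Snd
  | Pair of prog & prog
  | Seq of prog & prog
  | If of prog & prog & prog
  | While of prog & prog.

Definition charge (a b : data) : nat := dsize a + dsize b.

(* Tests regard Leaf as false and every Node as true; [Seq p q] is p followed
   by q. *)
Inductive run : prog -> data -> data -> nat -> Prop :=
  | RunId a : run Id a a (charge a a)
  | RunConstLeaf a : run Const_leaf a Leaf (charge a Leaf)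
  | RunFst a : run Fst a (dfst a) (charge a (dfst a))
  | RunSnd a : run Snd a (dsnd a) (charge a (dsnd a))
  | RunPair p q a b c s t :
      run p a b s -> run q a c t ->
      run (Pair p q) a (Node b c) (s + t + charge a (Node b c))
  | RunSeq p q a b c s t :
      run p a b s -> run q b c t -> run (Seq p q) a c (s + t + charge a c)
  | RunIfTrue g p q a u v b s t :
      run g a (Node u v) s -> run p a b t ->
      run (If g p q) a b (s + t + charge a b)
  | RunIfFalse g p q a b s t :
      run g a Leaf s -> run q a b t ->
      run (If g p q) a b (s + t + charge a b)
  | RunWhileStop g p a s :
      run g a Leaf s -> run (While g p) a a (s + charge a a)
  | RunWhileStep g p a u v b c s t m :
      run g a (Node u v) s -> run p a b t -> run (While g p) b c m ->
      run (While g p) a c (s + t + m + charge a b).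

Definition enc_seq (s : seq data) : data := foldr Node Leaf s.

Definition enc_bool (b : bool) : data := if b then Node Leaf Leaf else Leaf.

(* Vertices are numbered in unary: an input with n vertices has size at least
   n ^ 2 anyway (adjacency matrix), so binary numbers would not change which
   running times are polynomial. *)
Definition enc_vertex n (v : 'I_n) : data := iter v (Node Leaf) Leaf.

(* Numerical data is written in binary, least significant bit first, the
   leading 1 being implicit. *)
Fixpoint enc_pos (p : positive) : data :=
  match p with
  | xH => Leaf
  | xO q => Node (enc_bool false) (enc_pos q)
  | xI q => Node (enc_bool true) (enc_pos q)
  end.

Definition enc_nat (m : nat) : data :=
  if bin_of_nat m is Npos p then Node Leaf (enc_pos p) else Leaf.

(* Sign, numerator and denominator, in lowest terms. *)
Definition enc_rat (q : rat) : data :=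
  Node (enc_bool (q < 0)%R) (Node (enc_nat `|numq q|) (enc_nat `|denq q|)).

(* Adjacency matrix whose entry at an edge e is Node Leaf (x e) and whose other
   entries are Leaf. *)
Definition enc_weighted_graph n (E : {set {set 'I_n}}) (x : {set 'I_n} -> rat) :
    data :=
  enc_seq [seq enc_seq [seq if adj E u v
                            then Node Leaf (enc_rat (x [set u; v])) else Leaf
                       | v <- enum 'I_n]
          | u <- enum 'I_n].

Definition enc_path n (P : seq 'I_n) : data :=
  enc_seq [seq enc_vertex v | v <- P].

Definition enc_input n (E : {set {set 'I_n}}) (r : 'I_n) (R : {set 'I_n})
    (x : {set 'I_n} -> rat) (y : 'I_n -> n.-bseq 'I_n -> rat) (L1 L2 : rat)
    (ys : seq ('I_n * n.-bseq 'I_n)) : data :=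
  enc_seq [:: enc_weighted_graph E x;
              enc_vertex r;
              enc_seq [seq enc_bool (v \in R) | v <- enum 'I_n];
              enc_seq [seq Node (enc_vertex tP.1)
                             (Node (enc_path tP.2) (enc_rat (y tP.1 tP.2)))
                      | tP : 'I_n * n.-bseq 'I_n <- ys];
              enc_rat L1;
              enc_rat L2].

(* A subgraph (S, F) is output as a list of the vertices in S and a list of the
   edges in F. *)
Definition enc_output n (vs : seq 'I_n) (es : seq ('I_n * 'I_n)) : data :=
  Node (enc_seq [seq enc_vertex v | v <- vs])
       (enc_seq [seq Node (enc_vertex e.1) (enc_vertex e.2) | e <- es]).

Definition listed_vertices n (vs : seq 'I_n) : {set 'I_n} := [set v in vs].

Definition listed_edges n (es : seq ('I_n * 'I_n)) : {set {set 'I_n}} :=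
  [set [set e.1; e.2] | e in es].

(* Main.v *)
Require Import Defs.
From HB Require Import structures.
From mathcomp Require Import all_boot all_order all_algebra archimedean zify ring lra.
Import Order.TTheory GRing.Theory Num.Theory.
Set Implicit Arguments.
Unset Strict Implicit.
Unset Printing Implicit Defensive.

(** The tree is grown in phases around a shrinking set A of active terminals.  A
    phase splits A and the root into sources and sinks and routes sources to
    sinks by an integral flow in the graph whose vertices have capacity l,
    augmenting only along residual paths of at most D = 16 l arcs.  The m
    sources that get routed use at most m D arcs, so by Markov's inequality at
    least half of them are within 2 D hops of a sink in the support of the
    flow; they become inactive.  The support has degree at most 2 l + 1.

    Some split routes a constant fraction of A as soon as l >= L1, L2.  The
    residual distances at the end of an augmentation are a dual solution: they
    are levels of the vertices that separate the unrouted sources from the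
    sinks by D, and that change along an edge by at most 2 plus the prices of
    its endpoints, whose total is at most 2 m D / l.  The splits are the rows of a
    Hadamard matrix, so summing the levels over all of them gives an l1 metric
    that separates any two active terminals, and the LP flow of each terminal
    must leave a ball around it.  The balls are disjoint, hence the metric has a
    large volume with respect to x, which is only possible if many sources were
    routed.

    The LP solution is not consulted by the algorithm: l starts at 1 and grows
    when no split makes progress, so it never exceeds the LP value.  After
    O(log |A|) successful phases a breadth-first tree of the union of the
    supports is returned. *)

(** * Polynomial time for while-programs *)

(** A phase needs few paths through each vertex and short paths. Capacities give the first, but a
    maximum flow may use long paths. Cutting augmentation off at [D] arcs bounds the volume, so
    lengths are controlled on average, and failure to augment within [D] still leaves a dual
    solution, made of distances truncated at [D].

    Hadamard rows replace random splits: any two columns differ in exactly half of the rows, and at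
    most [2 k + 1] rows are needed for [k] terminals.

    The constants: with [J] splits, the tents around [k] active terminals demand a volume of
    [D k J / 4 = 4 l k J], up to terms in the routed sources, while a rise of 2 per edge supplies
    only [2 l k J]. The routed sources must make up for the gap, which forces an average of at least
    [k / 24] of them per split. Half of those are merged, so a successful phase removes at least one
    active terminal in 48, and adds at most [32 l] to the hop bound and [2 l + 1] to the degree.

    Using the LP only as a certificate also keeps rational arithmetic out of the program. *)

Definition polyb (b : nat -> nat) : Prop :=
  {homo b : m n / m <= n} /\ exists c d, forall s, b s <= c * s.+1 ^ d.

Lemma polyb_const k : polyb (fun=> k).
Proof. by split=> //; exists k, 0 => s; rewrite muln1. Qed.

Lemma polyb_id : polyb id.
Proof. by split=> //; exists 1, 1 => s; rewrite mul1n expn1. Qed.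

Lemma polyb_add b1 b2 : polyb b1 -> polyb b2 -> polyb (fun s => b1 s + b2 s).
Proof.
move=> [m1 [c1 [d1 h1]]] [m2 [c2 [d2 h2]]]; split=> [s t st|].
  by rewrite leq_add ?m1 ?m2.
exists (c1 + c2), (d1 + d2) => s; rewrite mulnDl expnD leq_add //.
  by apply: leq_trans (h1 s) _; rewrite leq_mul // leq_pmulr ?expn_gt0.
by apply: leq_trans (h2 s) _; rewrite leq_mul // leq_pmull ?expn_gt0.
Qed.

Lemma polyb_mul b1 b2 : polyb b1 -> polyb b2 -> polyb (fun s => b1 s * b2 s).
Proof.
move=> [m1 [c1 [d1 h1]]] [m2 [c2 [d2 h2]]]; split=> [s t st|].
  by rewrite leq_mul ?m1 ?m2.
exists (c1 * c2), (d1 + d2) => s; rewrite expnD mulnACA.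
exact: leq_mul.
Qed.

Lemma polyb_comp b1 b2 : polyb b1 -> polyb b2 -> polyb (fun s => b1 (b2 s)).
Proof.
move=> [m1 [c1 [d1 h1]]] [m2 [c2 [d2 h2]]]; split=> [s t st|].
  by rewrite m1 ?m2.
exists (c1 * c2.+1 ^ d1), (d2 * d1) => s.
apply: leq_trans (h1 _) _; rewrite -mulnA leq_mul // expnM -expnMn.
case: d1 h1 => // d1 h1; rewrite leq_exp2r // mulSn addnC -addn1.
by rewrite leq_add ?expn_gt0.
Qed.

Lemma polyb_succ b : polyb b -> polyb (fun s => (b s).+1).
Proof. by move=> h; exact: (polyb_add (polyb_const 1) h). Qed.

Ltac polyb_tac := repeat first
  [ assumption | exact: polyb_const | exact: polyb_id | apply: polyb_succ | apply: polyb_add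
  | apply: polyb_mul | apply: polyb_comp ].

Structure codeType := Code { csort :> Type; encode : csort -> data }.
(* Locked, because unfolded encodings of pairs and of lists unify with each
   other. *)
HB.lock Definition enc (X : codeType) (x : X) : data := encode x.
Arguments enc {X} x.
Arguments dsize : simpl never.

Lemma dsize_node a b : dsize (Node a b) = (dsize a + dsize b).+1.
Proof. by []. Qed.

Lemma dsize_leaf : dsize Leaf = 1. Proof. by []. Qed.

Definition dsizeE := (dsize_node, dsize_leaf).

Implicit Types E X Y Z S : codeType.

Canonical code_unit := Code (fun _ : unit => Leaf).
Canonical code_data := Code (@id data).
Canonical code_bool := Code enc_bool.
Canonical code_nat := Code (fun n : nat => iter n (Node Leaf) Leaf).
Canonical code_option X :=
  Code (fun o : option X => if o is Some x then Node Leaf (enc x) else Leaf).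
Canonical code_prod X Y := Code (fun p : X * Y => Node (enc p.1) (enc p.2)).
Canonical code_seq X := Code (fun s : seq X => enc_seq [seq enc x | x <- s]).

Lemma enc_boolE (b : bool) : enc b = if b then Node Leaf Leaf else Leaf.
Proof. by rewrite enc.unlock. Qed.

Lemma enc_0 : enc 0 = Leaf.
Proof. by rewrite enc.unlock. Qed.

Lemma enc_S (n : nat) : enc n.+1 = Node Leaf (enc n).
Proof. by rewrite enc.unlock. Qed.

Lemma enc_unit (u : unit) : enc u = Leaf.
Proof. by rewrite enc.unlock. Qed.

Lemma enc_pair X Y (x : X) (y : Y) : enc (x, y) = Node (enc x) (enc y).
Proof. by rewrite [in LHS]enc.unlock. Qed.

Lemma enc_none X : enc (@None X) = Leaf.
Proof. by rewrite enc.unlock. Qed.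

Lemma enc_some X (x : X) : enc (Some x) = Node Leaf (enc x).
Proof. by rewrite [in LHS]enc.unlock. Qed.

Lemma enc_nil X : enc (@nil X) = Leaf.
Proof. by rewrite enc.unlock. Qed.

Lemma enc_seqE X (s : seq X) : enc s = enc_seq [seq enc x | x <- s].
Proof. by rewrite [in LHS]enc.unlock. Qed.

Lemma enc_cons X (x : X) s : enc (x :: s) = Node (enc x) (enc s).
Proof. by rewrite !enc_seqE. Qed.

Definition encE := (enc_boolE, enc_0, enc_S, enc_unit, enc_pair, enc_none, enc_some,
  enc_nil, enc_cons).

Notation size_enc x := (dsize (enc x)).

Lemma dsize_gt0 a : 0 < dsize a. Proof. by case: a. Qed.

Lemma size_enc_pair X Y (x : X) (y : Y) :
  size_enc (x, y) = (size_enc x + size_enc y).+1.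
Proof. by rewrite enc_pair. Qed.

Lemma size_enc_nil X : size_enc (@nil X) = 1.
Proof. by rewrite enc_nil. Qed.

Lemma size_enc_cons X (x : X) s :
  size_enc (x :: s) = (size_enc x + size_enc s).+1.
Proof. by rewrite enc_cons. Qed.

Lemma size_enc_nat (n : nat) : size_enc n = n.*2.+1.
Proof. by elim: n => [|n IH]; rewrite encE // !dsizeE IH; lia. Qed.

Lemma size_enc_bool (b : bool) : size_enc b <= 3.
Proof. by rewrite enc_boolE; case: b. Qed.

Lemma size_enc_cat X (s1 s2 : seq X) :
  (size_enc (s1 ++ s2)).+1 = size_enc s1 + size_enc s2.
Proof.
elim: s1 => [|x s1 IH] /=; first by rewrite size_enc_nil.
by rewrite !size_enc_cons; lia.
Qed.

Lemma size_enc_take X (s : seq X) i : size_enc (take i s) <= size_enc s.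
Proof.
have := size_enc_cat (take i s) (drop i s).
by have := dsize_gt0 (enc (drop i s)); rewrite cat_take_drop; lia.
Qed.

Lemma size_enc_drop X (s : seq X) i : size_enc (drop i s) <= size_enc s.
Proof.
have := size_enc_cat (take i s) (drop i s).
by have := dsize_gt0 (enc (take i s)); rewrite cat_take_drop; lia.
Qed.

Lemma size_le_enc X (s : seq X) : size s < size_enc s.
Proof. by elim: s => [|x s IH] /=; rewrite ?size_enc_nil // size_enc_cons; lia. Qed.

Lemma size_enc_mem X (s : seq X) : all (fun x => size_enc x < size_enc s) s.
Proof.
elim: s => //= x s IH; rewrite size_enc_cons; apply/andP; split; first lia.
by apply: sub_all IH => y; lia.
Qed.

Lemma size_enc_bounded X (s : seq X) K :
  all (fun x => size_enc x <= K) s -> size_enc s <= size s * K.+1 + 1.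
Proof.
elim: s => [|x s IH] /=; first by rewrite size_enc_nil.
by move=> /andP[h /IH]; rewrite size_enc_cons mulSn; lia.
Qed.

Lemma size_enc_filter X (s : seq X) P : size_enc (filter P s) <= size_enc s.
Proof. by elim: s => //= x s IH; case: ifP; rewrite !size_enc_cons; lia. Qed.

Lemma run_size p a b t : run p a b t -> dsize b <= t.
Proof. by elim; move=> *; rewrite /charge ?dsizeE; lia. Qed.

Definition ptime X Y (f : X -> Y) : Prop :=
  exists p b, polyb b /\
    forall x, exists2 t, run p (enc x) (enc (f x)) t & t <= b (size_enc x).
Arguments ptime {X Y} f.

Lemma eq_ptime X Y (f g : X -> Y) :
  f =1 g -> ptime f -> ptime g.
Proof. by move=> fg [p [b [pb h]]]; exists p, b; split=> // x; rewrite -fg. Qed.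

Lemma ptime_size X Y (f : X -> Y) : ptime f ->
  exists2 b, polyb b & forall x, size_enc (f x) <= b (size_enc x).
Proof.
move=> [p [b [pb h]]]; exists b => // x; have [t ht tb] := h x.
exact: leq_trans (run_size ht) tb.
Qed.

Section Closure.
Context {E : codeType}.

Lemma pt_id : ptime (@id E).
Proof.
exists Id, (fun s => s + s); split; first by polyb_tac.
by move=> x; exists (charge (enc x) (enc x)) => //; exact: RunId.
Qed.

Fixpoint const_prog (a : data) : prog :=
  if a is Node b c then Pair (const_prog b) (const_prog c) else Const_leaf.

(** Slope and intercept of the running time: building a constant is charged the size of the
    discarded argument once per constructor. *)
Fixpoint const_time (a : data) : nat * nat :=
  if a is Node b c then ((const_time b).1 + (const_time c).1 + 1,
    (const_time b).2 + (const_time c).2 + dsize a) else (1, 1).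

Lemma pt_const Y (y : Y) : ptime (fun _ : E => y).
Proof.
exists (const_prog (enc y)), (fun s => s * (const_time (enc y)).1 + (const_time (enc y)).2).
split; first by polyb_tac.
move=> x; eexists; last exact: leqnn.
elim: (enc y) => [|a1 h1 a2 h2] /=; first by rewrite muln1; exact: RunConstLeaf.
have := RunPair h1 h2; rewrite /charge.
by congr run; rewrite /=; lia.
Qed.

Lemma pt_comp X Y (f : X -> Y) (g : E -> X) :
  ptime f -> ptime g -> ptime (fun e => f (g e)).
Proof.
move=> [p [b [pb hp]]] [q [b' [pb' hq]]].
exists (Seq q p), (fun s => b' s + b (b' s) + (s + b (b' s))).
split; first by polyb_tac.
move=> e; have [t ht tb] := hq e; have [t' ht' tb'] := hp (g e).
have hb : t' <= b (b' (size_enc e)).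
  by apply: leq_trans tb' _; case: pb => mb _; apply: mb; apply: leq_trans (run_size ht) tb.
eexists; first exact: RunSeq ht ht'.
by have := run_size ht'; rewrite /charge ?dsizeE; lia.
Qed.

Lemma pt_pair X Y (f : E -> X) (g : E -> Y) :
  ptime f -> ptime g -> ptime (fun e => (f e, g e)).
Proof.
move=> [p [b [pb hp]]] [q [b' [pb' hq]]].
exists (Pair p q), (fun s => (b s + b' s + (s + (b s + b' s))).+1).
split; first by polyb_tac.
move=> e; have [t ht tb] := hp e; have [t' ht' tb'] := hq e.
rewrite enc_pair; eexists; first exact: RunPair ht ht'.
by have := run_size ht'; have := run_size ht; rewrite /charge dsizeE; lia.
Qed.

Lemma pt_raw X Y (p : prog) (g : data -> data) (f : X -> Y) :
  (forall a, run p a (g a) (charge a (g a))) -> (forall a, dsize (g a) <= dsize a) ->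
  (forall x, enc (f x) = g (enc x)) -> ptime f.
Proof.
move=> hp hg hf; exists p, (fun s => s + s); split; first by polyb_tac.
by move=> x; rewrite hf; eexists; first exact: hp; rewrite /charge ?dsizeE; have := hg (enc x); lia.
Qed.

Lemma pt_raw_fst X Y (f : X -> Y) :
  (forall x, enc (f x) = dfst (enc x)) -> ptime f.
Proof. by apply: pt_raw RunFst _; case=> [|a b] //=; rewrite dsizeE; lia. Qed.

Lemma pt_raw_snd X Y (f : X -> Y) :
  (forall x, enc (f x) = dsnd (enc x)) -> ptime f.
Proof. by apply: pt_raw RunSnd _; case=> [|a b] //=; rewrite dsizeE; lia. Qed.

Lemma pt_fst X Y (f : E -> X * Y) :
  ptime f -> ptime (fun e => (f e).1).
Proof. by apply: pt_comp; apply: pt_raw_fst; case=> x y; rewrite enc_pair. Qed.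

Lemma pt_snd X Y (f : E -> X * Y) :
  ptime f -> ptime (fun e => (f e).2).
Proof. by apply: pt_comp; apply: pt_raw_snd; case=> x y; rewrite enc_pair. Qed.

Lemma pt_cast X Y (f : E -> X) (g : X -> Y) :
  (forall x, enc (g x) = enc x) -> ptime f -> ptime (fun e => g (f e)).
Proof.
move=> h [p [b [pb hp]]]; exists p, b; split=> // e.
by rewrite h; exact: hp.
Qed.

Lemma pt_test X Y (g : E -> X) (f1 f2 f : E -> Y) :
  ptime g -> ptime f1 -> ptime f2 ->
  (forall e, f e = if enc (g e) is Node _ _ then f1 e else f2 e) -> ptime f.
Proof.
move=> [p0 [b0 [pb0 h0]]] [p1 [b1 [pb1 h1]]] [p2 [b2 [pb2 h2]]] hf.
exists (If p0 p1 p2), (fun s => b0 s + (b1 s + b2 s) + (s + (b1 s + b2 s))).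
split; first by polyb_tac.
move=> e; have [t0 r0 l0] := h0 e; have [t1 r1 l1] := h1 e; have [t2 r2 l2] := h2 e.
rewrite hf; case: (enc (g e)) r0 => [|u v] r0.
  by eexists; first exact: RunIfFalse r0 r2; have := run_size r2; rewrite /charge ?dsizeE; lia.
by eexists; first exact: RunIfTrue r0 r1; have := run_size r1; rewrite /charge ?dsizeE; lia.
Qed.

Lemma pt_if Y (g : E -> bool) (f1 f2 : E -> Y) :
  ptime g -> ptime f1 -> ptime f2 -> ptime (fun e => if g e then f1 e else f2 e).
Proof. by move=> hg h1 h2; apply: pt_test hg h1 h2 _ => e; rewrite enc_boolE; case: (g e). Qed.

Lemma pt_cons X (f : E -> X) (g : E -> seq X) :
  ptime f -> ptime g -> ptime (fun e => f e :: g e).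
Proof.
move=> hf hg; have := pt_pair hf hg.
by apply: (pt_cast (g := fun p : X * seq X => p.1 :: p.2)) => -[x s]; rewrite !encE.
Qed.

Lemma pt_behead X (f : E -> seq X) :
  ptime f -> ptime (fun e => behead (f e)).
Proof. by apply: pt_comp; apply: pt_raw_snd; case=> [|x s]; rewrite encE. Qed.
End Closure.

Lemma pt_case E X Y (l : E -> seq X) (n : E -> Y)
    (c : E -> X -> seq X -> Y) :
  ptime l -> ptime n -> ptime (fun z : E * (X * seq X) => c z.1 z.2.1 z.2.2) ->
  ptime (fun e => if l e is x :: s then c e x s else n e).
Proof.
move=> hl hn hc.
have [p0 [b0 [pb0 h0]]] := hl.
have [p1 [b1 [pb1 h1]]] := hn.
have [p2 [b2 [pb2 h2]]] := hc.
pose k s := (s + b0 s).+1.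
exists (If p0 (Seq (Pair Id p0) p2) p1),
  (fun s => b0 s + (4 * k s + k s + b2 (k s) + b2 (k s) + b1 s) + (s + s + (b1 s + b2 (k s)))).
split; first by rewrite /k; polyb_tac.
move=> e; have [t0 r0 l0] := h0 e; have [t1 r1 l1] := h1 e.
case el: (l e) r0 => [|x s]; rewrite encE => r0.
  by eexists; first exact: RunIfFalse r0 r1; have := run_size r1; rewrite /charge /k; lia.
have [t2 r2 l2] := h2 (e, (x, s)).
have m2 : b2 (size_enc (e, (x, s))) <= b2 (k (size_enc e)).
  case: pb2 => mb _; apply: mb; rewrite /k size_enc_pair.
  by have := run_size r0; rewrite !dsizeE size_enc_pair; lia.
rewrite !enc_pair in r2; eexists; first exact: RunIfTrue r0 (RunSeq (RunPair (RunId _) r0) r2).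
have := run_size r0; have := run_size r2; rewrite /charge /= !dsizeE /k.
by move: m2 l2 l0; rewrite /k; lia.
Qed.

(** A unary number has the same encoding as a list of that many units, so case analysis on lists
    applies. *)
Lemma pt_nat_case E Y (l : E -> nat) (n : E -> Y)
    (c : E -> nat -> Y) :
  ptime l -> ptime n -> ptime (fun z : E * nat => c z.1 z.2) ->
  ptime (fun e => if l e is m.+1 then c e m else n e).
Proof.
move=> hl hn hc.
have hl' : ptime (fun e => nseq (l e) tt).
  by apply: (pt_cast (g := fun m => nseq m tt) _ hl); elim=> [|m IH]; rewrite /= !encE ?IH.
have hc' : ptime (fun z : E * (unit * seq unit) => c z.1 (size z.2.2)).
  apply: (pt_comp (g := fun z : E * (unit * seq unit) => (z.1, size z.2.2)) hc).
  apply: pt_pair; first exact: pt_fst pt_id.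
  apply: (pt_cast (g := size) _); last by do 2 apply: pt_snd; exact: pt_id.
  by elim=> [|[] s IH]; rewrite /= !encE ?IH.
apply: eq_ptime (pt_case (c := fun e _ s => c e (size s)) hl' hn hc') => e /=.
by case: (l e) => [|m] //=; rewrite size_nseq.
Qed.

Lemma pt_option_case E X Y (l : E -> option X)
    (n : E -> Y) (c : E -> X -> Y) :
  ptime l -> ptime n -> ptime (fun z : E * X => c z.1 z.2) ->
  ptime (fun e => if l e is Some x then c e x else n e).
Proof.
move=> hl hn hc.
have [p0 [b0 [pb0 h0]]] := hl.
have [p1 [b1 [pb1 h1]]] := hn.
have [p2 [b2 [pb2 h2]]] := hc.
pose k s := (s + b0 s).+1.
exists (If p0 (Seq (Pair Id (Seq p0 Snd)) p2) p1),
  (fun s => b0 s + (9 * k s + k s + b2 (k s) + b2 (k s) + b1 s) + (s + s + (b1 s + b2 (k s)))).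
split; first by rewrite /k; polyb_tac.
move=> e; have [t0 r0 l0] := h0 e; have [t1 r1 l1] := h1 e.
case el: (l e) r0 => [x|]; rewrite encE => r0; last first.
  by eexists; first exact: RunIfFalse r0 r1; have := run_size r1; rewrite /charge /k; lia.
have [t2 r2 l2] := h2 (e, x).
have m2 : b2 (size_enc (e, x)) <= b2 (k (size_enc e)).
  case: pb2 => mb _; apply: mb; rewrite /k size_enc_pair.
  by have := run_size r0; rewrite !dsizeE; lia.
rewrite enc_pair in r2; eexists; first exact: RunIfTrue r0 (RunSeq (RunPair (RunId _) (RunSeq r0 (RunSnd _))) r2).
have := run_size r0; have := run_size r2; rewrite /charge /= !dsizeE /k.
by move: m2 l2 l0; rewrite /k; lia.
Qed.

Lemma while_run g p (st : nat -> data) N T :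
  (forall i, i <= N -> dsize (st i) <= T) ->
  (forall i, i < N -> exists u v t, run g (st i) (Node u v) t /\ t <= T) ->
  (exists2 t, run g (st N) Leaf t & t <= T) ->
  (forall i, i < N -> exists2 t, run p (st i) (st i.+1) t & t <= T) ->
  exists2 t, run (While g p) (st 0) (st N) t & t <= N.+1 * (4 * T).
Proof.
elim: N st => [|N IH] st hs hg [t0 r0 l0] hp.
  eexists; first exact: RunWhileStop r0.
  by have := hs 0 isT; rewrite /charge ?dsizeE; lia.
have [t r l] : exists2 t, run (While g p) (st 1) (st N.+1) t & t <= N.+1 * (4 * T).
  apply: (IH (fun i => st i.+1)) => [i iN|i iN||i iN]; [exact: hs|exact: hg| |exact: hp].
  by exists t0.
have [u [v [tg [rg lg]]]] := hg 0 isT; have [tp rp lp] := hp 0 isT.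
eexists; first exact: RunWhileStep rg rp r.
by have := hs 0 isT; have := hs 1 isT; rewrite /charge [N.+2 * _]mulSn; lia.
Qed.

(* An accumulator may double at every step, hence the bound on the size of all
   intermediate values. *)
Lemma pt_foldl E X S (l : E -> seq X) (s0 : E -> S)
    (g : E -> S -> X -> S) b :
  polyb b ->
  (forall e i, size_enc (foldl (g e) (s0 e) (take i (l e))) <= b (size_enc e)) ->
  ptime l -> ptime s0 -> ptime (fun z : E * S * X => g z.1.1 z.1.2 z.2) ->
  ptime (fun e => foldl (g e) (s0 e) (l e)).
Proof.
move=> pb hb hl hs hg.
(* The loop state holds the environment, the rest of the list and the accumulator. The rest serves
   as the test: it is [Leaf] exactly when the list is exhausted. *)
pose step z := if z.2.1 is x :: s then (z.1, (s, g z.1 z.2.2 x)) else (z : E * (seq X * S)).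
have hstep : ptime step.
  pose step' (z : E * (seq X * S)) x (s : seq X) := (z.1, (s, g z.1 z.2.2 x)).
  apply: (pt_case (c := step')); [by apply: pt_fst; apply: pt_snd; exact: pt_id|exact: pt_id|].
  apply: pt_pair; first by do 2 apply: pt_fst; exact: pt_id.
  apply: pt_pair; first by do 2 apply: pt_snd; exact: pt_id.
  apply: (pt_comp (g := fun z : E * (seq X * S) * (X * seq X) => (z.1.1, z.1.2.2, z.2.1)) hg).
  apply: pt_pair; last by apply: pt_fst; apply: pt_snd; exact: pt_id.
  apply: pt_pair; first by do 2 apply: pt_fst; exact: pt_id.
  by apply: pt_snd; apply: pt_snd; apply: pt_fst; exact: pt_id.
have htest : ptime (fun z : E * (seq X * S) => z.2.1).
  by apply: pt_fst; apply: pt_snd; exact: pt_id.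
have hinit : ptime (fun e => (e, (l e, s0 e))).
  by apply: pt_pair; [exact: pt_id|exact: pt_pair].
have hout : ptime (fun z : E * (seq X * S) => z.2.2).
  by apply: pt_snd; apply: pt_snd; exact: pt_id.
have [bl pbl hbl] := ptime_size hl.
have [pi [bi [pbi hi]]] := hinit.
have [ps [bs [pbs hps]]] := hstep.
have [pt [bt [pbt ht]]] := htest.
have [po [bo [pbo ho]]] := hout.
pose k s := (s + (bl s + b s).+1).+1.
pose T s := k s + (bs (k s) + bt (k s)).
pose w s := (bl s).+1 * (4 * T s).
exists (Seq pi (Seq (While pt ps) po)),
  (fun s => bi s + (w s + bo (k s) + (bi s + bo (k s))) + (s + bo (k s))).
split; first by rewrite /w /T /k; polyb_tac.
move=> e.
pose z i := (e, (drop i (l e), foldl (g e) (s0 e) (take i (l e)))).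
have zk i : size_enc (z i) <= k (size_enc e).
  rewrite /z !size_enc_pair /k !ltnS leq_add2l ltnS leq_add //.
  exact: leq_trans (size_enc_drop _ _) (hbl e).
have [ti ri li] := hi e.
have zT i : size_enc (z i) <= T (size_enc e).
  by apply: leq_trans (zk i) _; rewrite /T leq_addr.
have hm (f : nat -> nat) i : polyb f -> f (size_enc (z i)) <= f (k (size_enc e)).
  by case=> mf _; apply: mf; exact: zk.
have [||||tw rw lw] := @while_run pt ps (fun i => enc (z i)) (size (l e)) (T (size_enc e)).
- by move=> i _; exact: zT.
- move=> i il; have [t r lt] := ht (z i).
  case edl : (drop i (l e)) => [|x s].
    by move/(congr1 size): edl; rewrite size_drop /=; lia.
  exists (enc x), (enc s), t; split; first by move: r; rewrite /z /= edl enc_cons.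
  by apply: leq_trans lt _; have := hm _ i pbt; rewrite /T; lia.
- have [t r lt] := ht (z (size (l e))).
  exists t; first by move: r; rewrite /z /= drop_size enc_nil.
  by apply: leq_trans lt _; have := hm _ (size (l e)) pbt; rewrite /T; lia.
- move=> i il; have [t r lt] := hps (z i).
  have -> : z i.+1 = step (z i).
    rewrite /z /step /= -addn1 takeD foldl_cat addnC -drop_drop.
    case edl : (drop i (l e)) => [|x s]; last by rewrite /= take0 drop0.
    by move/(congr1 size): edl; rewrite size_drop /=; lia.
  exists t => //.
  by apply: leq_trans lt _; have := hm _ i pbs; rewrite /T; lia.
have [to ro lo] := ho (z (size (l e))).
have zN : (z (size (l e))).2.2 = foldl (g e) (s0 e) (l e) by rewrite /z take_size.
have z0 : z 0 = (e, (l e, s0 e)) by rewrite /z take0 drop0.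
rewrite zN in ro; rewrite /= z0 in rw.
eexists; first exact: RunSeq ri (RunSeq rw ro).
have lw' : tw <= w (size_enc e).
  apply: leq_trans lw _; rewrite /w leq_mul // ltnS.
  by apply: leq_trans (hbl e); exact: ltnW (size_le_enc _).
have := run_size ri; have := run_size ro.
by have := hm _ (size (l e)) pbo; rewrite /charge ?dsizeE; lia.
Qed.

Lemma size_foldl_add X S (g : S -> X -> S) (h : nat -> nat) K s l :
  {homo h : m n / m <= n} -> all (fun x => size_enc x <= K) l ->
  (forall s x, size_enc (g s x) <= size_enc s + h (size_enc x)) ->
  size_enc (foldl g s l) <= size_enc s + size l * h K.
Proof.
move=> mh + hg; elim: l s => /= [|x l IH] s; first by rewrite addn0.
case/andP=> xK /(IH (g s x)) h1; rewrite mulSn.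
have := hg s x; have := mh _ _ xK; lia.
Qed.

(** Growth by an amount independent of the accumulator adds up to a polynomial along the list, so no
    bound on intermediate values has to be supplied. *)
Lemma pt_foldl_add E X S (l : E -> seq X) (s0 : E -> S) (g : E -> S -> X -> S) b :
  polyb b ->
  (forall e s x, size_enc (g e s x) <= size_enc s + b (size_enc e + size_enc x)) ->
  ptime l -> ptime s0 -> ptime (fun z : E * S * X => g z.1.1 z.1.2 z.2) ->
  ptime (fun e => foldl (g e) (s0 e) (l e)).
Proof.
move=> pb hb hl hs hg.
have [bl pbl hbl] := ptime_size hl.
have [bs pbs hbs] := ptime_size hs.
apply: (pt_foldl (b := fun s => bs s + bl s * b (s + bl s))) => //; first by polyb_tac.
move=> e i; have mb := pb.1.
have mh : {homo (fun t => b (size_enc e + t)) : m n / m <= n}.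
  by move=> m n mn; apply: mb; rewrite leq_add2l.
have hl' := size_enc_take (l e) i.
have hK : all (fun x => size_enc x <= size_enc (l e)) (take i (l e)).
  by apply: sub_all (size_enc_mem _) => x; lia.
apply: leq_trans (size_foldl_add _ mh hK (hb e)) _.
apply: leq_add (hbs e) (leq_mul _ (mh _ _ (hbl e))).
by have := size_le_enc (take i (l e)); have := hbl e; lia.
Qed.

Lemma pt_rev E X (l : E -> seq X) : ptime l -> ptime (fun e => rev (l e)).
Proof.
move=> hl.
apply: (@eq_ptime _ _ (fun e => foldl (fun s x => x :: s) [::] (l e))) => [e|].
  by rewrite -(revK (l e)) foldl_rev revK; elim: (rev _) => //= x s ->.
apply: (pt_foldl_add (b := succn)) hl (pt_const _) _ => [|e s x|]; first by polyb_tac.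
  by rewrite size_enc_cons; lia.
by apply: pt_cons; [apply: pt_snd|apply: pt_snd; apply: pt_fst]; exact: pt_id.
Qed.

Lemma pt_foldr_add E X S (l : E -> seq X) (s0 : E -> S) (g : E -> X -> S -> S) b :
  polyb b ->
  (forall e s x, size_enc (g e x s) <= size_enc s + b (size_enc e + size_enc x)) ->
  ptime l -> ptime s0 -> ptime (fun z : E * S * X => g z.1.1 z.2 z.1.2) ->
  ptime (fun e => foldr (g e) (s0 e) (l e)).
Proof.
move=> pb hb hl hs hg.
apply: (@eq_ptime _ _ (fun e => foldl (fun s x => g e x s) (s0 e) (rev (l e)))) => [e|].
  by rewrite foldl_rev.
exact: pt_foldl_add pb hb (pt_rev hl) hs hg.
Qed.

Lemma pt_map E X Y (l : E -> seq X) (g : E -> X -> Y) :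
  ptime l -> ptime (fun z : E * X => g z.1 z.2) -> ptime (fun e => map (g e) (l e)).
Proof.
move=> hl hg; have [b pb hb] := ptime_size hg.
apply: (@eq_ptime _ _ (fun e => foldr (fun x s => g e x :: s) [::] (l e))) => [e|].
  by elim: (l e) => //= x s ->.
apply: (pt_foldr_add (b := fun s => (b s.+1).+1)) hl (pt_const _) _ => [|e s x|].
- by polyb_tac.
- by rewrite size_enc_cons; have := hb (e, x); rewrite size_enc_pair /=; lia.
apply: pt_cons; last by apply: pt_snd; apply: pt_fst; exact: pt_id.
apply: (pt_comp (g := fun z : E * seq Y * X => (z.1.1, z.2)) hg).
by apply: pt_pair; [do 2 apply: pt_fst|apply: pt_snd]; exact: pt_id.
Qed.

Lemma pt_filter E X (l : E -> seq X) (g : E -> X -> bool) :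
  ptime l -> ptime (fun z : E * X => g z.1 z.2) -> ptime (fun e => filter (g e) (l e)).
Proof.
move=> hl hg.
apply: (@eq_ptime _ _ (fun e => foldr (fun x s => if g e x then x :: s else s) [::] (l e))).
  by move=> e; elim: (l e) => //= x s ->.
apply: (pt_foldr_add (b := succn)) hl (pt_const _) _ => [|e s x|].
- by polyb_tac.
- by case: ifP; rewrite ?size_enc_cons; lia.
apply: pt_if; last by apply: pt_snd; apply: pt_fst; exact: pt_id.
  apply: (pt_comp (g := fun z : E * seq X * X => (z.1.1, z.2)) hg).
  by apply: pt_pair; [do 2 apply: pt_fst|apply: pt_snd]; exact: pt_id.
by apply: pt_cons; [apply: pt_snd|apply: pt_snd; apply: pt_fst]; exact: pt_id.
Qed.

Lemma pt_cat E X (l1 l2 : E -> seq X) : ptime l1 -> ptime l2 -> ptime (fun e => l1 e ++ l2 e).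
Proof.
move=> h1 h2.
apply: (@eq_ptime _ _ (fun e => foldr cons (l2 e) (l1 e))) => [e|].
  by elim: (l1 e) => //= x s ->.
apply: (pt_foldr_add (b := succn)) h1 h2 _ => [|e s x|]; first by polyb_tac.
  by rewrite size_enc_cons; lia.
by apply: pt_cons; [apply: pt_snd|apply: pt_snd; apply: pt_fst]; exact: pt_id.
Qed.

Lemma pt_flatten E X (l : E -> seq (seq X)) : ptime l -> ptime (fun e => flatten (l e)).
Proof.
move=> hl.
apply: (pt_foldr_add (b := id) (g := fun _ => cat)) hl (pt_const _) _ => [|e s x|].
- by polyb_tac.
- by have := size_enc_cat x s; lia.
by apply: pt_cat; [apply: pt_snd|apply: pt_snd; apply: pt_fst]; exact: pt_id.
Qed.

Lemma pt_and E (a b : E -> bool) : ptime a -> ptime b -> ptime (fun e => a e && b e).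
Proof.
by move=> ha hb; apply: eq_ptime (pt_if ha hb (pt_const false)) => e; case: (a e).
Qed.

Lemma pt_or E (a b : E -> bool) : ptime a -> ptime b -> ptime (fun e => a e || b e).
Proof.
by move=> ha hb; apply: eq_ptime (pt_if ha (pt_const true) hb) => e; case: (a e).
Qed.

Lemma pt_not E (a : E -> bool) : ptime a -> ptime (fun e => ~~ a e).
Proof.
move=> ha; apply: eq_ptime (pt_if ha (pt_const false) (pt_const true)) => e.
by case: (a e).
Qed.

Lemma pt_eqb E (a b : E -> bool) : ptime a -> ptime b -> ptime (fun e => a e == b e).
Proof.
move=> ha hb; apply: eq_ptime (pt_if ha hb (pt_not hb)) => e.
by case: (a e); case: (b e).
Qed.

Lemma pt_has E X (l : E -> seq X) (g : E -> X -> bool) :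
  ptime l -> ptime (fun z : E * X => g z.1 z.2) -> ptime (fun e => has (g e) (l e)).
Proof.
move=> hl hg.
apply: (eq_ptime _ (pt_case (c := fun _ _ _ => true) (pt_filter hl hg) (pt_const false) (pt_const _))) => e.
by elim: (l e) => //= x s; case: (g e x).
Qed.

Lemma pt_succ E (a : E -> nat) : ptime a -> ptime (fun e => (a e).+1).
Proof.
move=> ha; apply: (pt_cast (g := fun p : unit * nat => p.2.+1)) (pt_pair (pt_const tt) ha).
by case=> -[] m; rewrite !encE.
Qed.

Lemma pt_pred E (a : E -> nat) : ptime a -> ptime (fun e => (a e).-1).
Proof.
move=> ha.
apply: (eq_ptime _ (pt_nat_case (c := fun _ m => m) ha (pt_const 0) (pt_snd pt_id))) => e.
by case: (a e).
Qed.

Lemma pt_units E (a : E -> nat) : ptime a -> ptime (fun e => nseq (a e) tt).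
Proof. by apply: pt_cast => m; elim: m => [|m IH]; rewrite /= !encE ?IH. Qed.

Lemma pt_size E X (l : E -> seq X) : ptime l -> ptime (fun e => size (l e)).
Proof.
move=> hl.
apply: (@eq_ptime _ _ (fun e => size (map (fun=> tt) (l e)))) => [e|].
  by rewrite size_map.
apply: (pt_cast (g := size)) (pt_map hl (pt_const tt)).
by elim=> [|[] s IH]; rewrite /= !encE ?IH.
Qed.


Lemma pt_iter E S (n : E -> nat) (s0 : E -> S) (g : E -> S -> S) b :
  polyb b -> (forall e i, i <= n e -> size_enc (iter i (g e) (s0 e)) <= b (size_enc e)) ->
  ptime n -> ptime s0 -> ptime (fun z : E * S => g z.1 z.2) ->
  ptime (fun e => iter (n e) (g e) (s0 e)).
Proof.
move=> pb hb hn hs hg.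
have eq_iter e i : foldl (fun s (_ : unit) => g e s) (s0 e) (nseq i tt) = iter i (g e) (s0 e).
  by elim: i (s0 e) => //= i IH s; rewrite IH -iterS iterSr.
apply: (@eq_ptime _ _ (fun e => foldl (fun s (_ : unit) => g e s) (s0 e) (nseq (n e) tt))).
  by move=> e.
apply: (pt_foldl pb) (pt_units hn) hs _ => [e i|]; last first.
  by apply: (pt_comp (g := fun z : E * S * unit => z.1) hg); apply: pt_fst; exact: pt_id.
have -> : take i (nseq (n e) tt) = nseq (minn i (n e)) tt.
  by elim: (n e) i => [|m IH] [|i] //=; rewrite IH minnSS.
by rewrite eq_iter hb // geq_minr.
Qed.

(** A hook, redefined whenever further closure lemmas are available. *)
Ltac pt_user := fail.
Ltac pt_step := first
  [ assumption | exact: pt_const | exact: pt_id | pt_user | apply: pt_fst | apply: pt_snd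
  | apply: pt_pair | apply: pt_if | apply: pt_and | apply: pt_or | apply: pt_not
  | apply: pt_cons | apply: pt_cat | apply: pt_map | apply: pt_filter
  | apply: pt_flatten | apply: pt_rev | apply: pt_size | apply: pt_has
  | apply: pt_succ | apply: pt_eqb
  | match goal with h : @ptime ?X _ ?f |- ptime (fun e => ?f _) => apply: (pt_comp h) end ].
Ltac pt := repeat pt_step.

Lemma pt_addn E (a b : E -> nat) : ptime a -> ptime b -> ptime (fun e => a e + b e).
Proof.
move=> ha hb.
apply: (@eq_ptime _ _ (fun e => size (nseq (a e) tt ++ nseq (b e) tt))) => [e|].
  by rewrite size_cat !size_nseq.
by apply: pt_size; apply: pt_cat; exact: pt_units.
Qed.

Lemma pt_mulc E c (a : E -> nat) : ptime a -> ptime (fun e => c * a e).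
Proof.
move=> ha; elim: c => [|c IH]; first exact: pt_const.
by apply: eq_ptime (pt_addn ha IH) => e; rewrite mulSn.
Qed.

Lemma pt_subn E (a b : E -> nat) : ptime a -> ptime b -> ptime (fun e => a e - b e).
Proof.
move=> ha hb.
apply: (@eq_ptime _ _ (fun e => iter (b e) predn (a e))) => [e|].
  by elim: (b e) => [|m IH]; rewrite ?subn0 // iterS IH subnS.
have [ba pba hba] := ptime_size ha.
apply: (pt_iter pba) hb ha (pt_pred (pt_snd pt_id)) => e i _.
apply: leq_trans (hba e).
by rewrite !size_enc_nat ltnS leq_double; elim: i => //= i; lia.
Qed.

Lemma pt_leq E (a b : E -> nat) : ptime a -> ptime b -> ptime (fun e => a e <= b e).
Proof.
move=> ha hb.
apply: (eq_ptime _ (pt_nat_case (c := fun _ _ => false) (pt_subn ha hb) (pt_const true) (pt_const _))).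
by move=> e; rewrite -subn_eq0; case: (a e - b e).
Qed.

Lemma pt_eqn E (a b : E -> nat) : ptime a -> ptime b -> ptime (fun e => a e == b e).
Proof.
move=> ha hb; apply: eq_ptime (pt_and (pt_leq ha hb) (pt_leq hb ha)) => e.
by rewrite eqn_leq.
Qed.

Ltac pt_arith := first [apply: pt_addn | apply: pt_mulc | apply: pt_leq | apply: pt_eqn].
Ltac pt_user ::= pt_arith.

Lemma pt_zip E X Y (l1 : E -> seq X) (l2 : E -> seq Y) :
  ptime l1 -> ptime l2 -> ptime (fun e => zip (l1 e) (l2 e)).
Proof.
move=> h1 h2.
pose g (st : seq Y * seq (X * Y)) x :=
  if st.1 is y :: s then (s, (x, y) :: st.2) else st.
apply: (@eq_ptime _ _ (fun e => rev (foldl g (l2 e, [::]) (l1 e)).2)) => [e|].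
  suff h s1 s2 acc : (foldl g (s2, acc) s1).2 = catrev (zip s1 s2) acc.
    by rewrite h -[RHS]revK.
  elim: s1 s2 acc => [|x s1 IH] [|y s2] acc //=; last exact: IH.
  by rewrite IH; case: (s1).
apply: pt_rev; apply: pt_snd.
apply: (pt_foldl_add (b := fun s => s.+2) (g := fun _ => g)) h1 _ _ => [|e s x||].
- by polyb_tac.
- rewrite /g; case: s => [[|y s] acc] /=; first lia.
  by rewrite !size_enc_pair !size_enc_cons size_enc_pair; lia.
- by pt.
apply: (pt_case (c := fun (z : E * (seq Y * seq (X * Y)) * X) y s =>
  (s, (z.2, y) :: z.1.2.2))); by pt.
Qed.

Lemma pt_iota E (a : E -> nat) : ptime a -> ptime (fun e => iota 0 (a e)).
Proof.
move=> ha.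
have hi n : iter n (fun s => size s :: s) [::] = rev (iota 0 n).
  elim: n => // n IH.
  by rewrite iterS IH size_rev size_iota -[n.+1]addn1 iotaD rev_cat.
apply: (@eq_ptime _ _ (fun e => rev (iter (a e) (fun s => size s :: s) [::]))).
  by move=> e; rewrite hi revK.
have [b pb hb] := ptime_size ha.
apply: pt_rev; apply: (pt_iter (b := fun s => b s * (b s).+1 + 1)) ha (pt_const _) _.
- by polyb_tac.
- move=> e i ia; rewrite hi.
  have := hb e; rewrite size_enc_nat => hb'.
  apply: leq_trans (size_enc_bounded (K := b (size_enc e)) _) _.
    apply/allP => x; rewrite mem_rev mem_iota => /andP[_ xi].
    by rewrite size_enc_nat; lia.
  by rewrite size_rev size_iota leq_add2r leq_mul //; lia.
by pt.
Qed.

Definition node := (nat * bool)%type.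
Definition darc := (node * node)%type.

Lemma pt_eq_node E (a b : E -> node) : ptime a -> ptime b -> ptime (fun e => a e == b e).
Proof.
move=> ha hb.
apply: (@eq_ptime _ _ (fun e => ((a e).1 == (b e).1) && ((a e).2 == (b e).2))) => [e|].
  by case: (a e) (b e) => ? ? [].
by pt.
Qed.

Lemma pt_eq_arc E (a b : E -> darc) : ptime a -> ptime b -> ptime (fun e => a e == b e).
Proof.
move=> ha hb.
apply: (@eq_ptime _ _ (fun e => ((a e).1 == (b e).1) && ((a e).2 == (b e).2))) => [e|].
  by case: (a e) (b e) => ? ? [].
by apply: pt_and; apply: pt_eq_node; pt.
Qed.

Ltac pt_list := first [pt_arith | apply: pt_zip | apply: pt_iota | apply: pt_eq_node | apply: pt_eq_arc].
Ltac pt_user ::= pt_list.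

Lemma pt_mem_node E (x : E -> node) (l : E -> seq node) :
  ptime x -> ptime l -> ptime (fun e => x e \in l e).
Proof.
move=> hx hl; apply: (@eq_ptime _ _ (fun e => has (fun y => y == x e) (l e))) => [e|].
  by rewrite has_pred1.
apply: pt_has => //; apply: pt_eq_node; first by pt.
by apply: (pt_comp hx); pt.
Qed.

Lemma pt_mem_arc E (x : E -> darc) (l : E -> seq darc) :
  ptime x -> ptime l -> ptime (fun e => x e \in l e).
Proof.
move=> hx hl; apply: (@eq_ptime _ _ (fun e => has (fun y => y == x e) (l e))) => [e|].
  by rewrite has_pred1.
apply: pt_has => //; apply: pt_eq_arc; first by pt.
by apply: (pt_comp hx); pt.
Qed.

Lemma pt_count_arc E (x : E -> darc) (l : E -> seq darc) :
  ptime x -> ptime l -> ptime (fun e => count_mem (x e) (l e)).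
Proof.
move=> hx hl; apply: (@eq_ptime _ _ (fun e => size [seq y <- l e | y == x e])) => [e|].
  by rewrite size_filter.
apply: pt_size; apply: pt_filter => //; apply: pt_eq_arc; first by pt.
by apply: (pt_comp hx); pt.
Qed.

Lemma pt_rem_arc E (x : E -> darc) (l : E -> seq darc) :
  ptime x -> ptime l -> ptime (fun e => rem (x e) (l e)).
Proof.
move=> hx hl.
(* [rem] keeps the tail behind the removed entry, which a fold does not see; hence the pair of the
   tail and the tail without the entry. The second component may be reset to the first, so its
   growth is not additive and [pt_foldl] is used directly. *)
pose g e y (st : seq darc * seq darc) := (y :: st.1, if y == x e then st.1 else y :: st.2).
have hg e s : foldr (g e) ([::], [::]) s = (s, rem (x e) s).
  by elim: s => //= y s ->; rewrite /g /=; case: eqP.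
apply: (@eq_ptime _ _ (fun e => (foldr (g e) ([::], [::]) (l e)).2)) => [e|].
  by rewrite hg.
have hrem e s : size_enc (rem (x e) s) <= size_enc s.
  elim: s => //= y s IH; case: eqP => _; rewrite !size_enc_cons; lia.
have [b pb hb] := ptime_size hl.
apply: (@eq_ptime _ _ (fun e => (foldl (fun s x => g e x s) ([::], [::]) (rev (l e))).2)) => [e|].
  by rewrite foldl_rev.
apply: pt_snd; apply: (pt_foldl (b := fun s => (b s + b s).+1)) (pt_rev hl) (pt_const _) _.
- by polyb_tac.
- move=> e i; rewrite take_rev foldl_rev hg size_enc_pair ltnS.
  apply: leq_add; first exact: leq_trans (size_enc_drop _ _) (hb e).
  exact: leq_trans (hrem e _) (leq_trans (size_enc_drop _ _) (hb e)).
apply: pt_pair; first by pt.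
apply: pt_if; try by pt.
Qed.

(** * The algorithm *)

Definition edges_of (rows : seq (seq (option data))) : seq (nat * nat) :=
  flatten [seq [seq (ur.1, ve.1) | ve <- zip (iota 0 (size ur.2)) ur.2 & isSome ve.2]
          | ur <- zip (iota 0 (size rows)) rows].

(* Every vertex v is split into an entrance (v, false) and an exit (v, true);
   the arc between them carries the capacity of v, edge arcs are uncapacitated. *)
Definition outn (v : nat) : node := (v, true).
Definition inn (v : nat) : node := (v, false).
Definition swp (a : darc) : darc := (a.2, a.1).

Definition edge_arcs (es : seq (nat * nat)) : seq darc := [seq (outn e.1, inn e.2) | e <- es].
Definition node_arcs (vs : seq nat) : seq darc := [seq (inn v, outn v) | v <- vs].

Definition residual (ea na : seq darc) (B : nat) (F : seq darc) : seq darc :=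
  ea ++ [seq a <- na | count_mem a F < B] ++ [seq swp a | a <- F].

(* A node that has been reached, with the arcs of a path to it, last arc first. *)
Definition entry := (node * seq darc)%type.

Definition bfs_add (st acc : seq entry) (a : darc) : seq entry :=
  if a.2 \in unzip1 acc then acc
  else if [seq en <- st | en.1 == a.1] is en :: _ then (a.2, a :: en.2) :: acc else acc.
Definition bfs_step (arcs : seq darc) (st : seq entry) : seq entry :=
  foldl (bfs_add st) st arcs.
Definition bfs (arcs : seq darc) (i : nat) (init : seq node) : seq entry :=
  iter i (bfs_step arcs) [seq (v, [::]) | v <- init].

Definition flip (F : seq darc) (a : darc) : seq darc :=
  if swp a \in F then rem (swp a) F else a :: F.

Definition origin (en : entry) : node := foldl (fun _ a => a.1) en.1 en.2.

Definition augment (ea na : seq darc) (B D : nat) (T : seq node)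
    (FZ : seq darc * seq node) : seq darc * seq node :=
  if [seq en <- bfs (residual ea na B FZ.1) D FZ.2 | en.1 \in T] is en :: _
  then (foldl flip FZ.1 en.2, [seq z <- FZ.2 | z != origin en]) else FZ.

Definition flow (ea na : seq darc) (B D : nat) (S T : seq node) : seq darc * seq node :=
  iter (size S) (augment ea na B D T) ([::], S).

Definition sym_arcs (H : seq (nat * nat)) : seq darc :=
  [seq (outn e.1, outn e.2) | e <- H] ++ [seq (outn e.2, outn e.1) | e <- H].
Definition flow_edges (F : seq darc) : seq (nat * nat) := [seq (a.1.1, a.2.1) | a <- F & a.1.2].

Definition radius (l : nat) : nat := 16 * l.

Definition sources (A : seq nat) (row : seq bool) : seq node :=
  [seq outn p.1 | p <- zip A (behead row) & p.2].
Definition sinks (r : nat) (A : seq nat) (row : seq bool) : seq node :=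
  outn r :: [seq outn p.1 | p <- zip A (behead row) & ~~ p.2].

Definition unmerged (l : nat) (H : seq (nat * nat)) (A : seq nat) (S T : seq node) : seq nat :=
  [seq a <- A | ~~ ((outn a \in S) && (outn a \in unzip1 (bfs (sym_arcs H) (2 * radius l) T)))].

Definition attempt (ea na : seq darc) (r l : nat) (A : seq nat) (row : seq bool) :
    seq nat * seq (nat * nat) :=
  let H := flow_edges (flow ea na l (radius l) (sources A row) (sinks r A row)).1 in
  (unmerged l H A (sources A row) (sinks r A row), H).

(* Sylvester's construction: two distinct columns of the matrix differ in half of
   the rows.  Column 0 is constantly false and belongs to the root, which is
   therefore always a sink. *)
Definition sylvester (fam : seq (seq bool)) : seq (seq bool) :=
  [seq h ++ h | h <- fam] ++ [seq h ++ [seq ~~ b | b <- h] | h <- fam].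
Definition hadamard (k : nat) : seq (seq bool) :=
  iter k (fun fam => if size fam <= k then sylvester fam else fam) [:: [:: false]].

(* ((active terminals, selected edges), (current guess of the LP value, bound on
   the hops from any terminal to an active one or to the root)). *)
Definition state := ((seq nat * seq (nat * nat)) * (nat * nat))%type.

Definition successes (ea na : seq darc) (r l : nat) (A : seq nat) :
    seq (seq nat * seq (nat * nat)) :=
  [seq c <- [seq attempt ea na r l A row | row <- hadamard (size A)]
  | size A <= 48 * (size A - size c.1)].

Definition phase (ea na : seq darc) (r : nat) (st : state) : state :=
  if st.1.1 is [::] then st
  else if successes ea na r st.2.1 st.1.1 is c :: _
  then ((c.1, c.2 ++ st.1.2), (st.2.1, st.2.2 + 2 * radius st.2.1))
  else (st.1, (st.2.1.+1, st.2.2)).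

Definition tree_edges (st : seq entry) : seq (nat * nat) :=
  flatten [seq if en.2 is a :: _ then [:: (a.2.1, a.1.1)] else [::] | en <- st].

Definition input := (seq (seq (option data)) * (nat * (seq bool * data)))%type.

Definition terminals (i : input) : seq nat :=
  [seq p.1 | p <- zip (iota 0 (size i.1)) i.2.2.1 & p.2 && (p.1 != i.2.1)].

Definition final_state (i : input) : state :=
  iter (size i.1 + size i.1)
    (phase (edge_arcs (edges_of i.1)) (node_arcs (iota 0 (size i.1))) i.2.1)
    ((terminals i, [::]), (1, 0)).

Definition algorithm (i : input) : seq nat * seq (nat * nat) :=
  let st := final_state i in
  let tr := bfs (sym_arcs st.1.2) st.2.2 [:: outn i.2.1] in
  ([seq en.1.1 | en <- tr], tree_edges tr).

(** * Size bounds and polynomial running time of the algorithm *)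

Lemma swpK : involutive swp. Proof. by case. Qed.

Section BfsFacts.
Variables (arcs : seq darc) (init : seq node).
Local Notation st i := (bfs arcs i init).

Lemma bfs_ind (P : nat -> entry -> Prop) :
  (forall v, v \in init -> P 0 (v, [::])) ->
  (forall i en, P i en -> P i.+1 en) ->
  (forall i a en, a \in arcs -> en.1 = a.1 -> P i en -> P i.+1 (a.2, a :: en.2)) ->
  forall i en, en \in st i -> P i en.
Proof.
move=> h0 hS ha; elim=> [|i IH] en; first by case/mapP=> v vi ->; exact: h0.
rewrite [st _]/=; move: (st i) IH => s0 IH.
rewrite /bfs_step.
have: {subset arcs <= arcs} by [].
have hacc : forall en, en \in s0 -> P i.+1 en by move=> e /IH; exact: hS.
elim: {1 3}arcs {1 3}s0 hacc => [|a l IHl] acc hacc sl /=; first exact: hacc.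
apply: IHl => [e|b bl]; last by apply: sl; rewrite inE bl orbT.
rewrite /bfs_add; case: ifP => _; first exact: hacc.
case ef : [seq _ <- _ | _] => [|f fs]; first exact: hacc.
have: f \in [seq e <- s0 | e.1 == a.1] by rewrite ef mem_head.
rewrite mem_filter => /andP[/eqP fa fs0].
rewrite inE => /orP[/eqP->|]; last exact: hacc.
by apply: ha fa (IH _ fs0); apply: sl; rewrite mem_head.
Qed.

Lemma bfs_sub i en : en \in st i ->
  [/\ (en.1 \in init) || (en.1 \in unzip2 arcs), {subset en.2 <= arcs} & size en.2 <= i].
Proof.
move: i en; apply: bfs_ind => [v vi|i en [h1 h2 h3]|i a en aA _ [h1 h2 h3]].
- by split=> //=; rewrite vi.
- by split=> //; exact: leqW.
split=> //=; first by rewrite map_f ?orbT.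
by move=> b; rewrite inE => /orP[/eqP->|/h2].
Qed.

Lemma size_bfs i : size (st i) <= size init + i * size arcs.
Proof.
have h l acc s0 : size (foldl (bfs_add s0) acc l) <= size acc + size l.
  elim: l acc => [|a l IH] acc /=; first by rewrite addn0.
  apply: leq_trans (IH _) _; rewrite addnS -addSn leq_add2r /bfs_add.
  by case: ifP => _; [exact: leqW|case: [seq _ <- _ | _]].
elim: i => [|i IH]; first by rewrite size_map mul0n addn0.
rewrite [st _]/=; apply: leq_trans (h _ _ _) _.
by rewrite mulSn addnA (addnC (size init)) -addnA addnC leq_add2l.
Qed.
End BfsFacts.

Ltac pt_arcs := first [pt_list | apply: pt_mem_node | apply: pt_mem_arc | apply: pt_count_arc
  | apply: pt_rem_arc].
Ltac pt_user ::= pt_arcs.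

Lemma pt_edges_of E (rows : E -> seq (seq (option data))) :
  ptime rows -> ptime (fun e => edges_of (rows e)).
Proof.
move=> hr; apply: pt_flatten; apply: (pt_map (g := fun _ ur =>
  [seq (ur.1, ve.1) | ve <- zip (iota 0 (size ur.2)) ur.2 & isSome ve.2])); first by pt.
apply: (pt_map (g := fun z ve => (z.2.1, ve.1))); last by pt.
apply: (pt_filter (g := fun _ ve => isSome ve.2)); first by pt.
by apply: (pt_option_case (c := fun _ _ => true)); pt.
Qed.

Lemma pt_edge_arcs E (es : E -> seq (nat * nat)) : ptime es -> ptime (fun e => edge_arcs (es e)).
Proof. by move=> h; rewrite /edge_arcs /outn /inn; pt. Qed.

Lemma pt_node_arcs E (vs : E -> seq nat) : ptime vs -> ptime (fun e => node_arcs (vs e)).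
Proof. by move=> h; rewrite /node_arcs /outn /inn; pt. Qed.

Lemma pt_residual E (ea na F : E -> seq darc) (B : E -> nat) :
  ptime ea -> ptime na -> ptime B -> ptime F -> ptime (fun e => residual (ea e) (na e) (B e) (F e)).
Proof.
move=> h1 h2 h3 h4; rewrite /residual /swp.
apply: pt_cat => //; apply: pt_cat; last by pt.
apply: (pt_filter (g := fun e (a : darc) => count_mem a (F e) < B e)) => //.
apply: pt_leq; last by apply: (pt_comp h3); pt.
by apply: pt_succ; apply: pt_count_arc; [pt|apply: (pt_comp h4); pt].
Qed.

Lemma pt_bfs_step E (arcs : E -> seq darc) (st : E -> seq entry) :
  ptime arcs -> ptime st -> ptime (fun e => bfs_step (arcs e) (st e)).
Proof.
move=> ha hs; have [b pb hb] := ptime_size hs.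
apply: (pt_foldl_add (g := fun e => bfs_add (st e)) (b := fun s => s + s + b s + 3)) => //.
- by polyb_tac.
- move=> e acc a; rewrite /bfs_add; case: ifP => _; first lia.
  case ef : [seq _ <- _ | _] => [|f fs]; first lia.
  have: f \in [seq en <- st e | en.1 == a.1] by rewrite ef mem_head.
  rewrite mem_filter => /andP[_] /(allP (size_enc_mem (st e))).
  case: f a {ef} => [f1 f2] [a1 a2]; rewrite !size_enc_cons !size_enc_pair size_enc_cons size_enc_pair /=.
  have : b (size_enc e) <= b (size_enc e + (size_enc a1 + size_enc a2).+1).
    by apply: pb.1; lia.
  by have := hb e; lia.
apply: (@pt_if _ _ (fun z : E * seq entry * darc => z.2.2 \in unzip1 z.1.2)); try by pt.
apply: (pt_case (c := fun (z : E * seq entry * darc) en _ => (z.2.2, z.2 :: en.2) :: z.1.2)).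
- apply: (pt_filter (g := fun (z : E * seq entry * darc) (en : entry) => en.1 == z.2.1)); last by pt.
  by apply: (pt_comp hs); pt.
- by pt.
- by pt.
Qed.

Lemma pt_bfs E (arcs : E -> seq darc) (i : E -> nat) (init : E -> seq node) :
  ptime arcs -> ptime i -> ptime init -> ptime (fun e => bfs (arcs e) (i e) (init e)).
Proof.
move=> ha hi hn.
have [ba pba hba] := ptime_size ha.
have [bi pbi hbi] := ptime_size hi.
have [bn pbn hbn] := ptime_size hn.
apply: (pt_iter (g := fun e => bfs_step (arcs e)) (b := fun s => (bn s + bi s * ba s) *
  ((bn s + ba s) + (bi s * (ba s).+1 + 1)).+2 + 1)) => //.
- by polyb_tac.
- move=> e j je; rewrite -/(bfs _ _ _).
  have ji : j <= bi (size_enc e) by have := hbi e; rewrite size_enc_nat; lia.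
  apply: leq_trans (size_enc_bounded (K := (bn (size_enc e) + ba (size_enc e) + (bi (size_enc e) *
    (ba (size_enc e)).+1 + 1)).+1) _) _.
    apply/allP => -[v p] /bfs_sub[/= h1 h2 h3]; rewrite size_enc_pair ltnS leq_add //.
      case/orP: h1 => [/(allP (size_enc_mem (init e)))|/mapP[[u w] /(allP (size_enc_mem (arcs e)))+ ->]].
        by have := hbn e; lia.
      by rewrite size_enc_pair /=; have := hba e; lia.
    apply: leq_trans (size_enc_bounded (K := ba (size_enc e)) _) _.
      apply/allP => a /h2 /(allP (size_enc_mem (arcs e))); have := hba e; lia.
    by rewrite leq_add2r leq_mul // (leq_trans h3).
  rewrite leq_add2r leq_mul //; apply: leq_trans (size_bfs _ _ _) _.
  apply: leq_add; first exact: leq_trans (ltnW (size_le_enc (init e))) (hbn e).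
  by apply: leq_mul => //; exact: leq_trans (ltnW (size_le_enc (arcs e))) (hba e).
- by pt.
by apply: pt_bfs_step; [apply: (pt_comp ha)|]; pt.
Qed.

Lemma pt_flip E (F : E -> seq darc) (a : E -> darc) :
  ptime F -> ptime a -> ptime (fun e => flip (F e) (a e)).
Proof. by move=> hF ha; rewrite /flip /swp; pt. Qed.

Lemma pt_origin E (en : E -> entry) : ptime en -> ptime (fun e => origin (en e)).
Proof.
move=> h; apply: (pt_foldl_add (g := fun _ _ (a : darc) => a.1) (b := id)); [by polyb_tac| |by pt..].
by move=> e s [a1 a2]; rewrite size_enc_pair /=; lia.
Qed.

Lemma flip_sub (P : pred darc) F a : (forall a, P (swp a) = P a) ->
  all P F -> P a -> all P (flip F a).
Proof.
move=> hP hF ha; rewrite /flip; case: ifP => _ /=; last by rewrite ha.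
by apply/allP => b /mem_rem /(allP hF).
Qed.

Lemma size_flip F a : size (flip F a) <= (size F).+1.
Proof. by rewrite /flip; case: ifP => // /size_rem ->; exact: leq_trans (leq_pred _) (leqnSn _). Qed.

Lemma pt_flips E (F p : E -> seq darc) :
  ptime F -> ptime p -> ptime (fun e => foldl flip (F e) (p e)).
Proof.
move=> hF hp; apply: (pt_foldl_add (g := fun=> flip) (b := succn)) => //.
- by polyb_tac.
- move=> e s a; rewrite /flip; case: ifP => _; last by rewrite size_enc_cons; lia.
  apply: (@leq_trans (size_enc s)); last exact: leq_addr.
  by elim: s => //= y s IH; case: eqP => _; rewrite !size_enc_cons; lia.
by apply: pt_flip; pt.
Qed.

Ltac pt_graph := first [pt_arcs | apply: pt_edges_of | apply: pt_edge_arcs | apply: pt_node_arcs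
  | apply: pt_residual | apply: pt_bfs | apply: pt_origin | apply: pt_flips].
Ltac pt_user ::= pt_graph.

Lemma pt_augment E (ea na : E -> seq darc) (B D : E -> nat) (T : E -> seq node)
    (FZ : E -> seq darc * seq node) :
  ptime ea -> ptime na -> ptime B -> ptime D -> ptime T -> ptime FZ ->
  ptime (fun e => augment (ea e) (na e) (B e) (D e) (T e) (FZ e)).
Proof.
move=> h1 h2 h3 h4 h5 h6.
apply: (pt_case (c := fun e (en : entry) _ => (foldl flip (FZ e).1 en.2,
  [seq z <- (FZ e).2 | z != origin en]))) => //.
  apply: (pt_filter (g := fun e (en : entry) => en.1 \in T e)); first by pt.
  by apply: pt_mem_node; [pt|apply: (pt_comp h5); pt].
apply: pt_pair; first by pt; apply: (pt_comp h6); pt.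
apply: (pt_filter (g := fun (z : E * (entry * seq entry)) (v : node) => v != origin z.2.1)); last by pt.
by pt; apply: (pt_comp h6); pt.
Qed.

(** Free of the hypotheses of the flow analysis, because the running time must be bounded on every
    input. Arcs are tracked up to reversal since residual paths may use them backwards. *)
Lemma flow_bound ea na B D (S : seq node) T i :
  let FZ := iter i (augment ea na B D T) ([::], S) in
  [/\ all (fun a => (a \in ea ++ na) || (swp a \in ea ++ na)) FZ.1,
      size FZ.1 <= i * D & size_enc FZ.2 <= size_enc S].
Proof.
elim: i => [|i]; first by split.
rewrite iterS; move: (iter i _ _) => [F Z] /= [h1 h2 h3].
rewrite /augment /=.
case ef : [seq _ <- _ | _] => [|[v p] fs]; first by split=> //=; lia.
have: (v, p) \in [seq en <- bfs (residual ea na B F) D Z | en.1 \in T].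
  by rewrite ef mem_head.
rewrite mem_filter => /andP[_] /bfs_sub[/= _ hp sp].
split=> /=; last exact: leq_trans (size_enc_filter _ _) h3.
  have: {subset p <= residual ea na B F} by [].
  have : all (fun a => (a \in ea ++ na) || (swp a \in ea ++ na)) (residual ea na B F).
    rewrite /residual !all_cat; apply/and3P; split.
    - by apply/allP => a ha; rewrite !mem_cat ha.
    - by apply/allP => a; rewrite mem_filter => /andP[_ ha]; rewrite !mem_cat ha !orbT.
    - by rewrite all_map; apply: sub_all h1 => a /=; rewrite swpK orbC.
  move=> /allP hres hsub; have {hres hsub hp} : all (fun a => (a \in ea ++ na) || (swp a \in ea ++ na)) p.
    by apply/allP => a /hsub /hres.
  elim: p F h1 {h2 ef sp} => //= a p IH F h1 /andP[ha hp].
  by apply: IH hp; apply: flip_sub => // b; rewrite swpK orbC.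
apply: (@leq_trans (size p + size F)); last by rewrite mulSn leq_add.
elim: p F {h1 h2 ef sp hp} => //= a p IH F.
by apply: leq_trans (IH _) _; rewrite addSnnS leq_add2l size_flip.
Qed.

Lemma pt_flow E (ea na : E -> seq darc) (B D : E -> nat) (S T : E -> seq node) :
  ptime ea -> ptime na -> ptime B -> ptime D -> ptime S -> ptime T ->
  ptime (fun e => flow (ea e) (na e) (B e) (D e) (S e) (T e)).
Proof.
move=> h1 h2 h3 h4 h5 h6.
have [ba pba hba] := ptime_size (pt_cat h1 h2).
have [bd pbd hbd] := ptime_size h4.
have [bs pbs hbs] := ptime_size h5.
apply: (pt_iter (g := fun e => augment (ea e) (na e) (B e) (D e) (T e))
  (b := fun s => (bs s * bd s * (ba s).+1 + 1 + bs s).+1)).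
- by polyb_tac.
- move=> e i ie; have [ha hs hz] := flow_bound (ea e) (na e) (B e) (D e) (S e) (T e) i.
  rewrite (surjective_pairing (iter _ _ _)) size_enc_pair ltnS.
  apply: leq_add; last exact: leq_trans hz (hbs e).
  apply: leq_trans (size_enc_bounded (K := ba (size_enc e)) _) _.
    apply: sub_all ha => -[a1 a2] /orP[] /(allP (size_enc_mem (ea e ++ na e)));
    by move=> h; have := leq_trans h (hba e); rewrite /swp !size_enc_pair /=; lia.
  rewrite leq_add2r leq_mul //; apply: leq_trans hs _; apply: leq_mul.
    by apply: leq_trans ie (leq_trans (ltnW (size_le_enc (S e))) (hbs e)).
  by have := hbd e; rewrite size_enc_nat; lia.
- by pt.
- by pt.
by apply: pt_augment; pt.
Qed.

Lemma pt_sym_arcs E (H : E -> seq (nat * nat)) : ptime H -> ptime (fun e => sym_arcs (H e)).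
Proof. by move=> h; rewrite /sym_arcs /outn; pt. Qed.

Lemma pt_flow_edges E (F : E -> seq darc) : ptime F -> ptime (fun e => flow_edges (F e)).
Proof. by move=> h; rewrite /flow_edges; pt. Qed.

Ltac pt_user ::= first [pt_graph | apply: pt_flow | apply: pt_sym_arcs | apply: pt_flow_edges
  | apply: pt_behead | apply: pt_subn].

Lemma pt_sources E (A : E -> seq nat) (row : E -> seq bool) :
  ptime A -> ptime row -> ptime (fun e => sources (A e) (row e)).
Proof.
move=> h1 h2; apply: (pt_map (g := fun _ (p : nat * bool) => outn p.1)); last by rewrite /outn; pt.
by apply: (pt_filter (g := fun _ (p : nat * bool) => p.2)); pt.
Qed.

Lemma pt_sinks E (r : E -> nat) (A : E -> seq nat) (row : E -> seq bool) :
  ptime r -> ptime A -> ptime row -> ptime (fun e => sinks (r e) (A e) (row e)).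
Proof.
move=> h0 h1 h2; apply: pt_cons; first by rewrite /outn; pt.
apply: (pt_map (g := fun _ (p : nat * bool) => outn p.1)); last by rewrite /outn; pt.
by apply: (pt_filter (g := fun _ (p : nat * bool) => ~~ p.2)); pt.
Qed.

Lemma pt_unmerged E (l : E -> nat) (H : E -> seq (nat * nat)) (A : E -> seq nat)
    (S T : E -> seq node) :
  ptime l -> ptime H -> ptime A -> ptime S -> ptime T ->
  ptime (fun e => unmerged (l e) (H e) (A e) (S e) (T e)).
Proof.
move=> h1 h2 h3 h4 h5.
apply: (pt_filter (g := fun e (a : nat) => ~~ ((outn a \in S e) &&
  (outn a \in unzip1 (bfs (sym_arcs (H e)) (2 * radius (l e)) (T e)))))) => //.
by rewrite /outn /radius; pt.
Qed.

Lemma pt_attempt E (ea na : E -> seq darc) (r l : E -> nat) (A : E -> seq nat)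
    (row : E -> seq bool) :
  ptime ea -> ptime na -> ptime r -> ptime l -> ptime A -> ptime row ->
  ptime (fun e => attempt (ea e) (na e) (r e) (l e) (A e) (row e)).
Proof.
move=> h1 h2 h3 h4 h5 h6; have hs := pt_sources h5 h6; have ht := pt_sinks h3 h5 h6.
have hf : ptime (fun e => flow_edges (flow (ea e) (na e) (l e) (radius (l e))
  (sources (A e) (row e)) (sinks (r e) (A e) (row e))).1) by rewrite /radius; pt.
by apply: pt_pair => //; apply: pt_unmerged.
Qed.

Lemma pt_sylvester E (fam : E -> seq (seq bool)) : ptime fam -> ptime (fun e => sylvester (fam e)).
Proof.
move=> h; apply: pt_cat.
  by apply: (pt_map (g := fun _ h => h ++ h)); pt.
by apply: (pt_map (g := fun _ h => h ++ [seq ~~ b | b <- h])); pt.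
Qed.

(** Doubling stops once there are more than [k] rows, which keeps the family linear in [k] although
    the construction is iterated [k] times. *)
Lemma hadamard_bound k i :
  let fam := iter i (fun fam => if size fam <= k then sylvester fam else fam) [:: [:: false]] in
  size fam <= k.*2.+1 /\ all (fun h => size h == size fam) fam.
Proof.
elim: i => [|i] //; rewrite iterS; move: (iter i _ _) => fam /= [h1 h2].
case: ifP => // sk; rewrite /sylvester size_cat !size_map; split; first lia.
rewrite all_cat !all_map; apply/andP; split; apply: sub_all h2 => h /= /eqP <-.
  by rewrite size_cat.
by rewrite size_cat size_map.
Qed.

Lemma pt_hadamard E (k : E -> nat) : ptime k -> ptime (fun e => hadamard (k e)).
Proof.
move=> hk; have [b pb hb] := ptime_size hk.
pose m s := b s + b s + 1.
apply: (pt_iter (g := fun e fam => if size fam <= k e then sylvester fam else fam)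
  (b := fun s => m s * (m s * 4 + 1).+1 + 1)) => //.
- by rewrite /m; polyb_tac.
- move=> e i _; have [h1 h2] := hadamard_bound (k e) i.
  have hm : (k e).*2.+1 <= m (size_enc e) by have := hb e; rewrite size_enc_nat /m; lia.
  apply: leq_trans (size_enc_bounded (K := m (size_enc e) * 4 + 1) _) _.
    apply: sub_all h2 => h /eqP hs; apply: leq_trans (size_enc_bounded (K := 3) _) _.
      by apply/allP => x _; exact: size_enc_bool.
    by rewrite leq_add2r leq_mul2r /= hs; apply: leq_trans hm.
  by rewrite leq_add2r leq_mul2r; apply/orP; right; apply: leq_trans h1 hm.
- exact: pt_const.
by apply: pt_if; [pt|apply: pt_sylvester; pt|pt].
Qed.

Lemma pt_successes E (ea na : E -> seq darc) (r l : E -> nat) (A : E -> seq nat) :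
  ptime ea -> ptime na -> ptime r -> ptime l -> ptime A ->
  ptime (fun e => successes (ea e) (na e) (r e) (l e) (A e)).
Proof.
move=> h1 h2 h3 h4 h5.
apply: (pt_filter (g := fun e (c : seq nat * seq (nat * nat)) =>
  size (A e) <= 48 * (size (A e) - size c.1))); last by pt.
apply: (pt_map (g := fun e row => attempt (ea e) (na e) (r e) (l e) (A e) row)).
  by apply: pt_hadamard; pt.
by apply: pt_attempt; pt.
Qed.

Lemma pt_phase E (ea na : E -> seq darc) (r : E -> nat) (st : E -> state) :
  ptime ea -> ptime na -> ptime r -> ptime st ->
  ptime (fun e => phase (ea e) (na e) (r e) (st e)).
Proof.
move=> h1 h2 h3 h4.
pose go e := if successes (ea e) (na e) (r e) (st e).2.1 (st e).1.1 is c :: _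
  then ((c.1, c.2 ++ (st e).1.2), ((st e).2.1, (st e).2.2 + 2 * radius (st e).2.1))
  else ((st e).1, ((st e).2.1.+1, (st e).2.2)).
have hgo : ptime go.
  apply: (pt_case (c := fun e (c : seq nat * seq (nat * nat)) _ =>
    ((c.1, c.2 ++ (st e).1.2), ((st e).2.1, (st e).2.2 + 2 * radius (st e).2.1)))).
  - by apply: pt_successes; pt.
  - by pt.
  by rewrite /radius; pt.
apply: (@eq_ptime _ _ (fun e => if (st e).1.1 is _ :: _ then go e else st e)) => [e|].
  by rewrite /phase /go; case: (st e).1.1.
by apply: (pt_case (c := fun e _ _ => go e)); pt.
Qed.

Lemma phases_bound ea na r (A0 : seq nat) b i :
  {homo b : m n / m <= n} ->
  (forall l A, size_enc (successes ea na r l A) <=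
     b (size_enc (ea, na, r) + size_enc l + size_enc A)) ->
  let st := iter i (phase ea na r) ((A0, [::]), (1, 0)) in
  [/\ size_enc st.1.1 <= size_enc A0,
     size_enc st.1.2 <= i * b (size_enc (ea, na, r) + i.+1.*2.+1 + size_enc A0) + 1,
     st.2.1 <= i.+1 & st.2.2 <= i * (32 * i.+1)].
Proof.
move=> mb hb; elim: i => [|i]; first by split; rewrite ?size_enc_nil.
rewrite iterS; move: (iter i _ _) => [[A H] [l bud]] /= [hA hH hl hbud].
set M := b _ in hH; set M' := b _.
have MM' : M <= M' by apply: mb; lia.
have hH' : size_enc H <= i.+1 * M' + 1.
  apply: leq_trans hH _; rewrite leq_add2r; exact: leq_mul.
have hbud' : bud <= i.+1 * (32 * i.+2) by apply: leq_trans hbud _; apply: leq_mul; lia.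
rewrite /phase /=; case eA : A => [|a A'] /=; first by rewrite -eA; split=> //; lia.
rewrite -eA; case es : (successes _ _ _ _ _) => [|c cs] /=; first by split=> //; lia.
have cin : c \in successes ea na r l A by rewrite es mem_head.
have cb : size_enc c <= M.
  apply: leq_trans (ltnW (allP (size_enc_mem (successes ea na r l A)) _ cin)) _.
  apply: leq_trans (hb l A) _; apply: mb; rewrite size_enc_nat.
  by apply: leq_add => //; rewrite leq_add2l; lia.
move: cin; rewrite mem_filter => /andP[_ /mapP[row _ ec]].
split.
- by rewrite ec; apply: leq_trans (size_enc_filter _ _) hA.
- have := size_enc_cat c.2 H; move: cb; case: (c) => c1 c2 /=; rewrite size_enc_pair => cb hc.
  rewrite mulSn.
  have : size_enc H <= i * M' + 1 by apply: leq_trans hH _; rewrite leq_add2r leq_mul.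
  by move: hc; set x := dsize _; set y := dsize _; set z := dsize _; lia.
- exact: leqW.
rewrite mulSn; have : bud <= i * (32 * i.+2) by apply: leq_trans hbud _; apply: leq_mul; lia.
by rewrite /radius; lia.
Qed.

Lemma pt_phases E (ea na : E -> seq darc) (r n : E -> nat) (A : E -> seq nat) :
  ptime ea -> ptime na -> ptime r -> ptime n -> ptime A ->
  ptime (fun e => iter (n e) (phase (ea e) (na e) (r e)) ((A e, [::]), (1, 0))).
Proof.
move=> h1 h2 h3 h4 h5.
have [bn pbn hbn] := ptime_size h4.
have [bA pbA hbA] := ptime_size h5.
have [bg pbg hbg] := ptime_size (pt_pair (pt_pair h1 h2) h3).
(* [successes] is measured as a function of all its arguments, because the guess and the active
   terminals change during the loop. *)
pose X := (code_prod (code_prod (code_prod (code_prod (code_seq (code_prod (code_prod code_nat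
  code_bool) (code_prod code_nat code_bool))) (code_seq (code_prod (code_prod code_nat
  code_bool) (code_prod code_nat code_bool)))) code_nat) code_nat) (code_seq code_nat)).
have hsucc : ptime (fun x : X => successes x.1.1.1.1 x.1.1.1.2 x.1.1.2 x.1.2 x.2).
  by apply: pt_successes; pt.
have [bs pbs hbs] := ptime_size hsucc.
pose b s := bs s.+2.
have pb : polyb b by rewrite /b; polyb_tac.
pose w s := bn s * b (bg s + ((bn s).+1 + (bn s).+1).+1 + bA s) + 1.
pose u s := bn s * (32 * (bn s).+1).
apply: (pt_iter (g := fun e => phase (ea e) (na e) (r e))
  (b := fun s => (bA s + w s).+1 + (((bn s).+1 + (bn s).+1).+1 + (u s + u s).+1).+1 + 1)) => //.
- by rewrite /w /u /b; polyb_tac.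
- move=> e i ie.
  have hb l A' : size_enc (successes (ea e) (na e) (r e) l A') <=
      b (size_enc (ea e, na e, r e) + size_enc l + size_enc A').
    apply: leq_trans (hbs (ea e, na e, r e, l, A')) _; apply: pbs.1.
    by rewrite !size_enc_pair; lia.
  have [] := phases_bound (A e) i pb.1 hb.
  have ib : i <= bn (size_enc e) by have := hbn e; rewrite size_enc_nat; lia.
  move: (iter i _ _) => [[A' H] [l bud]] /= hA hH hl hbud.
  have hH' : size_enc H <= w (size_enc e).
    apply: leq_trans hH _; rewrite /w leq_add2r; apply: leq_mul => //; apply: pb.1.
    by apply: leq_add (hbA e); apply: leq_add (hbg e) _; lia.
  have hbud' : bud <= u (size_enc e).
    by apply: leq_trans hbud _; rewrite /u; apply: leq_mul => //; rewrite leq_mul2l; lia.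
  rewrite !size_enc_pair !size_enc_nat; have hA' := leq_trans hA (hbA e).
  apply: (@leq_trans ((bA (size_enc e) + w (size_enc e)).+1 + (l.*2.+1 + bud.*2.+1).+1).+1).
    by rewrite ltnS leq_add2r ltnS; exact: leq_add.
  by lia.
- by pt.
by apply: pt_phase; pt.
Qed.

Lemma pt_tree_edges E (st : E -> seq entry) : ptime st -> ptime (fun e => tree_edges (st e)).
Proof.
move=> h; apply: pt_flatten; apply: (pt_map (g := fun _ (en : entry) =>
  if en.2 is a :: _ then [:: (a.2.1, a.1.1)] else [::])) => //.
apply: (pt_case (c := fun (z : E * entry) (a : darc) _ => [:: (a.2.1, a.1.1)])); by pt.
Qed.

Lemma pt_algorithm : ptime algorithm.
Proof.
have hA : ptime terminals.
  apply: (pt_map (g := fun _ (p : nat * bool) => p.1)); last by pt.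
  by apply: (pt_filter (g := fun i (p : nat * bool) => p.2 && (p.1 != i.2.1))); pt.
have hst : ptime final_state by apply: pt_phases; pt.
have htr : ptime (fun i => bfs (sym_arcs (final_state i).1.2) (final_state i).2.2 [:: outn i.2.1]).
  by rewrite /outn; pt.
by apply: pt_pair; [pt|apply: pt_tree_edges].
Qed.

Section Bfs.
Variables (arcs : seq darc) (init : seq node).
Local Notation st i := (bfs arcs i init).
Local Notation found i := (unzip1 (bfs arcs i init)).

(** * Breadth-first search and bounded augmentation *)

Lemma mem_unzip1 (s : seq entry) v : v \in unzip1 s -> exists p, (v, p) \in s.
Proof. by case/mapP=> -[w p] h /= ->; exists p. Qed.

Lemma found_of (s : seq entry) v p : (v, p) \in s -> v \in unzip1 s.
Proof. exact: (@map_f _ _ fst). Qed.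

Lemma bfs_addP s0 acc a : bfs_add s0 acc a = acc \/
  exists p, [/\ (a.1, p) \in s0, a.2 \notin unzip1 acc & bfs_add s0 acc a = (a.2, a :: p) :: acc].
Proof.
rewrite /bfs_add; case: ifP => h; first by left.
case ef : [seq _ <- _ | _] => [|[u p] fs]; first by left.
right; exists p; split=> //.
have: (u, p) \in [seq en <- s0 | en.1 == a.1] by rewrite ef mem_head.
by rewrite mem_filter /= => /andP[/eqP->].
Qed.

Lemma bfs_add_found s0 acc a : a.1 \in unzip1 s0 -> a.2 \in unzip1 (bfs_add s0 acc a).
Proof.
move=> /mem_unzip1[p hp]; rewrite /bfs_add; case: ifP => // _.
case ef : [seq _ <- _ | _] => [|en fs]; last by rewrite /= mem_head.
suff: (a.1, p) \in [seq en <- s0 | en.1 == a.1] by rewrite ef.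
by rewrite mem_filter /= eqxx hp.
Qed.

Lemma bfs_step_sub s0 acc l : {subset acc <= foldl (bfs_add s0) acc l}.
Proof.
elim: l acc => [|a l IH] acc en h //=; apply: IH.
by have [->|[p [_ _ ->]]] := bfs_addP s0 acc a; rewrite ?inE ?h ?orbT.
Qed.

Lemma bfs_mono i j en : i <= j -> en \in st i -> en \in st j.
Proof.
move=> /subnK <-; elim: (j - i) => // k IH /IH.
by rewrite addSn [st _.+1]/=; exact: bfs_step_sub.
Qed.

Lemma found_mono i j v : i <= j -> v \in found i -> v \in found j.
Proof. by move=> ij /mem_unzip1[p] /(bfs_mono ij) /(map_f fst). Qed.

Lemma found_step i a : a \in arcs -> a.1 \in found i -> a.2 \in found i.+1.
Proof.
rewrite [st i.+1]/= /bfs_step; move: (st i) => s0 + h.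
elim: arcs {2}s0 => //= b l IH acc; rewrite inE => /orP[/eqP<-|]; last exact: IH.
have /mem_unzip1[p hp] := bfs_add_found acc h.
by apply: (@found_of _ _ p); exact: bfs_step_sub.
Qed.

Lemma bfs_uniq i : uniq init -> uniq (found i).
Proof.
move=> ui; elim: i => [|i IH]; first by rewrite /unzip1 -map_comp map_id.
rewrite [st i.+1]/= /bfs_step; move: (st i) IH => s0.
elim: arcs {1 3}s0 => //= a l IHl acc ua.
apply: IHl; have [->//|[p [_ na ->]]] := bfs_addP s0 acc a.
by rewrite /= na.
Qed.

Lemma bfs_parent i en : en \in st i ->
  (en.1 \in init /\ en.2 = [::]) \/
  exists a p, [/\ en.2 = a :: p, a.2 = en.1, a \in arcs & (a.1, p) \in st i].
Proof.
elim: i en => [|i IH] en; first by case/mapP=> v vi ->; left.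
rewrite [in X in X -> _](_ : st i.+1 = bfs_step arcs (st i)) // /bfs_step => h.
suff {h}: forall l acc, {subset l <= arcs} -> en \in foldl (bfs_add (st i)) acc l ->
    en \in acc \/ exists a p, [/\ en.2 = a :: p, a.2 = en.1, a \in arcs & (a.1, p) \in st i].
  case/(_ _ _ _ h) => // [/IH[]|]; first by left.
    by case=> a [p [h1 h2 h3 h4]]; right; exists a, p; split=> //; exact: bfs_mono h4.
  by case=> a [p [h1 h2 h3 h4]]; right; exists a, p; split=> //; exact: bfs_mono h4.
elim=> [|a l IHl] acc /=; first by left.
move=> sl /IHl[b bl|ha|]; [by apply: sl; rewrite inE bl orbT| |by right].
move: ha; have [->|[p [h1 h2 ->]]] := bfs_addP (st i) acc a; first by left.
rewrite inE => /orP[/eqP->|]; last by left.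
by right; exists a, p; split=> //; apply: sl; rewrite mem_head.
Qed.

Lemma bfs_parent_found i a p v : (v, a :: p) \in st i -> [/\ a.2 = v, a \in arcs & (a.1, p) \in st i].
Proof. by case/bfs_parent=> [[]//|[b [q [/= [<- <-] h1 h2 h3]]]]. Qed.

Lemma bfs_func i v p q : uniq init -> (v, p) \in st i -> (v, q) \in st i -> p = q.
Proof.
move=> /(bfs_uniq i); elim: (st i) => //= -[w s] l IH /andP[nw ul]; rewrite !inE.
case/orP=> [/eqP[-> ->]|hp] /orP[/eqP[]|hq]; last exact: IH.
- by [].
- by move/(map_f fst): hq nw => /= ->.
- by move=> wv; move/(map_f fst): hp nw => /=; rewrite wv => ->.
Qed.

Definition bfs_level i v := size (nth [::] (unzip2 (st i)) (index v (found i))).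

Lemma bfs_levelE i v p : uniq init -> (v, p) \in st i -> bfs_level i v = size p.
Proof.
move=> ui hp; rewrite /bfs_level; congr size; apply: (bfs_func ui _ hp).
have vi : v \in found i by exact: found_of hp.
have sz : index v (found i) < size (st i) by rewrite -(size_map fst) index_mem.

rewrite (nth_map (v, [::])) //.
set en := nth _ _ _; have <- : en.1 = v by rewrite /en -(nth_map _ v fst) // nth_index.
by rewrite -surjective_pairing mem_nth.
Qed.

(** The tail of a recorded path is itself the path recorded for its end, so each arc climbs exactly
    one level. Hence no arc repeats and none occurs together with its reversal, as flipping a whole
    path requires. *)
Lemma bfs_path_level i v p : uniq init -> (v, p) \in st i ->
  uniq p /\ {in p, forall a, bfs_level i a.2 = (bfs_level i a.1).+1 /\ bfs_level i a.2 <= size p}.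
Proof.
move=> ui; elim: p v => [|a p IH] v //= h.
have [av aa hp] := bfs_parent_found h; have [up lp] := IH _ hp.
have la : bfs_level i a.2 = (size p).+1 by rewrite av (bfs_levelE ui h).
have la1 : bfs_level i a.1 = size p by rewrite (bfs_levelE ui hp).
split; last first.
  move=> b; rewrite inE => /orP[/eqP->|/lp[h1 h2]]; first by rewrite la la1.
  by split=> //; exact: leqW.
by rewrite up andbT; apply/negP => /lp[_]; rewrite la ltnn.
Qed.

(** The telescoping sum is the form in which a path enters flow conservation. *)
Lemma bfs_path i en : en \in st i -> origin en \in init /\
  forall g : node -> int, (\sum_(a <- en.2) (g a.2 - g a.1) = g en.1 - g (origin en))%R.
Proof.
move: i en; apply: bfs_ind => [v vi|i en //|i a en aA ea [h1 h2]].
  by split=> // g; rewrite big_nil /origin /= subrr.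
rewrite /origin /= -ea -[foldl _ _ _]/(origin en); split=> // g.
by rewrite big_cons h2 ea addrA subrK.
Qed.

(** Distance truncated at [D]: on failure [find] returns the length of [iota 0 D]. *)
Definition bfs_dist D v := find (fun i => v \in found i) (iota 0 D).

Lemma bfs_dist_le D v : bfs_dist D v <= D.
Proof. by rewrite -{2}(size_iota 0 D) find_size. Qed.

Lemma bfs_dist_found D v : bfs_dist D v < D -> v \in found (bfs_dist D v).
Proof.
move=> h; have hs : has (fun i => v \in found i) (iota 0 D) by rewrite has_find size_iota.
by have := nth_find 0 hs; rewrite nth_iota.
Qed.

Lemma bfs_dist_min D v i : v \in found i -> bfs_dist D v <= i.
Proof.
move=> h; rewrite leqNgt; apply/negP => hi.
have := before_find 0 hi; rewrite nth_iota; first by rewrite h.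
by apply: leq_trans hi _; exact: bfs_dist_le.
Qed.

Lemma bfs_dist_init D v : v \in init -> bfs_dist D v = 0.
Proof.
by move=> h; apply/eqP; rewrite -leqn0; apply: bfs_dist_min; rewrite /unzip1 -map_comp map_id.
Qed.

Lemma bfs_dist_step D a : a \in arcs -> bfs_dist D a.2 <= (bfs_dist D a.1).+1.
Proof.
move=> h; have [lt|ge] := ltnP (bfs_dist D a.1) D.
  by apply: bfs_dist_min; apply: found_step h _; exact: bfs_dist_found.
by apply: leq_trans (bfs_dist_le _ _) (leqW ge).
Qed.

Lemma bfs_dist_far D v : v \notin found D -> bfs_dist D v = D.
Proof.
move=> h; apply/eqP; rewrite eqn_leq bfs_dist_le leqNgt; apply/negP => lt.
by move/negP: h; apply; apply: found_mono (ltnW lt) (bfs_dist_found lt).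
Qed.

End Bfs.

(* With g an indicator function this is the net inflow of a vertex; with g a
   distance it relates the distances between the ends of a flow to its volume. *)
Definition drop_along (F : seq darc) (g : node -> int) : int := (\sum_(a <- F) (g a.2 - g a.1))%R.

Lemma perm_drop_along F1 F2 g : perm_eq F1 F2 -> drop_along F1 g = drop_along F2 g.
Proof. exact: perm_big. Qed.

Lemma drop_along_flip F a g : drop_along (flip F a) g = (drop_along F g + (g a.2 - g a.1))%R.
Proof.
rewrite /flip; case: ifP => h; last by rewrite [LHS]big_cons addrC.
rewrite (perm_drop_along g (perm_to_rem h)) [X in (X + _)%R]big_cons /= -/(drop_along _ _).
by rewrite addrAC -[(g a.1 - _)%R]opprB addNr add0r.
Qed.

Lemma drop_along_flips F p g : drop_along (foldl flip F p) g = (drop_along F g + drop_along p g)%R.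
Proof.
elim: p F => [|a p IH] F /=; first by rewrite [X in (_ + X)%R]big_nil addr0.
by rewrite IH drop_along_flip -addrA [in RHS]/drop_along big_cons.
Qed.

Lemma size_flips F p : size (foldl flip F p) <= size F + size p.
Proof.
elim: p F => [|a p IH] F /=; first by rewrite addn0.
apply: leq_trans (IH _) _; rewrite addnS -addSn leq_add2r /flip; case: ifP => // h.
by rewrite size_rem //; exact: leq_trans (leq_pred _) (leqnSn _).
Qed.

Section Flow.
Variables (ea na : seq darc) (B D : nat) (S T : seq node).
Hypothesis disj : forall a, a \in na -> a \notin ea.
Hypothesis uniqS : uniq S.

Definition legal (F : seq darc) : Prop :=
  (forall a, a \in F -> a \in ea \/ a \in na) /\ (forall a, a \in na -> count_mem a F <= B).

Lemma mem_residual F a : (a \in residual ea na B F) =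
  [|| a \in ea, (a \in na) && (count_mem a F < B) | swp a \in F].
Proof.
rewrite !mem_cat mem_filter [(_ < _) && _]andbC.
by congr [|| _, _ | _]; rewrite -{1}[a]swpK mem_map //; exact: can_inj swpK.
Qed.

Lemma count_flip F a b : count_mem b (flip F a) =
  if swp a \in F then count_mem b F - (b == swp a) else count_mem b F + (b == a).
Proof.
rewrite /flip; case: ifP => h; last by rewrite /= addnC eq_sym.
by rewrite (permP (perm_to_rem h) (pred1 b)) /= [swp a == b]eq_sym addnC addnK.
Qed.

(** Flipping [b] changes multiplicities only at [b] and [swp b]. *)
Lemma residual_flip F a b : a != b -> swp a != b ->
  a \in residual ea na B F -> a \in residual ea na B (flip F b).
Proof.
move=> ab sab; rewrite !mem_residual.
have ab' : (a == swp b) = false by apply: contraNF sab => /eqP ->; rewrite swpK.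
have sab' : (swp a == swp b) = false by apply: contraNF ab => /eqP /(can_inj swpK) ->.
suff h c : c != b -> (c == swp b) = false -> count_mem c (flip F b) = count_mem c F.
  have -> : (swp a \in flip F b) = (swp a \in F) by rewrite -!has_pred1 !has_count h.
  by rewrite h.
by move=> /negPf cb cs; rewrite count_flip cb cs; case: ifP; rewrite ?subn0 ?addn0.
Qed.

Lemma legal_flip F a : a \in residual ea na B F -> legal F -> legal (flip F a).
Proof.
rewrite mem_residual => ha [h1 h2]; split=> [b|b bna].
  rewrite /flip; case: ifP => [_ /mem_rem|sF]; first exact: h1.
  move: ha; rewrite sF orbF => /orP ha; rewrite inE => /orP[/eqP->|]; last exact: h1.
  by case: ha => [->|/andP[->]]; [left|right].
rewrite count_flip; case: ifP => [_|sF]; first by apply: leq_trans (leq_subr _ _) (h2 b bna).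
move: ha; rewrite sF orbF; case: eqP => [<-|_ _]; last by rewrite addn0 h2.
by rewrite bna (negPf (disj bna)) /= addn1.
Qed.

Lemma legal_flips F p : uniq p -> {in p &, forall a b, swp a != b} ->
  {subset p <= residual ea na B F} -> legal F -> legal (foldl flip F p).
Proof.
elim: p F => //= a p IH F /andP[ap up] sp rp lF.
apply: IH => // [b c bp cp|b bp|].
- by apply: sp; rewrite inE ?bp ?cp orbT.
- apply: residual_flip; [by apply: contraNneq ap => <-| |].
    by apply: sp; rewrite inE ?bp ?eqxx ?orbT.
  by apply: rp; rewrite inE bp orbT.
by apply: legal_flip => //; apply: rp; rewrite mem_head.
Qed.

(* [fi_drop] is flow conservation tested against all potentials at once, so that
   flows never have to be decomposed into paths. *)
Record flow_inv (FZ : seq darc * seq node) (ends done : seq node) : Prop := FlowInv {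
  fi_perm : perm_eq S (FZ.2 ++ done);
  fi_size : size ends = size done;
  fi_ends : {subset ends <= T};
  fi_drop : forall g, drop_along FZ.1 g = (\sum_(t <- ends) g t - \sum_(s <- done) g s)%R;
  fi_vol : size FZ.1 <= size done * D;
  fi_legal : legal FZ.1 }.

Definition stuck (FZ : seq darc * seq node) : bool :=
  ~~ has (fun en => en.1 \in T) (bfs (residual ea na B FZ.1) D FZ.2).

Lemma augment_inv FZ ends done : flow_inv FZ ends done ->
  stuck FZ /\ augment ea na B D T FZ = FZ \/
  exists ends' done', flow_inv (augment ea na B D T FZ) ends' done' /\ size done' = (size done).+1.
Proof.
case: FZ => F Z [/= pm sz hT hd hv hl]; rewrite /stuck /augment has_filter negbK /=.
case ef : [seq _ <- _ | _] => [|[t p] fs]; first by left.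
right; move: (mem_head (t, p) fs); rewrite -ef mem_filter => /andP[/= tT].
have uZ : uniq Z by move: uniqS; rewrite (perm_uniq pm) cat_uniq => /andP[].
set arcs := residual _ _ _ _ => hin.
have [oZ hpot] := bfs_path hin.
have [up lev] := bfs_path_level uZ hin.
have [_ sub szp] := bfs_sub hin.
exists (t :: ends), (origin (t, p) :: done); split=> //; split=> /=.
- apply: perm_trans pm _.
  have <- : rem (origin (t, p)) Z = [seq z <- Z | z != origin (t, p)] by rewrite rem_filter.
  rewrite perm_sym -cat_rcons perm_cat2r perm_rcons perm_sym.
  exact: perm_to_rem.
- by rewrite sz.
- by move=> s; rewrite inE => /orP[/eqP->|/hT].
- move=> g; rewrite drop_along_flips hd /drop_along hpot !big_cons /=; ring.
- by apply: leq_trans (size_flips _ _) _; rewrite mulSn addnC leq_add.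
(* Levels rise along [a] and along [b], so [b] is not the reversal of [a]. *)
apply: legal_flips => // a b ap bp.
have [ha _] := lev a ap; have [hb _] := lev b bp.
apply/eqP => eab; move: hb; rewrite -eab /= ha => /eqP.
by rewrite -[X in X == _]addn0 -addn2 eqn_add2l.
Qed.

Lemma flow_spec : exists ends done,
  flow_inv (flow ea na B D S T) ends done /\ stuck (flow ea na B D S T).
Proof.
suff h i : exists ends done, flow_inv (iter i (augment ea na B D T) ([::], S)) ends done /\
    (stuck (iter i (augment ea na B D T) ([::], S)) \/ size done = i).
  (* After [size S] effective rounds all sources are routed; the search then starts from no node at
     all and is stuck too. *)
  have [ends [done [inv [st|sd]]]] := h (size S); exists ends, done; split=> //.
  have := perm_size (fi_perm inv); rewrite size_cat sd -[X in X = _]add0n => /eqP.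
  rewrite eqn_add2r eq_sym size_eq0 /stuck => /eqP ->.
  suff -> : bfs (residual ea na B (iter (size S) (augment ea na B D T) ([::], S)).1) D [::] = [::].
    by [].
  move: (residual _ _ _ _) => arcs; elim: D => // d; rewrite /bfs /= => ->.
  by rewrite /bfs_step; elim: arcs => //= a l IH; rewrite /bfs_add.
elim: i => [|i [ends [done [inv hs]]]].
  exists [::], [::]; split; last by right.
  split=> [||t|g||] //=; first by rewrite cats0.
  by rewrite /drop_along !big_nil subrr.
rewrite iterS; set FZ := iter _ _ _ in inv hs *.
have [[st ->]|[ends' [done' [inv' sd]]]] := augment_inv inv.
  by exists ends, done; split=> //; left.
exists ends', done'; split=> //.
case: hs => [st|<-]; last by right.
left; move: (st); rewrite /stuck has_filter negbK => /eqP e0.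
by rewrite /augment e0.
Qed.

End Flow.

(** * The flow at termination: prices, degree and length of its support *)

Definition incident (v : nat) (e : nat * nat) : bool := (e.1 == v) || (e.2 == v).

Lemma sum_pred_count (I : eqType) (s : seq I) (P : pred I) :
  (\sum_(i <- s) (P i)%:R = (count P s)%:R :> int)%R.
Proof.
by elim: s => [|i s IH]; rewrite ?big_nil // big_cons IH /= natrD.
Qed.

(** The summands are the slacks of [g a.1 <= g a.2 + 1], nonnegative when [g] drops by at most one
    along each arc of the flow. *)
Lemma drop_along_size (F : seq darc) (g : node -> int) :
  (\sum_(a <- F) (g a.2 + 1 - g a.1) = drop_along F g + (size F)%:Z)%R.
Proof.
elim: F => [|a F IH]; first by rewrite /drop_along !big_nil.
rewrite big_cons IH /drop_along big_cons /= -/(drop_along _ _) -[(size F).+1]addn1 PoszD.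
by move: (drop_along _ _) (g a.1) (g a.2) => x y z; lia.
Qed.

Lemma edge_arcsP es a : reflect (exists2 e, e \in es & a = (outn e.1, inn e.2)) (a \in edge_arcs es).
Proof. exact: mapP. Qed.

Lemma node_arcsP vs a : reflect (exists2 v, v \in vs & a = (inn v, outn v)) (a \in node_arcs vs).
Proof. exact: mapP. Qed.

Lemma node_edge_disj vs es a : a \in node_arcs vs -> a \notin edge_arcs es.
Proof. by case/node_arcsP=> v _ ->; apply/edge_arcsP => -[e _ []]. Qed.

Definition linked (H : seq (nat * nat)) : rel nat := fun u v => ((u, v) \in H) || ((v, u) \in H).

Lemma linked_sym H : symmetric (linked H).
Proof. by move=> u v; rewrite /linked orbC. Qed.

Lemma mem_sym_arcs H u v : ((outn u, outn v) \in sym_arcs H) = linked H u v.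
Proof.
rewrite mem_cat /linked; congr (_ || _).
  apply/mapP/idP => [[[a b] h [-> ->]]//|h]; by exists (u, v).
apply/mapP/idP => [[[a b] h [-> ->]]//|h]; by exists (v, u).
Qed.

Lemma sym_arcsP H a : a \in sym_arcs H -> exists u v, a = (outn u, outn v) /\ linked H u v.
Proof.
rewrite mem_cat => /orP[] /mapP[[u v] h ->]; [exists u, v|exists v, u];
by rewrite /linked h ?orbT.
Qed.

Lemma bfs_walk H init i en : en \in bfs (sym_arcs H) i init ->
  exists t p, [/\ t \in init, path (linked H) t.1 p, last t.1 p = en.1.1 & size p <= i].
Proof.
move: i en; apply: bfs_ind => [v vi|i en [t [p [h1 h2 h3 h4]]]|i a en aA ea [t [p [h1 h2 h3 h4]]]].
- by exists v, [::].
- by exists t, p; split=> //; exact: leqW.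
have [u [v [ev lk]]] := sym_arcsP aA.
exists t, (rcons p v); split=> //.
- by rewrite rcons_path h2 h3 ea ev.
- by rewrite last_rcons ev.
by rewrite size_rcons.
Qed.

Lemma walk_found H init u p : outn u \in init -> path (linked H) u p ->
  outn (last u p) \in unzip1 (bfs (sym_arcs H) (size p) init).
Proof.
move=> ui; elim/last_ind: p => [|p v IH].
  by rewrite /= /unzip1 -map_comp map_id.
rewrite rcons_path last_rcons size_rcons => /andP[hp hl].
by apply: (@found_step _ _ _ (outn (last u p), outn v)); [rewrite mem_sym_arcs|exact: IH].
Qed.

Section Network.
Variables (n : nat) (es : seq (nat * nat)) (l : nat) (S T : seq node).
Hypothesis uniqS : uniq S.
Hypothesis S_out : forall s, s \in S -> s.2.
Hypothesis T_out : forall t, t \in T -> t.2.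
Hypothesis l_gt0 : 0 < l.

Local Notation ea := (edge_arcs es).
Local Notation na := (node_arcs (iota 0 n)).
Local Notation D := (radius l).
Variables (F : seq darc) (Z ends done : seq node).
Hypothesis inv : flow_inv ea na l D S T (F, Z) ends done.
Hypothesis st : stuck ea na l D T (F, Z).

Local Notation d := (bfs_dist (residual ea na l F) Z D).
(* The price of the capacity of v: positive only if the arc through v is
   saturated. *)
Definition node_gap v := bfs_dist (residual ea na l F) Z D (outn v) -
  (bfs_dist (residual ea na l F) Z D (inn v)).+1.

Lemma level_sink t : t \in T -> d t = D.
Proof.
move=> tT; apply: bfs_dist_far; apply/negP => /mem_unzip1[p hp].
by move/hasPn: st => /(_ _ hp); rewrite tT.
Qed.

(** The 2 pays for the edge arc, which is always residual, and for a node arc of length one; the gap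
    is the excess over that. *)
Lemma level_edge u v : (u, v) \in es -> d (outn v) <= d (outn u) + 2 + node_gap v.
Proof.
clear uniqS S_out T_out l_gt0 inv st.
move=> uv; have : d (inn v) <= (d (outn u)).+1.
  apply: (@bfs_dist_step _ _ _ (outn u, inn v)); rewrite mem_residual.
  by apply/orP; left; apply/edge_arcsP; exists (u, v).
by rewrite /node_gap; lia.
Qed.

(* Complementary slackness: a saturated arc pays its gap l times, and the total
   drop of the levels along the flow is at most the number of routed sources
   times D. *)
Lemma gap_sum : l * (\sum_(v <- iota 0 n) node_gap v) <= 2 * (size done * D).
Proof.
clear uniqS S_out T_out l_gt0 st.
pose h (a : darc) : int := ((d a.2)%:Z + 1 - (d a.1)%:Z)%R.
have h0 a : a \in F -> (0 <= h a)%R.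
  move=> aF; have : d a.1 <= (d a.2).+1.
    by apply: (@bfs_dist_step _ _ _ (swp a)); rewrite mem_residual swpK aF !orbT.
  by case: a {aF} => x y /=; rewrite /h /=; lia.
(* One [D] per routed source bounds the levels at the sinks, the other the volume of the flow; the
   levels at the sources enter with a negative sign. *)
have sumF : (\sum_(a <- F) h a <= (2 * (size done * D))%:Z)%R.
  rewrite (drop_along_size F (fun v => (d v)%:Z)%R).
  rewrite (fi_drop inv).
  have hvol : ((size F)%:Z <= (size done * D)%:Z)%R by rewrite lez_nat (fi_vol inv).
  have hends : (\sum_(t <- ends) (d t)%:Z <= (size done * D)%:Z)%R.
    rewrite -(fi_size inv); elim: ends => [|t r IH]; first by rewrite big_nil.
    rewrite big_cons /=; have := bfs_dist_le (residual ea na l F) Z D t.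
    by move: IH; move: (\sum_(j <- r) _)%R => x; lia.
  have hdone : (0 <= \sum_(s <- done) (d s)%:Z)%R by apply: sumr_ge0 => *; lia.
  by move: hends hdone; move: (\sum_(t <- ends) _)%R (\sum_(t <- done) _)%R => x y; lia.
suff hsum : ((l * \sum_(v <- iota 0 n) node_gap v)%:Z <= \sum_(a <- F) h a)%R.
  by have := le_trans hsum sumF; lia.
have -> : ((l * \sum_(v <- iota 0 n) node_gap v)%:Z =
    \sum_(v <- iota 0 n) l%:Z * (node_gap v)%:R)%R.
  by rewrite -mulr_sumr -natr_sum natz PoszM.
have hv v : v \in iota 0 n ->
    (l%:Z * (node_gap v)%:R <= \sum_(a <- F | a == (inn v, outn v)) h a)%R.
  move=> vn; set b := (inn v, outn v).
  have hge : (0 <= \sum_(a <- F | a == b) h a)%R.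
    by rewrite big_seq_cond; apply: sumr_ge0 => a /andP[aF _]; exact: h0.
  have [g0|gpos] := posnP (node_gap v); first by rewrite g0 mulr0.
  have -> : (\sum_(a <- F | a == b) h a = (count_mem b F)%:Z * h b)%R.
    rewrite (eq_bigr (fun=> h b)) => [|a /eqP->//].
    by rewrite big_const_seq iter_addr_0 -mulr_natl natz.
  have bna : b \in na by apply/node_arcsP; exists v.
  (* An unsaturated node arc would be residual and leave no gap. *)
  have cb : l <= count_mem b F.
    rewrite leqNgt; apply/negP => lt.
    have : d b.2 <= (d b.1).+1.
      by apply: bfs_dist_step; rewrite mem_residual bna lt orbT.
    by move: gpos; rewrite /node_gap /b /=; lia.
  have : h b = ((node_gap v)%:Z + 2)%R.
    by move: gpos; rewrite /h /node_gap /b /=; lia.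
  move=> ->; rewrite natz; nia.
apply: (le_trans (y := \sum_(v <- iota 0 n) \sum_(a <- F | a == (inn v, outn v)) h a)%R).
  by rewrite big_seq_cond [leRHS]big_seq_cond; apply: ler_sum => v /andP[vn _]; exact: hv.
(* Each arc of the flow is charged by at most one vertex. *)
rewrite (exchange_big_dep xpredT) //= big_seq_cond [leRHS]big_seq_cond.
apply: ler_sum => a /andP[aF _]; rewrite big_const_seq iter_addr_0 -mulr_natl.
rewrite -[leRHS]mul1r ler_wpM2r ?h0 // (ler_nat _ _ 1).
apply: leq_trans (_ : count_mem a.1.1 (iota 0 n) <= 1).
  by apply: sub_count => v /= /eqP ->.
by rewrite count_uniq_mem ?iota_uniq ?leq_b1.
Qed.

Lemma flow_arcP a : a \in F ->
  (exists2 e, e \in es & a = (outn e.1, inn e.2)) \/ exists v, a = (inn v, outn v).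
Proof.
case/(fi_legal inv).1 => [/edge_arcsP|/node_arcsP[v _ ->]]; first by left.
by right; exists v.
Qed.

Lemma drop_along_pred1 v : drop_along F (fun w => (w == v)%:R%R) =
  ((count (fun a => a.2 == v) F)%:R - (count (fun a => a.1 == v) F)%:R)%R.
Proof. by rewrite /drop_along sumrB !sum_pred_count. Qed.

Lemma count_through v : count_mem (inn v, outn v) F <= l.
Proof.
have [/(fi_legal inv).2//|nb] := boolP ((inn v, outn v) \in na).
rewrite (count_memPn _) //; by apply: contra nb => /(fi_legal inv).1[/edge_arcsP[e _ []]|].
Qed.

(** Sources and sinks are exits, so by conservation all flow into the entrance of [v] crosses its
    node arc. *)
Lemma count_in v : count (fun a => a.2 == inn v) F <= l.
Proof.
clear uniqS l_gt0 st.
have /eqP := drop_along_pred1 (inn v).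
rewrite (fi_drop inv) !sum_pred_count.
have perm_out s : s \in Z ++ done -> s.2 by rewrite -(perm_mem (fi_perm inv)); exact: S_out.
have -> : count (fun s => s == inn v) ends = 0.
  by apply/eqP; rewrite -leqn0 leqNgt -has_count; apply/hasPn => t /(fi_ends inv) /T_out h;
    apply/negP => /eqP et; rewrite et in h.
have -> : count (fun s => s == inn v) done = 0.
  apply/eqP; rewrite -leqn0 leqNgt -has_count; apply/hasPn => t td.
  by apply/negP => /eqP et; have := perm_out t; rewrite mem_cat td orbT et => /(_ isT).
have -> : count (fun a => a.1 == inn v) F = count_mem (inn v, outn v) F.
  apply: eq_in_count => a /flow_arcP[[e _ ->]|[w ->]]; first by rewrite /= !xpair_eqE !andbF.
  by rewrite /= !xpair_eqE !eqxx !andbT andbb.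
have := count_through v; lia.
Qed.

(** The extra unit is flow that starts at [v]: without duplicates in [S], a source is routed at most
    once. *)
Lemma count_out v : count (fun a => a.1 == outn v) F <= l.+1.
Proof.
clear S_out T_out l_gt0 st.
have /eqP := drop_along_pred1 (outn v).
rewrite (fi_drop inv) !sum_pred_count.
have -> : count (fun a => a.2 == outn v) F = count_mem (inn v, outn v) F.
  apply: eq_in_count => a /flow_arcP[[e _ ->]|[w ->]]; first by rewrite /= !xpair_eqE !andbF.
  by rewrite /= !xpair_eqE !eqxx !andbT andbb.
have : count (fun s => s == outn v) done <= 1.
  have : uniq (Z ++ done) by rewrite -(perm_uniq (fi_perm inv)).
  by rewrite cat_uniq => /and3P[_ _ ud]; rewrite count_uniq_mem ?leq_b1.
have := count_through v; lia.
Qed.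

Lemma flow_edges_degree v : count (incident v) (flow_edges F) <= 2 * l + 1.
Proof.
clear l_gt0 st.
rewrite count_map count_filter.
apply: (@leq_trans (count (fun a => a.1 == outn v) F + count (fun a => a.2 == inn v) F)).
  rewrite -count_predUI; apply: leq_trans (leq_addr _ _).
  rewrite (@eq_in_count _ _ (predI (predU (fun a => a.1 == outn v) (fun a => a.2 == inn v))
    (predI (preim (fun a => (a.1.1, a.2.1)) (incident v)) (fun a => a.1.2)))).
    by apply: sub_count => a /= /andP[].
  move=> a /flow_arcP[[e _ ->]|[w ->]]; rewrite /= /incident /=; last by rewrite !andbF.
  by rewrite !xpair_eqE !eqxx !andbT andbb.
by have := count_in v; have := count_out v; lia.
Qed.

Lemma flow_edges_sub : {subset flow_edges F <= es}.
Proof.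
move=> e /mapP[a]; rewrite mem_filter => /andP[h /flow_arcP[[f fe ->]|[v ea]]] ->.
  by rewrite /= -surjective_pairing.
by rewrite ea in h.
Qed.

Local Notation H := (flow_edges F).
Local Notation near := (unzip1 (bfs (sym_arcs H) (2 * D) T)).

(* The distances to the sinks in the support decrease by at most one along each
   arc of the flow, so those of the routed sources add up to at most its volume. *)
Lemma near_half : size done <= 2 * count (fun s => s \in near) done.
Proof.
clear uniqS st.
(* Both halves of a vertex get the same value, so only edge arcs can change it. *)
pose h (w : node) := bfs_dist (sym_arcs H) T (2 * D) (outn w.1).
have hF : (0 <= \sum_(a <- F) ((h a.2)%:Z + 1 - (h a.1)%:Z))%R.
  rewrite big_seq_cond; apply: sumr_ge0 => a /andP[aF _].
  have : h a.1 <= (h a.2).+1.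
    have [[e es_e ea]|[v ->]] := flow_arcP aF; last exact: leqnSn.
    have eH : e \in H.
      apply/mapP; exists a; first by rewrite mem_filter aF ea.
      by rewrite ea /= -surjective_pairing.
    rewrite ea /=; apply: (@bfs_dist_step _ _ _ (outn e.2, outn e.1)).
    by rewrite mem_sym_arcs linked_sym /linked -surjective_pairing eH.
  by move: (h a.1) (h a.2) => x y; lia.
move: hF; rewrite (drop_along_size F (fun w => (h w)%:Z)%R) (fi_drop inv).
have -> : (\sum_(t <- ends) (h t)%:Z = 0)%R.
  rewrite big_seq_cond big1 // => t /andP[/(fi_ends inv) tT _].
  suff -> : h t = 0 by [].
  by apply: bfs_dist_init; move: (T_out tT) (tT); case: t {tT} => x [].
(* A source that is not near has the truncation value [2 * D]; a majority of such sources would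
   exceed the volume bound [size done * D]. *)
have hfar : ((2 * D * count (fun s => s \notin near) done)%:Z <= \sum_(s <- done) (h s)%:Z)%R.
  have -> : ((2 * D * count (fun s => s \notin near) done)%:Z =
      \sum_(s <- done) (2 * D * (s \notin near))%:Z)%R.
    by rewrite -natz natrM -sum_pred_count mulr_sumr; apply: eq_bigr => s _; rewrite -natrM natz.
  rewrite big_seq_cond [leRHS]big_seq_cond; apply: ler_sum => s /andP[sd _].
  have so : outn s.1 = s.
    have := S_out (s := s); rewrite (perm_mem (fi_perm inv)) mem_cat sd orbT => /(_ isT).
    by case: s {sd} => x [].
  rewrite lez_nat; case: (boolP (s \in near)) => sn; first by rewrite muln0.
  by rewrite muln1 /h so bfs_dist_far.
have := fi_vol inv; rewrite /= sub0r.
have := count_predC (fun s => s \in near) done.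
rewrite (eq_count (a1 := predC _) (a2 := fun s => s \notin near)) //.
have D0 : 0 < D by rewrite muln_gt0.
move: hfar; set c1 := count (fun s => s \in near) done.
set c2 := count (fun s => s \notin near) done; move: (\sum_(s <- done) _)%R => x hx hc hf hFx.
have {hx hFx} : 2 * D * c2 <= size F by move: hx hFx; lia.
move: hc hf D0; move: (size done) (size F) c1 c2 D => m f c1' c2' DD; nia.
Qed.

End Network.

(** * Hadamard splits *)

Definition separates (fam : seq (seq bool)) i j :=
  count (fun row => nth false row i != nth false row j) fam.

Definition hadamard_inv (fam : seq (seq bool)) : Prop :=
  [/\ all (fun row => size row == size fam) fam, all (fun row => ~~ nth false row 0) fam &
      forall i j, i < j < size fam -> 2 * separates fam i j = size fam].

(** For two columns in the same half, complementing is invisible and the count doubles. For columns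
    in different halves, [h ++ h] distinguishes them exactly when [h] followed by its complement
    does not, so [size fam] rows differ, even for the two copies of one column. *)
Lemma sylvester_inv fam : 0 < size fam -> hadamard_inv fam -> hadamard_inv (sylvester fam).
Proof.
move=> N0 [/allP h1 /allP h2 h3].
have sz : size (sylvester fam) = size fam + size fam by rewrite size_cat !size_map.
split.
- apply/allP => row; rewrite sz mem_cat => /orP[] /mapP[h /h1 /eqP hs ->];
  by rewrite size_cat ?size_map hs.
- apply/allP => row; rewrite mem_cat => /orP[] /mapP[h hf ->];
  by rewrite nth_cat (eqP (h1 _ hf)) N0 h2.
move=> i j; rewrite sz => /andP[ij jN].
rewrite /separates count_cat !count_map.
set N := size fam in N0 h1 h3 sz jN *.
have [jl|jg] := ltnP j N.
  have e1 : count (preim (fun h => h ++ h) (fun row => nth false row i != nth false row j)) fam =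
      separates fam i j.
    apply: eq_in_count => h hf; have := eqP (h1 _ hf) => hs.
    by rewrite /= !nth_cat hs jl (ltn_trans ij jl).
  have e2 : count (preim (fun h => h ++ [seq ~~ b | b <- h])
      (fun row => nth false row i != nth false row j)) fam = separates fam i j.
    apply: eq_in_count => h hf; have := eqP (h1 _ hf) => hs.
    by rewrite /= !nth_cat hs jl (ltn_trans ij jl).
  by rewrite e1 e2 -(h3 i j) ?ij ?jl //; lia.
have jN' : j - N < N by lia.
have [il|ig] := ltnP i N.
  have e1 : count (preim (fun h => h ++ h) (fun row => nth false row i != nth false row j)) fam =
      count (fun h => nth false h i != nth false h (j - N)) fam.
    apply: eq_in_count => h hf; have := eqP (h1 _ hf) => hs.
    by rewrite /= !nth_cat hs il ltnNge jg.
  have e2 : count (preim (fun h => h ++ [seq ~~ b | b <- h])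
      (fun row => nth false row i != nth false row j)) fam =
      count (predC (fun h => nth false h i != nth false h (j - N))) fam.
    apply: eq_in_count => h hf; have := eqP (h1 _ hf) => hs.
    rewrite /= !nth_cat hs il ltnNge jg /= (nth_map false) ?hs //.
    by case: (nth _ _ i); case: (nth _ _ (j - N)).
  by rewrite e1 e2 count_predC -/N; lia.
have e1 : count (preim (fun h => h ++ h) (fun row => nth false row i != nth false row j)) fam =
    separates fam (i - N) (j - N).
  apply: eq_in_count => h hf; have := eqP (h1 _ hf) => hs.
  by rewrite /= !nth_cat hs !ltnNge jg ig.
have e2 : count (preim (fun h => h ++ [seq ~~ b | b <- h])
    (fun row => nth false row i != nth false row j)) fam = separates fam (i - N) (j - N).
  apply: eq_in_count => h hf; have := eqP (h1 _ hf) => hs.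
  rewrite /= !nth_cat hs !ltnNge jg ig /= !(nth_map false) ?hs //; last lia.
  by case: (nth _ _ (i - N)); case: (nth _ _ (j - N)).
have hN : 2 * separates fam (i - N) (j - N) = N by apply: h3; lia.
by rewrite e1 e2; lia.
Qed.

(** Doubling a nonempty family adds at least one row, so [k] rounds suffice. *)
Lemma hadamardP k : k < size (hadamard k) /\ hadamard_inv (hadamard k).
Proof.
suff h i : let fam := iter i (fun fam => if size fam <= k then sylvester fam else fam)
    [:: [:: false]] in
    (i < size fam \/ k < size fam) /\ (0 < size fam /\ hadamard_inv fam).
  by have /= [h1 [_ h2]] := h k; split=> //; case: h1.
elim: i => [|i].
  split; first by left.
  by split=> //; split=> // a b /andP[ab]; rewrite ltnS leqn0 => /eqP b0; rewrite b0 in ab.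
rewrite iterS; move: (iter i _ _) => fam /= [h1 [h0 h2]].
case: (leqP (size fam) k) => sk; last by split; [right|].
have sz : size (sylvester fam) = size fam + size fam by rewrite size_cat !size_map.
split; last by split; [rewrite sz addn_gt0 h0|exact: sylvester_inv].
by left; rewrite sz; case: h1; lia.
Qed.

(** * Disjoint balls and the LP flow *)

Section PathSums.
Local Open Scope ring_scope.
Variables (n : nat) (E : {set {set 'I_n}}).

(** Edges are unordered, hence the sum over ordered pairs and the factor 1/2. *)
Definition variation (g : 'I_n -> rat) (e : {set 'I_n}) : rat :=
  2^-1 * \sum_(u in e) \sum_(v in e) `|g u - g v|.

Lemma variation_ge0 g e : 0 <= variation g e.
Proof. by apply: mulr_ge0 => //; apply: sumr_ge0 => u _; apply: sumr_ge0. Qed.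

Lemma variation_set2 g u v : variation g [set u; v] = `|g u - g v|.
Proof.
rewrite /variation; have [->|uv] := eqVneq u v.
  by rewrite setUid !big_set1 subrr normr0 mulr0.
rewrite big_setU1 ?inE //= big_set1 !big_setU1 ?inE //= !big_set1 !subrr !normr0.
rewrite [`|g v - _|]distrC; lra.
Qed.

Lemma path_edges_cons (a b : 'I_n) p :
  path_edges (a :: b :: p) = [set a; b] :: path_edges (b :: p).
Proof. by []. Qed.

Lemma mem_path_edges (e : {set 'I_n}) (v : 'I_n) P : e \in path_edges P -> v \in e -> v \in P.
Proof.
case: P => // a p; elim: p a => // b p IH a; rewrite path_edges_cons inE.
case/orP=> [/eqP->|/IH h /h hb]; last by rewrite in_cons hb orbT.
by rewrite !inE => /orP[]->; rewrite ?orbT.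
Qed.

Lemma path_edges_uniq (P : seq 'I_n) : uniq P -> uniq (path_edges P).
Proof.
case: P => // a p; elim: p a => // b p IH a.
rewrite path_edges_cons cons_uniq => /andP[ap /IH]; rewrite cons_uniq => ->; rewrite andbT.
by apply: contra ap => /mem_path_edges; apply; rewrite !inE eqxx.
Qed.

Lemma path_edges_sub (a : 'I_n) p e : path (adj E) a p -> e \in path_edges (a :: p) -> e \in E.
Proof.
elim: p a => // b p IH a /= /andP[ab hp]; rewrite -/(path_edges (b :: p)) inE.
by case/orP=> [/eqP->//|]; exact: IH.
Qed.

Lemma size_path_edges (P : seq 'I_n) : size (path_edges P) = hops P.
Proof. by case: P => // a p; elim: p a => // b p IH a; rewrite path_edges_cons /= IH. Qed.

Lemma path_variation g (a : 'I_n) p :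
  g a - g (last a p) <= \sum_(e <- path_edges (a :: p)) variation g e.
Proof.
elim: p a => [|b p IH] a; first by rewrite big_nil /= subrr.
rewrite path_edges_cons big_cons variation_set2 /=.
have := IH b; have := ler_norm (g a - g b); lra.
Qed.

Variables (t r : 'I_n) (y : n.-bseq 'I_n -> rat).
Hypothesis y0 : forall P, P \in simple_paths E t r -> 0 <= y P.
Hypothesis y1 : \sum_(P in simple_paths E t r) y P = 1.

Definition edge_load (e : {set 'I_n}) : rat :=
  \sum_(P in simple_paths E t r | e \in path_edges P) y P.

Lemma edge_load_ge0 e : 0 <= edge_load e.
Proof. by apply: sumr_ge0 => P /andP[/y0]. Qed.

Lemma edge_load_le1 e : edge_load e <= 1.
Proof.
rewrite -y1 /edge_load [leRHS](bigID (fun P : n.-bseq 'I_n => e \in path_edges P)) /=.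
by rewrite lerDl; apply: sumr_ge0 => P /andP[/y0].
Qed.

(** Exchange of summation; a simple path repeats no edge, so its edges can be summed as a set. *)
Lemma sum_edge_load (w : {set 'I_n} -> rat) :
  \sum_(e in E) w e * edge_load e =
  \sum_(P in simple_paths E t r) y P * \sum_(e <- path_edges P) w e.
Proof.
rewrite /edge_load; under eq_bigr do rewrite mulr_sumr.
rewrite (exchange_big_dep (fun P : n.-bseq 'I_n => P \in simple_paths E t r)) /=; last first.
  by move=> e P _ /andP[].
apply: eq_bigr => P hP; rewrite mulr_sumr.
move: (hP); rewrite inE /simple_path; case eP : (bseqval P) => [//|a p] /and4P[ha hl hp up].
rewrite (eq_bigl (fun e => e \in path_edges (a :: p))) => [|e]; last first.
  rewrite ha hl hp up /=; apply/andP/idP => [[]//|h]; split=> //; exact: path_edges_sub hp h.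
rewrite -big_uniq /=; last exact: path_edges_uniq.
by apply: eq_bigr => e _; rewrite mulrC.
Qed.

(** Weak duality: a unit flow from [t] to [r] pays for the descent of any potential. *)
Lemma flow_variation g : g t - g r <= \sum_(e in E) variation g e * edge_load e.
Proof.
rewrite sum_edge_load -[leLHS]mul1r -y1 mulr_suml; apply: ler_sum => P hP.
apply: ler_wpM2l; first exact: y0.
move: hP; rewrite inE /simple_path; case: (bseqval P) => [//|a p] /and4P[/eqP<- /eqP<- _ _].
exact: path_variation.
Qed.

Lemma total_edge_load (l : rat) :
  \sum_(P in simple_paths E t r) (hops P)%:R * y P <= l -> \sum_(e in E) edge_load e <= l.
Proof.
move=> h; apply: le_trans h; rewrite -[leLHS]/(\sum_(e in E) edge_load e).
rewrite (eq_bigr (fun e => 1 * edge_load e)) => [|e _]; last by rewrite mul1r.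
rewrite sum_edge_load; apply: ler_sum => P _.
by rewrite big_const_seq count_predT size_path_edges iter_addr_0 mulrC.
Qed.

End PathSums.

Section Balls.
Local Open Scope ring_scope.
Variables (n : nat) (E : {set {set 'I_n}}) (r : 'I_n) (K : {set 'I_n}) (y : 'I_n -> n.-bseq 'I_n -> rat).
(** For each split [j]: the levels [d], the prices [q], the sides (true for sources) and the routed
    sources [mt]. *)
Variables (J l : nat) (d q : 'I_J -> 'I_n -> nat) (side mt : 'I_J -> 'I_n -> bool).
(** A capacity between the largest load of a terminal, so that it carries each flow, and the sum of
    the loads, so that its total is at most [#|K| * l]. *)
Variable c : {set 'I_n} -> rat.
Local Notation load t e := (edge_load E t r (y t) e).
Local Notation D := (16 * l)%N.
Local Notation m j := #|[set t in K | mt j t]|.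

Hypothesis simpleE : simple_graph E.
Hypothesis l0 : (0 < l)%N.
Hypothesis rK : r \notin K.
Hypothesis y0 : forall t P, t \in K -> P \in simple_paths E t r -> 0 <= y t P.
Hypothesis y1 : forall t, t \in K -> \sum_(P in simple_paths E t r) y t P = 1.
Hypothesis yl : forall t, t \in K -> \sum_(P in simple_paths E t r) (hops P)%:R * y t P <= l%:R.
Hypothesis c_ge : forall t e, t \in K -> e \in E -> load t e <= c e.
Hypothesis c_le : forall e, e \in E -> c e <= \sum_(t in K) load t e.
Hypothesis c0 : forall e, e \in E -> 0 <= c e.
Hypothesis c_deg : forall v, \sum_(e in delta E v) c e <= l%:R.
Hypothesis d_edge : forall j u v, adj E u v -> (d j v <= d j u + 2 + q j v)%N.
Hypothesis q_sum : forall j, (l * (\sum_v q j v) <= 2 * (m j * D))%N.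
Hypothesis sep : forall t t', t \in r |: K -> t' \in r |: K -> t != t' ->
  (2 * #|[set j | side j t != side j t']| = J)%N.
Hypothesis d_source : forall j t, t \in r |: K -> side j t -> ~~ mt j t -> d j t = 0%N.
Hypothesis d_sink : forall j t, t \in r |: K -> ~~ side j t -> d j t = D.
Hypothesis mt_r : forall j, ~~ mt j r.

(* [level_dist] is the l1 metric of the levels of all splits, [ball_radius] may be
   negative for terminals that were routed too often, and then the tent [bump] of
   height [ball_radius t] around t vanishes. *)
Definition level_dist u v : rat := \sum_(j < J) `|(d j u)%:R - (d j v)%:R|.
Definition times_matched t : rat := \sum_(j < J) (mt j t)%:R.
Definition ball_radius t : rat := D%:R * (J%:R / 4 - times_matched t).
Definition bump t v : rat := Num.max 0 (ball_radius t - level_dist t v).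

Lemma level_dist_ge0 u v : 0 <= level_dist u v.
Proof. exact: sumr_ge0. Qed.

Lemma level_distC u v : level_dist u v = level_dist v u.
Proof. by apply: eq_bigr => j _; rewrite distrC. Qed.

Lemma level_dist_tri u v w : level_dist u w <= level_dist u v + level_dist v w.
Proof. by rewrite -big_split; apply: ler_sum => j _ /=; exact: ler_distD. Qed.

Lemma level_distxx u : level_dist u u = 0.
Proof. by rewrite /level_dist big1 // => j _; rewrite subrr normr0. Qed.

(** A split that separates [t] from [t'] and routes neither contributes [D] to their distance. Half
    of the splits separate them, and each time one of the two is routed, at most one split is
    lost. *)
Lemma balls_apart t t' : t \in r |: K -> t' \in r |: K -> t != t' ->
  ball_radius t + ball_radius t' <= level_dist t t'.
Proof.
move=> tK tK' tt'.
have -> : ball_radius t + ball_radius t' =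
    \sum_(j < J) D%:R * ((side j t != side j t')%:R - (mt j t)%:R - (mt j t')%:R).
  rewrite -mulr_sumr !sumrB /ball_radius -/(times_matched t) -/(times_matched t').
  have -> : \sum_(j < J) (side j t != side j t')%:R = (J%:R / 2 : rat).
    have hs := congr1 (fun k => k%:R : rat) (sep tK tK' tt'); rewrite natrM in hs.
    have -> : \sum_(j < J) (side j t != side j t')%:R =
        #|[set j | side j t != side j t']|%:R :> rat.
      rewrite -sum1_card natr_sum [RHS]big_mkcond /=.
      by apply: eq_bigr => j _; rewrite inE; case: (_ != _).
    by lra.
  by rewrite -mulrDr; congr (_ * _); lra.
apply: ler_sum => j _.
have hD : 0 <= D%:R :> rat by rewrite ler0n.
have hn := normr_ge0 ((d j t)%:R - (d j t')%:R : rat).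
case: (boolP (mt j t)) => h1; first by case: (_ != _); case: (mt j t'); rewrite /=; nra.
case: (boolP (mt j t')) => h2; first by case: (_ != _); rewrite /=; nra.
case: (boolP (side j t)) => s1; case: (boolP (side j t')) => s2 /=; rewrite ?subr0 ?mulr0 ?mulr1 //.
- by rewrite (d_source tK s1 h1) (d_sink tK' s2) distrC subr0 normr_nat.
- by rewrite (d_source tK' s2 h2) (d_sink tK s1) subr0 normr_nat.
Qed.

Lemma bump_ge0 t v : 0 <= bump t v. Proof. by rewrite /bump le_max lexx. Qed.

Lemma bump_ge t v : ball_radius t - level_dist t v <= bump t v.
Proof. by rewrite /bump le_max lexx orbT. Qed.

Lemma bump_gt0 t v : 0 < bump t v -> bump t v = ball_radius t - level_dist t v.
Proof. by rewrite /bump lt_max ltxx /= => /ltW; exact: max_r. Qed.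

Lemma bump_lipschitz t u v : bump t u - bump t v <= level_dist u v.
Proof.
have [/bump_gt0 h|] := ltP 0 (bump t u).
  have := bump_ge t v; have := level_dist_tri t u v; lra.
have := bump_ge0 t v; have := level_dist_ge0 u v; lra.
Qed.

Lemma bump_disjoint t t' v : t \in K -> t' \in K -> 0 < bump t v -> 0 < bump t' v -> t = t'.
Proof.
move=> tK tK' h h'; apply/eqP/negPn/negP => tt'.
have := @balls_apart t t'; rewrite !inE tK tK' !orbT => /(_ isT isT tt').
have := bump_gt0 h; have := bump_gt0 h'; have := level_dist_tri t v t'.
rewrite (level_distC v t'); lra.
Qed.

Lemma sum_bump v : \sum_(t in K) bump t v = 0 \/
  exists t, [/\ t \in K, 0 < bump t v & \sum_(t in K) bump t v = bump t v].
Proof.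
case: (pickP (fun t => (t \in K) && (0 < bump t v))) => [t /andP[tK ht]|h]; [right|left].
  exists t; split=> //; rewrite (bigD1 t) //= big1 ?addr0 // => t' /andP[tK' tt'].
  apply/eqP; rewrite eq_le bump_ge0 andbT leNgt; apply/negP => ht'.
  by rewrite (bump_disjoint tK' tK ht' ht) eqxx in tt'.
apply: big1 => t tK; have := h t; rewrite tK /= => /negbT; rewrite -leNgt => ht.
by apply/eqP; rewrite eq_le ht bump_ge0.
Qed.

(** Summing over all terminals costs no more than a single tent: if [u] and [v] lie in different
    balls, the separation of the centres leaves at most [level_dist u v] for the two heights
    together. *)
Lemma sum_bump_diff u v : \sum_(t in K) `|bump t u - bump t v| <= level_dist u v.
Proof.
case: (pickP (fun t => [&& t \in K, 0 < bump t u & 0 < bump t v])) => [t /and3P[tK hu hv]|h].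
  rewrite (bigD1 t) //= big1 ?addr0 => [|t' /andP[tK' tt']].
    by rewrite ler_norml bump_lipschitz andbT lerNl opprB level_distC bump_lipschitz.
  have h0 w : 0 < bump t w -> bump t' w = 0.
    move=> hw; apply/eqP; rewrite eq_le bump_ge0 andbT leNgt; apply/negP => ht'.
    by rewrite (bump_disjoint tK' tK ht' hw) eqxx in tt'.
  by rewrite !h0 // subrr normr0.
apply: (@le_trans _ _ (\sum_(t in K) bump t u + \sum_(t in K) bump t v)).
  rewrite -big_split /=; apply: ler_sum => t _; apply: le_trans (ler_normB _ _) _.
  by rewrite !ger0_norm ?bump_ge0.
have zero t w w' : t \in K -> 0 < bump t w -> (forall t, [&& t \in K, 0 < bump t w & 0 < bump t w'] = false) ->
    bump t w' = 0.
  move=> tK hw /(_ t); rewrite tK hw /= => /negbT; rewrite -leNgt => hle.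
  by apply/eqP; rewrite eq_le hle bump_ge0.
have h' t : [&& t \in K, 0 < bump t v & 0 < bump t u] = false by have := h t; rewrite [X in _ && X]andbC.
case: (sum_bump u) => [->|[t [tK ht ->]]]; case: (sum_bump v) => [->|[t' [tK' ht' ->]]].
- by rewrite addr0 level_dist_ge0.
- by have := bump_lipschitz t' v u; rewrite (zero _ _ _ tK' ht' h') level_distC; lra.
- by have := bump_lipschitz t u v; rewrite (zero _ _ _ tK ht h); lra.
have tt' : t != t' by apply: contraTneq ht' => <-; rewrite (zero _ _ _ tK ht h) ltxx.
have := @balls_apart t t'; rewrite !inE tK tK' !orbT => /(_ isT isT tt').
have := bump_gt0 ht; have := bump_gt0 ht'; have := level_dist_tri t u t'.
have := level_dist_tri u v t'; rewrite (level_distC v t'); lra.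
Qed.

Lemma level_dist_edge u v : adj E u v ->
  level_dist u v <= 2 * J%:R + (\sum_(j < J) q j u)%:R + (\sum_(j < J) q j v)%:R.
Proof.
move=> uv; have vu : adj E v u by rewrite /adj setUC.
have -> : 2 * J%:R = \sum_(j < J) 2 :> rat by rewrite sumr_const card_ord mulr_natr.
rewrite !natr_sum -!big_split /=; apply: ler_sum => j _.
rewrite ler_norml; have := d_edge j uv; have := d_edge j vu.
rewrite -!(ler_nat rat) !natrD => h1 h2.
have := ler0n rat (q j u); have := ler0n rat (q j v).
by move=> q1 q2; apply/andP; split; lra.
Qed.

Lemma variation_edge e : e \in E -> \sum_(t in K) variation (bump t) e <=
  2 * J%:R + \sum_(v in e) (\sum_(j < J) q j v)%:R.
Proof.
move=> eE; have /forall_inP/(_ e eE)/cards2P[u [v [uv ee]]] := simpleE.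
rewrite ee; under eq_bigr do rewrite variation_set2.
apply: le_trans (sum_bump_diff u v) _.
rewrite big_setU1 ?inE //= big_set1 addrA; apply: level_dist_edge.
by rewrite /adj -ee.
Qed.

(* With k = #|K| and M the total number of routed sources, the tents give
   D (k J / 4 - M) <= 2 J k l + 2 D M; the constant 16 in D makes the left-hand
   term in k dominate. *)
Lemma matched_bound : (J * #|K| <= 24 * \sum_(j < J) m j)%N.
Proof.
pose M := \sum_(j < J) m j.
have sumM : \sum_(t in K) times_matched t = M%:R.
  rewrite exchange_big natr_sum; apply: eq_bigr => j _.
  rewrite -sum1_card natr_sum [RHS]big_mkcond [LHS]big_mkcond /=.
  by apply: eq_bigr => t _; rewrite inE; case: (t \in K); case: (mt j t).
have lower : D%:R * (#|K|%:R * J%:R / 4 - M%:R) <= \sum_(e in E) c e * \sum_(t in K) variation (bump t) e.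
  apply: (@le_trans _ _ (\sum_(t in K) \sum_(e in E) variation (bump t) e * load t e)); last first.
    rewrite exchange_big; apply: ler_sum => e eE; rewrite mulr_sumr; apply: ler_sum => t tK.
    by rewrite mulrC ler_wpM2r ?variation_ge0 // c_ge.
  rewrite -sumM; have -> : D%:R * (#|K|%:R * J%:R / 4 - \sum_(t in K) times_matched t) =
      \sum_(t in K) ball_radius t.
    rewrite /ball_radius -[RHS]mulr_sumr sumrB sumr_const; congr (_ * (_ - _)).
    by rewrite -[RHS]mulr_natl mulrA.
  apply: ler_sum => t tK.
  apply: le_trans (flow_variation (fun P => y0 tK (P:=P)) (y1 tK) (bump t)).
  (* The root is never routed, so its own radius is nonnegative and the separation keeps it out of
     every other ball. *)
  have -> : bump t r = 0.
    rewrite /bump; apply/eqP; rewrite eq_le le_max lexx andbT ge_max lexx /=.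
    have tr : t != r by apply: contraNneq rK => <-.
    have := @balls_apart t r; rewrite !inE tK eqxx orbT => /(_ isT isT tr).
    have : 0 <= ball_radius r.
      rewrite /ball_radius /times_matched big1 => [|j _]; last by rewrite (negPf (mt_r j)).
      by rewrite subr0 mulr_ge0 ?divr_ge0.
    lra.
  by have := bump_ge t t; rewrite level_distxx !subr0.
have upper : \sum_(e in E) c e * \sum_(t in K) variation (bump t) e <=
    2 * J%:R * (#|K|%:R * l%:R) + 2 * (M%:R * D%:R).
  apply: (@le_trans _ _ (\sum_(e in E) c e * (2 * J%:R + \sum_(v in e) (\sum_(j < J) q j v)%:R))).
    by apply: ler_sum => e eE; rewrite ler_wpM2l ?c0 // variation_edge.
  under eq_bigr do rewrite mulrDr; rewrite big_split /=; apply: lerD.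
    rewrite -mulr_suml mulrC ler_wpM2l ?mulr_ge0 //.
    apply: (@le_trans _ _ (\sum_(t in K) \sum_(e in E) load t e)).
      by rewrite exchange_big; apply: ler_sum => e; exact: c_le.
    rewrite -[#|K|%:R * _]/(_) mulr_natl -sumr_const; apply: ler_sum => t tK.
    exact: total_edge_load (yl tK).
  (* The prices are regrouped by vertex: [c_deg] brings in a factor [l], which [q_sum] absorbs. *)
  apply: (@le_trans _ _ (\sum_v (\sum_(j < J) q j v)%:R * \sum_(e in delta E v) c e)).
    under eq_bigr do rewrite mulr_sumr.
    rewrite (exchange_big_dep xpredT) //=; apply: ler_sum => v _.
    rewrite mulr_sumr le_eqVlt; apply/orP; left; apply/eqP; apply: eq_big => e.
      by rewrite inE.
    by move=> _; rewrite mulrC.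
  apply: (@le_trans _ _ (\sum_v (\sum_(j < J) q j v)%:R * l%:R)).
    by apply: ler_sum => v _; rewrite ler_wpM2l ?c_deg.
  have hN : (l * (\sum_v \sum_(j < J) q j v) <= 2 * (M * D))%N.
    rewrite exchange_big !big_distrr /= /M big_distrl /= big_distrr /=.
    by apply: leq_sum => j _; exact: q_sum.
  by rewrite -mulr_suml -natr_sum mulrC -!natrM ler_nat.
have := le_trans lower upper.
have lr : 0 < l%:R :> rat by rewrite ltr0n.
rewrite natrM => h.
(* With [D = 16 l] and [k = #|K|], [h] reads [4 l J k - 16 l M <= 2 l J k + 32 l M], that is,
   [2 l J k <= 48 l M]. *)
have h2 : l%:R * (J%:R * #|K|%:R) <= l%:R * (24 * M%:R) :> rat by nra.
by move: h2; rewrite ler_pM2l // -!natrM ler_nat.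
Qed.

End Balls.

(** * One attempt, and the existence of a successful split *)

Lemma mem_zip_index (A : seq nat) (b : seq bool) a x : uniq A -> size A <= size b ->
  ((a, x) \in zip A b) = (a \in A) && (nth false b (index a A) == x).
Proof.
elim: A b => [|c A IH] [|y b] //= /andP[cA uA] sz; rewrite !inE xpair_eqE IH //.
have [->|ac] := eqVneq a c; last by [].
by rewrite (negPf cA) /= orbF eq_sym.
Qed.

Section Attempt.
Variables (n : nat) (es : seq (nat * nat)) (r l : nat) (A : seq nat).
Hypothesis uniqA : uniq A.
Hypothesis l_gt0 : 0 < l.
Local Notation ea := (edge_arcs es).
Local Notation na := (node_arcs (iota 0 n)).
Local Notation D := (radius l).

Section Row.
Variable row : seq bool.
Hypothesis size_row : size A < size row.

Let size_behead : size A <= size (behead row).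
Proof. by rewrite size_behead -ltnS (ltn_predK size_row). Qed.

(** Terminals use the columns from 1 on, since column 0 is that of the root. *)
Definition row_side a := nth false (behead row) (index a A).

Lemma mem_sources a : (outn a \in sources A row) = (a \in A) && row_side a.
Proof.
transitivity ((a, true) \in zip A (behead row)).
  apply/mapP/idP => [[[b x]]|h]; last by exists (a, true); rewrite ?mem_filter.
  by rewrite mem_filter /= => /andP[xt h] [->]; rewrite -xt.
by rewrite mem_zip_index // eqb_id.
Qed.

Lemma mem_sinks a : a != r -> (outn a \in sinks r A row) = (a \in A) && ~~ row_side a.
Proof.
move=> ar; rewrite inE xpair_eqE (negPf ar) /=.
transitivity ((a, false) \in zip A (behead row)).
  apply/mapP/idP => [[[b x]]|h]; last by exists (a, false); rewrite ?mem_filter.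
  by rewrite mem_filter /= => /andP[/negPf xt h] [->]; rewrite -xt.
by rewrite mem_zip_index // eqbF_neg.
Qed.

Lemma sources_out s : s \in sources A row -> s.2.
Proof. by case/mapP=> p _ ->. Qed.

Lemma sinks_out s : s \in sinks r A row -> s.2.
Proof. by rewrite inE => /orP[/eqP->|/mapP[p _ ->]]. Qed.

Lemma sources_uniq : uniq (sources A row).
Proof.
rewrite /sources (map_comp outn fst) map_inj_uniq; last by move=> a b [].
apply: (@subseq_uniq _ _ (unzip1 (zip A (behead row)))); last by rewrite unzip1_zip.
exact: map_subseq (filter_subseq _ _).
Qed.

Local Notation c := (attempt ea na r l A row).
Local Notation FZ := (flow ea na l D (sources A row) (sinks r A row)).

Lemma row_flow : exists ends done,
  flow_inv ea na l D (sources A row) (sinks r A row) (FZ.1, FZ.2) ends done /\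
  stuck ea na l D (sinks r A row) (FZ.1, FZ.2).
Proof.
have := flow_spec l D (sinks r A row) (@node_edge_disj (iota 0 n) es) sources_uniq.
by case: FZ.
Qed.

Lemma attempt_spec : [/\ {subset c.1 <= A}, uniq c.1, {subset c.2 <= es},
    forall v, count (incident v) c.2 <= 2 * l + 1 &
    forall a, a \in A -> exists b p, [/\ b \in r :: c.1, path (linked c.2) b p, last b p = a &
      size p <= 2 * D]].
Proof.
have [ends [done [inv st]]] := row_flow.
have sub a : a \in c.1 -> a \in A by rewrite mem_filter => /andP[].
split=> //.
- exact: filter_uniq.
- exact: flow_edges_sub inv.
- exact: (flow_edges_degree sources_uniq sources_out sinks_out inv).
move=> a aA; have [ac|] := boolP (a \in c.1).
  by exists a, [::]; rewrite inE ac orbT.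
rewrite mem_filter aA andbT negbK => /andP[_ /mapP[en /bfs_walk[t [p [tT h1 h2 h3]]] e1]].
exists t.1, p; split=> //; last by rewrite h2 -e1.
(* Only sources become inactive, so the sink reached is the root or is still active. *)
have [->|tr] := eqVneq t.1 r; first exact: mem_head.
have tt : t = outn t.1 by case: (t) (sinks_out tT) => x [].
move: tT; rewrite tt mem_sinks // => /andP[tA nside].
by rewrite inE (negPf tr) mem_filter tA mem_sources (negPf nside) andbF.
Qed.

Definition row_matched a := (outn a \in sources A row) && (outn a \notin FZ.2).

(** By [near_half], at least half of the routed sources are near a sink, and those become
    inactive. *)
Lemma matched_progress :
  count row_matched A <= 2 * (size A - size c.1).
Proof.
have [ends [done [inv st]]] := row_flow.
have ud : uniq (FZ.2 ++ done) by rewrite -(perm_uniq (fi_perm inv)) sources_uniq.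
move: (ud); rewrite cat_uniq => /and3P[_ /hasPn dZ uniq_done].
have md s : s \in done -> s \in sources A row by move=> sd; rewrite (perm_mem (fi_perm inv)) mem_cat sd orbT.
have m1 : count row_matched A <= size done.
  rewrite -size_filter -(size_map outn); apply: uniq_leq_size.
    by rewrite map_inj_uniq ?filter_uniq // => x y [].
  move=> s /mapP[a]; rewrite mem_filter => /andP[/andP[aS aZ] _] ->.
  by move: aS; rewrite (perm_mem (fi_perm inv)) mem_cat (negPf aZ).
have m2 := near_half sources_out sinks_out l_gt0 inv.
apply: leq_trans m1 (leq_trans m2 _); rewrite leq_mul2l /=.
have -> : size A - size c.1 = count (fun a => (outn a \in sources A row) &&
    (outn a \in unzip1 (bfs (sym_arcs c.2) (2 * D) (sinks r A row)))) A.
  rewrite size_filter; set P := fun a => _ && _; rewrite -(count_predC P A).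
  by rewrite (eq_count (a1 := fun a => ~~ _) (a2 := predC P)) // addnK.
rewrite -!size_filter -(size_map outn); apply: uniq_leq_size; first exact: filter_uniq.
move=> s; rewrite mem_filter => /andP[sn /md sS].
have ss : s = outn s.1 by case: (s) (sources_out sS) => x [].
apply/mapP; exists s.1 => //; rewrite mem_filter -ss sS sn /=.
by move: sS; rewrite ss mem_sources => /andP[].
Qed.

Lemma matched_gaps :
  l * (\sum_(v <- iota 0 n) node_gap n es l FZ.1 FZ.2 v) <= 2 * (count row_matched A * D).
Proof.
have [ends [done [inv st]]] := row_flow.
apply: leq_trans (gap_sum inv) _; rewrite leq_mul2l /= leq_mul2r.
apply/orP; right.
have ud : uniq (FZ.2 ++ done) by rewrite -(perm_uniq (fi_perm inv)) sources_uniq.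
move: (ud); rewrite cat_uniq => /and3P[_ /hasPn dZ uniq_done].
rewrite -size_filter -[leqRHS](size_map outn); apply: uniq_leq_size => // s sd.
have sS : s \in sources A row by rewrite (perm_mem (fi_perm inv)) mem_cat sd orbT.
have ss : s = outn s.1 by case: (s) (sources_out sS) => x [].
apply/mapP; exists s.1 => //; rewrite mem_filter /row_matched -ss sS dZ //=.
by move: sS; rewrite ss mem_sources => /andP[].
Qed.

End Row.
End Attempt.

Lemma card_nth (T : eqType) (x0 : T) (s : seq T) (P : pred T) :
  #|[set j : 'I_(size s) | P (nth x0 s j)]| = count P s.
Proof.
rewrite -sum1_card -sum1_count (big_nth x0) big_mkord.
by apply: eq_bigl => j; rewrite inE.
Qed.

Lemma card_ord_mem n (A : seq nat) (P : pred nat) : uniq A -> (forall a, a \in A -> a < n) ->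
  #|[set t : 'I_n | (val t \in A) && P (val t)]| = count P A.
Proof.
move=> uA hA; rewrite cardE -(size_map val) -size_filter; apply: perm_size; apply: uniq_perm.
- by rewrite map_inj_uniq ?enum_uniq //; exact: val_inj.
- exact: filter_uniq.
move=> a; rewrite mem_filter; apply/mapP/andP => [[t]|[Pa aA]].
  by rewrite mem_enum inE => /andP[h1 h2] ->.
by exists (Ordinal (hA a aA)) => //; rewrite mem_enum inE /= aA.
Qed.

Section Success.
Variables (n : nat) (E : {set {set 'I_n}}) (r : 'I_n) (es : seq (nat * nat)) (A : seq nat) (l : nat).
Variable y : 'I_n -> n.-bseq 'I_n -> rat.
Hypothesis simpleE : simple_graph E.
Hypothesis es_adj : forall u v : 'I_n, adj E u v -> (val u, val v) \in es.
Hypothesis uniqA : uniq A.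
Hypothesis A_lt : forall a, a \in A -> a < n.
Hypothesis rA : val r \notin A.
Hypothesis A0 : 0 < size A.
Hypothesis l_gt0 : 0 < l.
Local Notation K := [set t : 'I_n | val t \in A].
(** Takes the place of [x], which may exceed the sum of the loads. *)
Definition max_load (e : {set 'I_n}) : rat :=
  \big[Num.max/0%R]_(t : 'I_n | val t \in A) edge_load E t r (y t) e.
Local Open Scope ring_scope.
Hypothesis y0 : forall t P, val t \in A -> P \in simple_paths E t r -> 0 <= y t P.
Hypothesis y1 : forall t, val t \in A -> \sum_(P in simple_paths E t r) y t P = 1.
Hypothesis yl : forall t, val t \in A -> \sum_(P in simple_paths E t r) (hops P)%:R * y t P <= l%:R.
Hypothesis load_deg : forall v, \sum_(e in delta E v) max_load e <= l%:R.
Local Close Scope ring_scope.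
Local Notation fam := (hadamard (size A)).
Local Notation J := (size fam).
Local Notation ea := (edge_arcs es).
Local Notation na := (node_arcs (iota 0 n)).
Local Notation row j := (nth [::] fam j).
Local Notation FZ j := (flow ea na l (radius l) (sources A (row j)) (sinks r A (row j))).

Let row_size (j : 'I_J) : size A < size (row j).
Proof.
have [kJ [/allP h1 _ _]] := hadamardP (size A).
by rewrite (eqP (h1 _ (mem_nth _ (ltn_ord j)))).
Qed.

Lemma attempt_success : exists2 c, c \in [seq attempt ea na r l A row | row <- fam] &
  size A <= 48 * (size A - size c.1).
Proof.
have [kJ [/allP h1 /allP h2 h3]] := hadamardP (size A).
pose d (j : 'I_J) (v : 'I_n) :=
  bfs_dist (residual ea na l (FZ j).1) (FZ j).2 (radius l) (outn v).
pose q (j : 'I_J) (v : 'I_n) := node_gap n es l (FZ j).1 (FZ j).2 v.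
pose mt (j : 'I_J) (t : 'I_n) := row_matched n es r l A (row j) t.
pose idx (t : 'I_n) := if t == r then 0 else (index (val t) A).+1.
pose side (j : 'I_J) (t : 'I_n) := nth false (row j) (idx t).
have cardK : #|K| = size A.
  rewrite -(count_predT A) -(card_ord_mem predT uniqA A_lt).
  by apply: eq_card => t; rewrite !inE andbT.
have row0 (j : 'I_J) : nth false (row j) 0 = false.
  by have := h2 _ (mem_nth [::] (ltn_ord j)) => /= /negPf.
have sideE j (t : 'I_n) : t != r -> side j t = row_side A (row j) t.
  by move=> tr; rewrite /side /idx (negPf tr) -nth_behead.
have side_r j : side j r = false by rewrite /side /idx eqxx.
have in_rK (t : 'I_n) : t \in r |: K -> t != r -> val t \in A.
  by rewrite !inE => /orP[->|].
have matched_A j (t : 'I_n) : mt j t -> val t \in A.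
  by rewrite /mt /row_matched (mem_sources uniqA (row_size j)) => /andP[/andP[]].
have bound : J * #|K| <= 24 * \sum_(j < J) #|[set t in K | mt j t]|.
  apply: (@matched_bound n E r K y J l d q side mt max_load) => //.
  - by rewrite inE.
  - by move=> t P; rewrite inE; exact: y0.
  - by move=> t; rewrite inE; exact: y1.
  - by move=> t; rewrite inE; exact: yl.
  - by move=> t e; rewrite inE => tA _; apply: le_bigmax_cond.
  - move=> e eE; apply: bigmax_le.
      apply: sumr_ge0 => t; rewrite inE => tA; apply: edge_load_ge0 => P; exact: y0.
    move=> t tA; rewrite (bigD1 t) /=; last by rewrite inE.
    rewrite lerDl; apply: sumr_ge0 => t' /andP[]; rewrite inE => tA' _.
    by apply: edge_load_ge0 => P; exact: y0.
  - move=> e eE; case: (boolP (has predT A)) => [|]; last by case: (A) A0.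
    by move=> _; exact: bigmax_ge_id.
  - move=> j u v uv; rewrite /d /q.
    exact: (level_edge n l (FZ j).1 (FZ j).2 (es_adj uv)).
  - move=> j; have -> : #|[set t in K | mt j t]| = count (row_matched n es r l A (row j)) A.
      by rewrite -(card_ord_mem _ uniqA A_lt); apply: eq_card => t; rewrite !inE.
    have := matched_gaps n es r l uniqA (row_size j).
    have -> // : \sum_(v <- iota 0 n) node_gap n es l (FZ j).1 (FZ j).2 v = \sum_v q j v.
    by rewrite -(big_mkord xpredT (node_gap n es l (FZ j).1 (FZ j).2)) /index_iota subn0.
  - have idx_lt t : t \in r |: K -> idx t < J.
      move=> tK; rewrite /idx; case: eqVneq => [_|tr]; first by apply: leq_trans kJ.
      by apply: leq_trans kJ; rewrite ltnS index_mem in_rK.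
    have sep i k : i < k -> k < J ->
        2 * #|[set j : 'I_J | nth false (row j) i != nth false (row j) k]| = J.
      move=> ik kk; rewrite (card_nth [::] fam (fun h => nth false h i != nth false h k)).
      by apply: h3; rewrite ik.
    move=> t t' tK tK' tt'; rewrite /side.
    have [lt|gt|eq] := ltngtP (idx t) (idx t').
    - exact: sep lt (idx_lt _ tK').
    - rewrite -[RHS](sep _ _ gt (idx_lt _ tK)); congr (2 * _).
      by apply: eq_card => j; rewrite !inE eq_sym.
    case/negP: tt'; apply/eqP; move: eq tK tK'; rewrite /idx.
    case: (eqVneq t r) => [->|tr]; case: (eqVneq t' r) => [->|tr'] //= [eq].
    move=> /in_rK /(_ tr) tA /in_rK /(_ tr') tA'; apply: val_inj.
    by rewrite -(nth_index 0 tA) eq nth_index.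
  - move=> j t tK; have [->|tr] := eqVneq t r; first by rewrite side_r.
    rewrite sideE // /mt /row_matched (mem_sources uniqA (row_size j)) in_rK // => -> /=.
    by rewrite negbK => h; exact: bfs_dist_init.
  - move=> j t tK hs; have [ends [done [inv st]]] := row_flow n es r l uniqA (row_size j).
    apply: (level_sink st); have [->|tr] := eqVneq t r; first exact: mem_head.
    by rewrite (mem_sinks uniqA (row_size j)) ?in_rK // -sideE.
  by move=> j; apply/negP => /matched_A; exact/negP.
(* Averaging over the splits: some split routes at least the mean number of sources. *)
have [j hj] : exists j : 'I_J, size A <= 24 * #|[set t in K | mt j t]|.
  case: (pickP (fun j : 'I_J => size A <= 24 * #|[set t in K | mt j t]|)) => [j hj|h].
    by exists j.
  have : 24 * \sum_(j < J) #|[set t in K | mt j t]| <= \sum_(j < J) (size A).-1.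
    rewrite big_distrr; apply: leq_sum => j _ /=.
    by have := h j; move: #|_| => m; lia.
  rewrite sum_nat_const card_ord => h'; have := leq_trans bound h'.
  rewrite cardK leq_mul2l => /orP[/eqP J0|]; first by rewrite J0 in kJ.
  by rewrite -[X in X <= _](prednK A0) ltnn.
exists (attempt ea na r l A (row j)); first by apply: map_f; exact: mem_nth.
have -> : 48 = 24 * 2 by [].
apply: leq_trans hj _; rewrite -mulnA leq_mul2l /=.
apply: leq_trans (matched_progress n es r uniqA l_gt0 (row_size j)).
rewrite -(card_ord_mem _ uniqA A_lt); apply: eq_leq; apply: eq_card => t; by rewrite !inE.
Qed.
End Success.

(** * The breadth-first tree *)

Section Forest.
Variables (V : eqType) (e up : rel V) (depth : V -> nat) (h : nat).
Hypothesis e_up : forall u v, e u v -> up u v || up v u.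
Hypothesis up_depth : forall u v, up u v -> depth u = (depth v).+1.
Hypothesis up_fun : forall u v w, up u v -> up u w -> v = w.
Hypothesis depth_le : forall v, depth v <= h.

(** After a step down from a parent, a simple path cannot climb again: the only way up leads back
    where it came from. *)
Lemma forest_descend a b p : up b a -> path e b p -> uniq [:: a, b & p] -> depth b + size p <= h.
Proof.
elim: p a b => [|c p IH] a b ba /=; first by rewrite addn0 depth_le.
move=> /andP[bc hp] /and3P[nab nb uc].
case/orP: (e_up bc) => [bc'|cb].
  by move: nab; rewrite (up_fun bc' ba) !inE eqxx !orbT.
by rewrite addnS -addSn -(up_depth cb); apply: IH cb hp _; rewrite /= nb.
Qed.

(** A simple path climbs at most [depth a] times, and from then on only descends. *)
Lemma forest_path a p : path e a p -> uniq (a :: p) -> size p <= depth a + h.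
Proof.
elim: p a => //= b p IH a /andP[ab hp] /andP[na ub].
case/orP: (e_up ab) => [hu|hd]; first by rewrite (up_depth hu) addSn ltnS IH.
have := forest_descend hd hp; rewrite /= na => /(_ ub); rewrite (up_depth hd); lia.
Qed.

Lemma max_depth (c : seq V) : c != [::] -> exists2 v, v \in c & {in c, forall w, depth w <= depth v}.
Proof.
elim: c => // a c IH _; have [->|cn] := eqVneq c [::].
  by exists a; rewrite ?mem_head // => w; rewrite inE => /eqP->.
have [v vc vm] := IH cn; have [le|lt] := leqP (depth v) (depth a).
  exists a; rewrite ?mem_head // => w; rewrite inE => /orP[/eqP->//|/vm]; lia.
exists v; rewrite ?inE ?vc ?orbT // => w; rewrite inE => /orP[/eqP->|/vm //]; lia.
Qed.

(** Both neighbours of a deepest vertex of the cycle are its parent, hence they coincide. *)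
Lemma forest_acyclic c : cycle e c -> uniq c -> size c <= 2.
Proof.
have [->//|cn] := eqVneq c [::]; have [v vc vmax] := max_depth cn.
case/rot_to: vc => i s es cyc uc.
have: cycle e (v :: s) by rewrite -es rot_cycle.
have: uniq (v :: s) by rewrite -es rot_uniq.
have vmax' : {in v :: s, forall w, depth w <= depth v}.
  by move=> w; rewrite -es mem_rot; exact: vmax.
rewrite -(size_rot i) es; case: s vmax' {es} => // b s vmax' us.
rewrite /= rcons_path => /and3P[vb hp lv].
have high w : up w v -> w \in v :: b :: s -> false.
  by move=> /up_depth hw /vmax'; rewrite hw ltnn.
have vb' : up v b by case/orP: (e_up vb) => // /high; rewrite !inE eqxx orbT => /(_ isT).
have vl' : up v (last b s).
  by case/orP: (e_up lv) => // /high; rewrite inE mem_last orbT => /(_ isT).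
have := up_fun vb' vl'; case: s us {vmax' hp lv high vl'} => // a s /= /and3P[_ nb _] eb.
by move: nb; rewrite {1}eb mem_last.
Qed.

End Forest.

Section Tree.
Variables (H : seq (nat * nat)) (r h : nat).
Local Notation tr := (bfs (sym_arcs H) h [:: outn r]).
Local Notation te := (tree_edges tr).
Definition tree_depth (v : nat) : nat := bfs_level (sym_arcs H) [:: outn r] h (outn v).
Definition tree_up : rel nat := fun u v => (u, v) \in te.
Definition in_tree (v : nat) : bool := outn v \in unzip1 tr.

Lemma tree_vertex en : en \in tr -> en.1 = outn en.1.1.
Proof.
case/bfs_parent=> [[]|[a [p [_ <- /sym_arcsP[u [v [-> _]]] _]]] //].
by rewrite inE => /eqP ->.
Qed.

Lemma tree_edgeP u v : tree_up u v ->
  linked H v u /\ exists p, (outn u, (outn v, outn u) :: p) \in tr /\ (outn v, p) \in tr.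
Proof.
case/flattenP=> s /mapP[[w [|a p]] /= hen ->]; rewrite ?inE // => /eqP[eu ev].
have [aw aA hp] := bfs_parent_found hen.
have [x [z [ea lk]]] := sym_arcsP aA.
rewrite ea /= in eu ev aw hp hen *; rewrite eu ev; split=> //; exists p; split=> //.
by rewrite aw in hen *.
Qed.

Lemma tree_up_depth u v : tree_up u v -> tree_depth u = (tree_depth v).+1.
Proof.
case/tree_edgeP=> _ [p [h1 h2]].
by rewrite /tree_depth (bfs_levelE _ h1) // (bfs_levelE _ h2).
Qed.

Lemma tree_up_fun u v w : tree_up u v -> tree_up u w -> v = w.
Proof.
case/tree_edgeP=> _ [p [h1 _]] /tree_edgeP[_ [q [h2 _]]].
by have [->] := bfs_func (isT : uniq [:: outn r]) h1 h2.
Qed.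

Lemma tree_depth_le v : tree_depth v <= h.
Proof.
rewrite /tree_depth /bfs_level.
set p := nth _ _ _; have [lt|ge] := ltnP (index (outn v) (unzip1 tr)) (size (unzip2 tr)); last first.
  by rewrite /p nth_default.
have /mapP[en hen ->] : p \in unzip2 tr by exact: mem_nth.
by have [] := bfs_sub hen.
Qed.

Lemma tree_up_in u v : tree_up u v -> in_tree u && in_tree v.
Proof. by case/tree_edgeP=> _ [p [/found_of h1 /found_of h2]]; apply/andP. Qed.

Lemma tree_parent v : in_tree v -> v = r \/ exists2 u, tree_up v u & tree_depth v = (tree_depth u).+1.
Proof.
case/mem_unzip1=> p hp; case: (bfs_parent hp) => [[]|].
  by rewrite inE => /eqP[->]; left.
case=> a [q [/= ep av aA hq]]; right; exists a.1.1.
  apply/flattenP; exists [:: (v, a.1.1)]; last exact: mem_head.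
  by apply/mapP; exists (outn v, p) => //=; rewrite ep av.
rewrite /tree_depth (bfs_levelE _ hp) // ep -(tree_vertex hq).
by rewrite (bfs_levelE _ hq).
Qed.

Lemma in_tree_root : in_tree r.
Proof.
apply: (@found_mono _ _ 0) => //; first by rewrite inE.
Qed.

End Tree.

(** * The main loop *)

(** Bernoulli's inequality for [(1 + 1/m) ^ k], cleared of denominators. *)
Lemma bernoulli_nat m k : m ^ k * (m + k) <= m * m.+1 ^ k.
Proof.
elim: k => [|k IH]; first by rewrite !expn0 mul1n muln1 addn0.
rewrite !expnS; move: (m ^ k) (m.+1 ^ k) IH => x y IH; nia.
Qed.

Lemma expn_succ_double m : 0 < m -> 2 * m ^ m <= m.+1 ^ m.
Proof.
move=> m0; have := bernoulli_nat m m; rewrite -(leq_pmul2l m0).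
by move: (m ^ m) (m.+1 ^ m) => x y; nia.
Qed.

(** Since [(1 + 1/m) ^ m] is at least 2, [m * u] steps already use up the factor [2 ^ u]. It is
    applied with [m = 47]. *)
Lemma decay_bound m k u p : 0 < m -> k <= 2 ^ u -> m.+1 ^ p <= k * m ^ p -> p <= m * u.
Proof.
move=> m0 ku hp; rewrite leqNgt; apply/negP => lt.
have [s ep] : exists s, p = m * u + s.+1 by exists (p - m * u).-1; lia.
have : 2 ^ u * (m ^ (m * u)) <= m.+1 ^ (m * u).
  rewrite !expnM -expnMn; case: u {ku lt ep} => // u.
  by rewrite leq_exp2r //; exact: expn_succ_double.
move: hp; rewrite ep !expnD => h1 h2.
have h3 : m ^ s.+1 < m.+1 ^ s.+1 by rewrite ltn_exp2r.
have h4 : 0 < m ^ (m * u) by rewrite expn_gt0 m0.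
have h5 : 0 < 2 ^ u by rewrite expn_gt0.
have : k * (m ^ (m * u) * m ^ s.+1) < m.+1 ^ (m * u) * m.+1 ^ s.+1.
  apply: (@leq_ltn_trans (2 ^ u * m ^ (m * u) * m ^ s.+1)).
    by rewrite mulnA leq_mul2r leq_mul2r ku !orbT.
  apply: (@leq_trans (2 ^ u * m ^ (m * u) * m.+1 ^ s.+1)).
    by rewrite ltn_pmul2l // muln_gt0 h5.
  by rewrite leq_mul2r h2 orbT.
by rewrite ltnNge h1.
Qed.

Section Loop.
Variables (n r L : nat) (es : seq (nat * nat)) (T0 : seq nat).
Hypothesis uniqT0 : uniq T0.
Hypothesis T0n : size T0 <= n.
Hypothesis L0 : 0 < L.
Hypothesis Ln : L <= n.
Local Notation ea := (edge_arcs es).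
Local Notation na := (node_arcs (iota 0 n)).
Hypothesis progress : forall A, uniq A -> {subset A <= T0} -> 0 < size A ->
  exists2 c, c \in [seq attempt ea na r L A row | row <- hadamard (size A)] &
    size A <= 48 * (size A - size c.1).

(** [i] counts all rounds, [p] the successful ones. [li_phases] records the decay just before the
    latest success, when some terminal was still active; this bounds [p] once none is left. By
    [li_steps], each round removes a terminal or raises the guess, so [n + n] rounds exhaust the
    terminals. *)
Record loop_inv (i p : nat) (st : state) : Prop := LoopInv {
  li_uniq : uniq st.1.1;
  li_sub : {subset st.1.1 <= T0};
  li_guess : 0 < st.2.1 <= L;
  li_edges : {subset st.1.2 <= es};
  li_bud : st.2.2 <= p * (32 * L);
  li_degree : forall v, count (incident v) st.1.2 <= p * (2 * L + 1);
  li_walk : forall t, t \in T0 -> exists b q, [/\ b \in r :: st.1.1, path (linked st.1.2) b q,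
    last b q = t & size q <= st.2.2];
  li_decay : size st.1.1 * 48 ^ p <= size T0 * 47 ^ p;
  li_phases : p = 0 \/ 48 ^ p.-1 <= size T0 * 47 ^ p.-1;
  li_steps : st.1.1 = [::] \/ i + size st.1.1 < size T0 + st.2.1 }.

Lemma linked_cat (H1 H2 : seq (nat * nat)) u p :
  path (linked H1) u p || path (linked H2) u p -> path (linked (H1 ++ H2)) u p.
Proof.
by case/orP; apply: sub_path => x z; rewrite /linked !mem_cat => /orP[]->; rewrite ?orbT.
Qed.

Lemma phase_inv i p st : loop_inv i p st ->
  exists p', loop_inv i.+1 p' (phase ea na r st).
Proof.
case: st => [[A H] [l bud]] [/= uA sA /andP[l0 lL] sH hb hd hw hk hp hs].
rewrite /phase /=; have [A0|An] := posnP (size A).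
  have eA := size0nil A0; rewrite eA /=; exists p.
  by split=> //=; rewrite -?eA //; [rewrite l0|left].
have -> : (if A is [::] then ((A, H), (l, bud)) else
    if successes ea na r l A is c :: _ then ((c.1, c.2 ++ H), (l, bud + 2 * radius l))
    else ((A, H), (l.+1, bud))) = if successes ea na r l A is c :: _
    then ((c.1, c.2 ++ H), (l, bud + 2 * radius l)) else ((A, H), (l.+1, bud)).
  by case: (A) An.
have {}hs : i + size A < size T0 + l by case: hs => // hA; rewrite hA in An.
case es' : (successes ea na r l A) => [|c cs].
  exists p; split=> //=; last by right; rewrite addSn addnS ltnS.
  (* The guess cannot pass [L], where [progress] provides a successful split. *)
  rewrite ltn_neqAle lL andbT; apply: contra_eqN es' => /eqP->.
  have [c hc hs'] := progress uA sA An.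
  suff: c \in successes ea na r L A by case: (successes _ _ _ _ _).
  by rewrite mem_filter hs'.
have: c \in successes ea na r l A by rewrite es' mem_head.
rewrite mem_filter => /andP[hc /mapP[row hrow ec]].
have [kJ [/allP h1 _ _]] := hadamardP (size A).
have size_row : size A < size row by rewrite (eqP (h1 _ hrow)).
have [c1 c2 c3 c4 c5] := attempt_spec n es r l uA size_row.
rewrite -ec in c1 c2 c3 c4 c5.
have cA : size c.1 <= size A by apply: uniq_leq_size.
exists p.+1; split=> //=.
- by move=> a /c1 /sA.
- by rewrite l0.
- by move=> e; rewrite mem_cat => /orP[/c3|/sH].
- by rewrite mulSn /radius; move: hb; lia.
- move=> v; rewrite count_cat mulSn; apply: leq_add (hd v).
  by apply: leq_trans (c4 v) _; lia.
- move=> t /hw[b [q [hbA hq lq sq]]].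
  have [b' [q' [hb' hq' lq' sq']]] : exists b' q', [/\ b' \in r :: c.1, path (linked c.2) b' q',
      last b' q' = b & size q' <= 2 * radius l].
    move: hbA; rewrite inE => /orP[/eqP->|/c5 //].
    by exists r, [::]; rewrite mem_head.
  exists b', (q' ++ q); split=> //.
  + rewrite cat_path lq'; apply/andP; split; apply: linked_cat; first by rewrite hq'.
    by rewrite hq orbT.
  + by rewrite last_cat lq'.
  by rewrite size_cat addnC leq_add.
- rewrite !expnS; move: (48 ^ p) (47 ^ p) hk => x z hk.
  have : 48 * size c.1 <= 47 * size A by lia.
  by move=> h; nia.
- by right; apply: leq_trans hk; rewrite leq_pmull.
(* As [size A] is positive, [hc] forces the removal of at least one terminal. *)
by right; move: hs hc cA An; lia.
Qed.

Lemma loop_final : exists p, [/\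
  loop_inv (n + n) p (iter (n + n) (phase ea na r) ((T0, [::]), (1, 0))) &
  (iter (n + n) (phase ea na r) ((T0, [::]), (1, 0))).1.1 = [::]].
Proof.
suff h i : exists p, loop_inv i p (iter i (phase ea na r) ((T0, [::]), (1, 0))).
  have [p hp] := h (n + n); exists p; split=> //.
  case: (li_steps hp) => // hs; have /andP[_ lL] := li_guess hp; lia.
elim: i => [|i [p hp]]; last by rewrite iterS; exact: phase_inv hp.
exists 0; split=> //=.
- move=> t tT; exists t, [::]; split=> //; by rewrite inE tT orbT.
- by left.
by right; rewrite add0n addn1.
Qed.

End Loop.

(** * The output as a tree on ['I_n]: encoding, diameter and degree *)

Lemma eq_set2 (T : finType) (u v a b : T) : [set u; v] = [set a; b] ->
  (u = a /\ v = b) \/ (u = b /\ v = a).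
Proof.
move=> /setP h; have := h u; have := h v; have := h a; have := h b.
rewrite !inE !eqxx !orbT /=.
move=> /orP[]/eqP hb /orP[]/eqP ha /esym/orP[]/eqP hv /esym/orP[]/eqP hu; subst; auto.
Qed.

Section TreeSpec.
Variables (n : nat) (r : 'I_n) (H : seq (nat * nat)) (h : nat).
Hypothesis H_lt : forall e, e \in H -> (e.1 < n) && (e.2 < n).
Local Notation tr := (bfs (sym_arcs H) h [:: outn r]).
Local Notation te := (tree_edges tr).

(** [insubd r] merely changes the type: every number in the tree is below [n], so the default [r] is
    never taken. *)
Definition tree_vs : seq 'I_n := [seq insubd r en.1.1 | en <- tr].
Definition tree_es : seq ('I_n * 'I_n) := [seq (insubd r e.1, insubd r e.2) | e <- te].
Local Notation S := (listed_vertices tree_vs).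
Local Notation F := (listed_edges tree_es).
Local Notation up := (fun u v : 'I_n => tree_up H r h u v).

Lemma linked_lt u v : linked H u v -> (u < n) && (v < n).
Proof. by case/orP=> /H_lt //=; rewrite andbC. Qed.

Lemma tree_edge_lt e : e \in te -> (e.1 < n) && (e.2 < n).
Proof.
by case: e => u v /tree_edgeP[/linked_lt]; rewrite andbC.
Qed.

Lemma tree_vertex_lt en : en \in tr -> en.1.1 < n.
Proof.
move=> hen; case: (bfs_parent hen) => [[]|]; first by rewrite inE => /eqP -> _ /=.
case=> a [p [_ <- /sym_arcsP[u [v [-> /linked_lt/andP[_ hv]]]] _]].
exact: hv.
Qed.

Lemma val_insubd_lt a : a < n -> val (insubd r a) = a.
Proof. by move=> an; rewrite val_insubd an. Qed.

Lemma enc_tree : enc_output tree_vs tree_es = enc ([seq en.1.1 | en <- tr], te).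
Proof.
rewrite enc_pair !enc_seqE /enc_output -!map_comp; congr (Node (enc_seq _) (enc_seq _)).
  apply/eq_in_map => en /tree_vertex_lt hlt /=.
  by rewrite /enc_vertex val_insubd_lt // enc.unlock.
apply/eq_in_map => -[a b] /tree_edge_lt /andP[/= h1 h2].
by rewrite enc_pair /enc_vertex !val_insubd_lt // enc.unlock.
Qed.

Lemma mem_tree_vertices (v : 'I_n) : (v \in S) = in_tree H r h v.
Proof.
rewrite inE; apply/mapP/mapP => [[en hen ->]|[en hen ev]]; exists en => //.
  by rewrite val_insubd_lt ?tree_vertex_lt // -(tree_vertex hen).
by apply: val_inj; rewrite val_insubd_lt ?tree_vertex_lt // -ev.
Qed.

Lemma tree_edgesP e : reflect (exists2 uv : 'I_n * 'I_n, up uv.1 uv.2 & e = [set uv.1; uv.2]) (e \in F).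
Proof.
apply: (iffP imsetP) => [[uv]|[[u v] /= huv ->]].
  case/mapP=> -[a b] hab -> ->; exists (insubd r a, insubd r b) => //=.
  by have /andP[/= h1 h2] := tree_edge_lt hab; rewrite !val_insubd_lt.
exists (u, v) => //; apply/mapP; exists (val u, val v) => //=.
by congr (_, _); apply: val_inj; rewrite val_insubd_lt /=.
Qed.

Lemma adj_tree (u v : 'I_n) : adj F u v -> up u v || up v u.
Proof.
case/tree_edgesP=> -[a b] /= hab /eq_set2[[-> ->]|[-> ->]]; by rewrite hab ?orbT.
Qed.

Lemma up_adj (u v : 'I_n) : up u v -> adj F u v.
Proof. by move=> huv; apply/tree_edgesP; exists (u, v). Qed.

Lemma adj_tree_sym : symmetric (adj F).
Proof. by move=> u v; rewrite /adj setUC. Qed.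

Lemma tree_connected_root (v : 'I_n) : in_tree H r h v -> connect (adj F) v r.
Proof.
have [m] := ubnP (tree_depth H r h v); elim: m v => // m IH v hm hv.
case: (tree_parent hv) => [vr|[u hu hd]]; first by rewrite (val_inj vr) connect0.
have /andP[_ uin] := tree_up_in hu.
have un : u < n by have /andP[] := tree_edge_lt hu.
apply: (@connect_trans _ _ (Ordinal un)); first by apply: connect1; apply: up_adj.
by apply: IH => //=; rewrite -ltnS -hd.
Qed.

Lemma tree_is_tree : is_tree S F.
Proof.
split.
- apply/forall_inP => e /tree_edgesP[[u v] /= huv ->]; rewrite cards2.
  suff -> : u != v by [].
  by apply/eqP => uv; move: (tree_up_depth huv); rewrite uv => /eqP; rewrite ltn_eqF.
- apply/bigcupsP => e /tree_edgesP[[u v] /= huv ->].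
  have /andP[hu hv] := tree_up_in huv.
  by apply/subsetP => w; rewrite mem_tree_vertices !inE => /orP[]/eqP->.
- by apply/set0Pn; exists r; rewrite mem_tree_vertices in_tree_root.
- move=> u v; rewrite !mem_tree_vertices => hu hv.
  apply: connect_trans (tree_connected_root hu) _.
  by rewrite (sym_connect_sym adj_tree_sym) tree_connected_root.
move=> c /andP[cyc uc].
apply: (@forest_acyclic _ (adj F) up (fun v => tree_depth H r h v)) cyc uc.
- exact: adj_tree.
- by move=> u v; exact: tree_up_depth.
by move=> u v w huv huw; apply: val_inj; exact: tree_up_fun huv huw.
Qed.

Lemma tree_diameter : diameter S F <= 2 * h.
Proof.
apply/bigmax_leqP => u _; apply/bigmax_leqP => v _; apply/bigmax_leqP => P.
rewrite inE /simple_path /hops; case: (bseqval P) => [//|a p] /and4P[_ _ hp up'].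
rewrite /= mul2n -addnn.
apply: leq_trans (@forest_path _ (adj F) up (fun v => tree_depth H r h v) h _ _ _ _ a p hp up') _.
- exact: adj_tree.
- by move=> x z; exact: tree_up_depth.
- by move=> x z w hxz hxw; apply: val_inj; exact: tree_up_fun hxz hxw.
- by move=> x; exact: tree_depth_le.
by rewrite leq_add2r tree_depth_le.
Qed.

Definition edge_set (e : nat * nat) : {set 'I_n} := [set w : 'I_n | (val w == e.1) || (val w == e.2)].

Lemma tree_edge_linked (u v : 'I_n) : up u v -> linked H v u.
Proof. by case/tree_edgeP. Qed.

(** Tree edges come from entries of [H], so the images under [edge_set] of the entries at [v] cover
    the tree edges at [v]. *)
Lemma tree_degree m : (forall v, count (incident v) H <= m) -> max_degree S F <= m.
Proof.
move=> hm; apply/bigmax_leqP => v _; apply: leq_trans (hm v).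
rewrite -size_filter -(size_map edge_set); apply: leq_trans (card_size _).
apply/subset_leq_card/subsetP => e; rewrite inE => /andP[/tree_edgesP[[a b] /= hab ->]] vab.
have eE (x z : 'I_n) : [set a; b] = [set x; z] -> edge_set (val x, val z) = [set a; b].
  by move=> ->; apply/setP => w; rewrite !inE.
have lk := tree_edge_linked hab.
have vv : (v == a) || (v == b) by move: vab; rewrite !inE.
case/orP: lk => hH; apply/mapP; [exists (val b, val a)|exists (val a, val b)].
- by rewrite mem_filter hH andbT /incident /= ![val _ == val v]eq_sym orbC.
- by rewrite eE // setUC.
- by rewrite mem_filter hH andbT /incident /= ![val _ == val v]eq_sym.
by rewrite eE.
Qed.

End TreeSpec.

(** * Decoding the input, and the guess compared with the LP value *)

Section Input.
Variables (n : nat) (E : {set {set 'I_n}}) (r : 'I_n) (R : {set 'I_n}).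
Variables (x : {set 'I_n} -> rat) (y : 'I_n -> n.-bseq 'I_n -> rat) (L1 L2 : rat).
Variable ys : seq ('I_n * n.-bseq 'I_n).

Definition rows : seq (seq (option data)) :=
  [seq [seq if adj E u v then Some (enc_rat (x [set u; v])) else None | v <- enum 'I_n]
  | u <- enum 'I_n].

(** Weights and LP values remain undecoded [data]: of the matrix, the program inspects only which
    entries are present. *)
Definition lp_input : input :=
  (rows, (val r, ([seq v \in R | v <- enum 'I_n],
    Node (enc_seq [seq Node (enc_vertex tP.1) (Node (enc_path tP.2) (enc_rat (y tP.1 tP.2)))
                  | tP : 'I_n * n.-bseq 'I_n <- ys])
      (enc_seq [:: enc_rat L1; enc_rat L2])))).

Lemma lp_inputE : enc_input E r R x y L1 L2 ys = enc lp_input.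
Proof.
rewrite /lp_input !enc_pair /enc_input /=; congr (Node _ (Node _ (Node _ _))).
- rewrite /enc_weighted_graph /rows enc_seqE -[X in _ = enc_seq X]map_comp; congr enc_seq; apply: eq_map => u /=.
  rewrite enc_seqE -[X in _ = enc_seq X]map_comp; congr enc_seq; apply: eq_map => v /=.
  by case: ifP => _; rewrite encE // enc.unlock.
- by rewrite enc.unlock.
- by rewrite enc_seqE -[X in _ = enc_seq X]map_comp; congr enc_seq; apply: eq_map => v /=; rewrite enc.unlock.
by rewrite enc.unlock.
Qed.

Lemma size_rows : size rows = n.
Proof. by rewrite size_map size_enum_ord. Qed.

Lemma zip_iota_enum (T : Type) (f : 'I_n -> T) :
  zip (iota 0 (size [seq f u | u <- enum 'I_n])) [seq f u | u <- enum 'I_n] =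
  [seq (val u, f u) | u <- enum 'I_n].
Proof.
rewrite size_map size_enum_ord -val_enum_ord; elim: (enum 'I_n) => //= u s <-.
by [].
Qed.

Lemma mem_edges_of (e : nat * nat) : reflect (exists u v : 'I_n, e = (val u, val v) /\ adj E u v)
  (e \in edges_of rows).
Proof.
rewrite /edges_of zip_iota_enum -map_comp; apply: (iffP flattenP).
  case=> s /mapP[u _ ->] /=; rewrite zip_iota_enum filter_map -map_comp => /mapP[v].
  rewrite mem_filter /= => /andP[huv _] ->; exists u, v; split=> //.
  by move: huv; case: ifP.
case=> u [v [-> huv]].
exists [seq (val u, ve.1) | ve <- zip (iota 0 (size [seq if adj E u v then
  Some (enc_rat (x [set u; v])) else None | v <- enum 'I_n])) [seq if adj E u v then
  Some (enc_rat (x [set u; v])) else None | v <- enum 'I_n] & isSome ve.2].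
  by apply/mapP; exists u; rewrite ?mem_enum.
rewrite zip_iota_enum filter_map -map_comp; apply/mapP; exists v => //.
by rewrite mem_filter /= huv mem_enum.
Qed.

Lemma terminals_input : terminals lp_input = [seq val v | v <- enum 'I_n & (v \in R) && (val v != val r)].
Proof.
rewrite /terminals /= size_rows.
have -> : zip (iota 0 n) [seq v \in R | v <- enum 'I_n] = [seq (val v, v \in R) | v <- enum 'I_n].
  by rewrite -zip_iota_enum size_map size_enum_ord.
by rewrite filter_map -map_comp.
Qed.

Lemma mem_terminals (t : 'I_n) : (val t \in terminals lp_input) = (t \in R) && (t != r).
Proof.
rewrite terminals_input; apply/mapP/andP => [[v]|[tR tr]].
  by rewrite mem_filter => /andP[/andP[vR vr] _] /val_inj ->.
by exists t; rewrite // mem_filter tR mem_enum andbT.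
Qed.

Lemma terminals_uniq : uniq (terminals lp_input).
Proof.
rewrite terminals_input map_inj_uniq; last exact: val_inj.
by rewrite filter_uniq // enum_uniq.
Qed.

Lemma terminals_lt a : a \in terminals lp_input -> a < n.
Proof. by rewrite terminals_input => /mapP[v _ ->]; exact: ltn_ord. Qed.

Lemma size_terminals : size (terminals lp_input) <= #|R|.
Proof.
rewrite terminals_input size_map cardE; apply: uniq_leq_size; first by rewrite filter_uniq // enum_uniq.
by move=> v; rewrite mem_filter !mem_enum => /andP[/andP[]].
Qed.

Lemma size_terminals_n : size (terminals lp_input) <= n.
Proof. by apply: leq_trans size_terminals _; rewrite -[leqRHS]card_ord max_card. Qed.

Local Open Scope ring_scope.
Hypothesis simpleE : simple_graph E.
Hypothesis feas : poise_lp_feasible E r R x y L1 L2.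

Lemma L1_ge0 : 0 <= L1.
Proof.
apply: le_trans (lp_degree feas r); apply: sumr_ge0 => e.
by rewrite inE => /andP[eE _]; exact: (lp_x_ge0 feas eE).
Qed.

(** Every path from a terminal other than [r] has a hop. The resulting lower bound 1 on the LP value
    is what makes rounding up to an integer cost only a factor 2. *)
Lemma L2_ge t : t \in R -> 0 <= L2 /\ (t != r -> 1 <= L2).
Proof.
move=> tR; split=> [|tr].
  apply: le_trans (lp_length feas tR); apply: sumr_ge0 => P hP.
  by rewrite mulr_ge0 // (lp_y_ge0 feas tR hP).
apply: le_trans (lp_length feas tR); rewrite -[leLHS](lp_unit feas tR); apply: ler_sum => P hP.
rewrite -[leLHS]mul1r; apply: ler_wpM2r; first exact: (lp_y_ge0 feas tR hP).
rewrite ler1n /hops.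
move: hP; rewrite inE /simple_path; case: (bseqval P) => [//|a [|b p]] /and4P[/eqP ha /eqP hl _ _] //.
by move: tr; rewrite -ha -hl eqxx.
Qed.

(* Capping at n keeps the number of rounds polynomial; it is harmless, since
   simple paths have at most n hops and an edge carries at most one unit of the
   flow of a terminal. *)
Definition guess : nat := minn n (Num.truncn (L1 + L2)).+1.

Lemma guess_cases : R != set0 -> guess = n \/ L1 <= guess%:R /\ L2 <= guess%:R.
Proof.
case/set0Pn=> t tR; have [l2 _] := L2_ge tR; have l1 := L1_ge0.
have lt := truncnS_gt (L1 + L2).
rewrite /guess /minn; case: ifP => _; [by left|right].
by split; apply: ltW; apply: le_lt_trans lt; rewrite ?lerDl ?lerDr.
Qed.

Lemma guess_gt0 : (0 < guess)%N.
Proof. by rewrite /guess leq_min andbT (leq_ltn_trans _ (ltn_ord r)). Qed.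

Lemma guess_le_n : (guess <= n)%N. Proof. exact: geq_minl. Qed.

Lemma guess_le t : t \in R -> t != r -> guess%:R <= 2 * (L1 + L2).
Proof.
move=> tR tr; have [_ /(_ tr) l2] := L2_ge tR; have l1 := L1_ge0.
have : (Num.truncn (L1 + L2))%:R <= L1 + L2 by rewrite truncn_le; lra.
have : guess%:R <= (Num.truncn (L1 + L2)).+1%:R :> rat by rewrite ler_nat geq_minr.
by rewrite -[X in _ <= X%:R -> _]addn1 natrD; lra.
Qed.

Lemma card_delta v : (#|delta E v| <= n)%N.
Proof.
rewrite -[leqRHS](card_ord n) -(cardsT 'I_n).
apply: leq_trans (leq_imset_card (fun u => [set v; u]) _).
apply/subset_leq_card/subsetP => e; rewrite inE => /andP[eE ve].
have /forall_inP/(_ e eE)/cards2P[a [b [_ ee]]] := simpleE.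
apply/imsetP; move: ve; rewrite ee !inE => /orP[]/eqP->; [exists b|exists a] => //.
by rewrite setUC.
Qed.

Lemma progress_input A : R != set0 -> uniq A -> {subset A <= terminals lp_input} ->
  (0 < size A)%N ->
  exists2 c, c \in [seq attempt (edge_arcs (edges_of rows)) (node_arcs (iota 0 n)) r guess A row
    | row <- hadamard (size A)] & (size A <= 48 * (size A - size c.1))%N.
Proof.
move=> R0 uA sA A0.
have AR (t : 'I_n) : val t \in A -> t \in R by move=> /sA; rewrite mem_terminals => /andP[].
apply: (@attempt_success n E r (edges_of rows) A guess y) => //.
- by move=> u v uv; apply/mem_edges_of; exists u, v.
- by move=> a /sA; exact: terminals_lt.
- by apply/negP => /sA; rewrite mem_terminals eqxx andbF.
- exact: guess_gt0.
- by move=> t P tA; exact: (lp_y_ge0 feas (AR _ tA)).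
- by move=> t tA; exact: (lp_unit feas (AR _ tA)).
- move=> t /AR tR; have [->|[_ h2]] := guess_cases R0; last exact: (le_trans (lp_length feas tR) h2).
  rewrite -[leRHS]mulr1 -[X in _ <= _ * X](lp_unit feas tR) mulr_sumr; apply: ler_sum => P hP.
  apply: ler_wpM2r; first exact: (lp_y_ge0 feas tR hP).
  rewrite ler_nat /hops.
  exact: leq_trans (leq_pred _) (size_bseq P).
move=> v; have [->|[h1 _]] := guess_cases R0; last first.
  apply: le_trans h1; apply: le_trans (lp_degree feas v); apply: ler_sum => e.
  rewrite inE => /andP[eE _]; apply: bigmax_le; first exact: (lp_x_ge0 feas eE).
  by move=> t /AR tR; exact: (lp_capacity feas eE tR).
apply: (@le_trans _ _ (\sum_(e in delta E v) 1)).
  apply: ler_sum => e _; apply: bigmax_le => // t /AR tR.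
  apply: edge_load_le1 (lp_unit feas tR) _ => P hP; exact: (lp_y_ge0 feas tR hP).
by rewrite sumr_const ler_nat card_delta.
Qed.

End Input.

Lemma scaled_le (a b l u C : nat) (z : rat) : C = a * b * 2 -> (l%:R <= 2 * z)%R ->
  ((a * l * (b * u))%:R <= C%:R * (z * u%:R))%R.
Proof.
move=> -> h; rewrite !natrM.
have -> : (a%:R * l%:R * (b%:R * u%:R) = (a%:R * b%:R * u%:R) * l%:R :> rat)%R by ring.
have -> : (a%:R * b%:R * 2 * (z * u%:R) = (a%:R * b%:R * u%:R) * (2 * z) :> rat)%R by ring.
by rewrite ler_wpM2l // !mulr_ge0.
Qed.

Theorem theorem2 :
  exists (A : prog) (c d C : nat),
  forall (n : nat) (E : {set {set 'I_n}}) (r : 'I_n) (R : {set 'I_n})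
         (x : {set 'I_n} -> rat) (y : 'I_n -> n.-bseq 'I_n -> rat)
         (L1 L2 : rat) (ys : seq ('I_n * n.-bseq 'I_n)),
    simple_graph E ->
    R != set0 ->
    poise_lp_feasible E r R x y L1 L2 ->
    lists_support E r R y ys ->
    exists (vs : seq 'I_n) (es : seq ('I_n * 'I_n)) (time : nat),
      let S := listed_vertices vs in
      let F := listed_edges es in
      [/\ run A (enc_input E r R x y L1 L2 ys) (enc_output vs es) time,
          time <= c * dsize (enc_input E r R x y L1 L2 ys) ^ d,
          is_tree S F /\ F \subset E,
          r |: R \subset S
        & ((poise S F)%:R
             <= C%:R * ((L1 + L2) * (up_log 2 (maxn 2 #|R|))%:R) :> rat)%R].
Proof.
have [A [b [[_ [c [d hb]]] hrun]]] := pt_algorithm.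
(* Diameter at most [2 * 32 L p] and degree at most [(2 L + 1) p] give [67 L p]; then
   [p <= 47 u + 1 <= 48 u], and the guess [L] is at most twice the LP value. *)
have [C hC] : exists C, C = 67 * 48 * 2 by exists (67 * 48 * 2).
(* [polyb] bounds by powers of [s + 1], which is at most [2 s]. *)
exists A, (c * 2 ^ d), d, C => n E r R x y L1 L2 ys simpleE R0 feas _.
set i := lp_input E r R x y L1 L2 ys.
set L := guess n L1 L2.
have inputE : enc_input E r R x y L1 L2 ys = enc i by exact: lp_inputE.
have edgesP e := @mem_edges_of n E x e.
have [p [inv eA]] := @loop_final n r L (edges_of i.1) (terminals i)
  (terminals_uniq E r R x y L1 L2 ys) (size_terminals_n E r R x y L1 L2 ys) (guess_gt0 r L1 L2) (guess_le_n n L1 L2)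
  (fun A => @progress_input n E r R x y L1 L2 ys simpleE feas A R0).
have fsE : final_state i = iter (n + n) (phase (edge_arcs (edges_of i.1)) (node_arcs (iota 0 n)) r)
  ((terminals i, [::]), (1, 0)) by rewrite /final_state /= size_rows.
rewrite -fsE in inv eA.
set st := final_state i in inv eA; set H := st.1.2 in inv; set bud := st.2.2 in inv.
have H_lt e : e \in H -> (e.1 < n) && (e.2 < n).
  by move=> /(li_edges inv)/edgesP[u [v [-> _]]]; rewrite !ltn_ord.
have [time ht tb] := hrun i.
exists (tree_vs r H bud), (tree_es r H bud), time => S F; split.
- by rewrite inputE enc_tree.
- rewrite inputE; apply: leq_trans tb _; apply: leq_trans (hb _) _.
  rewrite -mulnA leq_mul2l -expnMn; apply/orP; right.
  case: (d) => // d'; rewrite leq_exp2r //; have := dsize_gt0 (enc i).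
  by move: (dsize _) => s; lia.
- split; first exact: (@tree_is_tree n r H bud H_lt).
  apply/subsetP => e /(@tree_edgesP n r H bud H_lt)[[u v] /= huv ->].
  have /orP[] := tree_edge_linked huv => /(li_edges inv)/edgesP[a [b' [[/val_inj-> /val_inj->]]]] //.
  by rewrite /adj setUC.
- apply/subsetP => t; rewrite mem_tree_vertices // !inE => htR.
  have [->|tr] := eqVneq t r; first exact: in_tree_root.
  have tT : val t \in terminals i by rewrite mem_terminals tr andbT; move: htR; rewrite (negPf tr).
  have [b' [q [hb' hq lq sq]]] := li_walk inv tT.
  move: hb'; rewrite eA inE => /eqP eb; rewrite eb in hq lq.
  rewrite /in_tree -lq; apply: found_mono sq _; apply: walk_found hq.
  exact: mem_head.
have poiseL : poise S F <= 67 * L * p.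
  have deg := @tree_degree n r H bud H_lt _ (li_degree inv).
  have dia := @tree_diameter n r H bud H_lt.
  have := li_bud inv; have := guess_gt0 r L1 L2; rewrite -/L -/bud => L0 hb'.
  by apply: leq_trans (leq_add dia deg) _; nia.
set u := up_log 2 (maxn 2 #|R|).
have u0 : 0 < u by rewrite up_log_gt0 leq_max.
have ku : size (terminals i) <= 2 ^ u.
  apply: leq_trans (size_terminals E r R x y L1 L2 ys) _.
  by apply: leq_trans (up_logP _ _); rewrite // leq_maxr.
have [t0 t0R] := set0Pn _ R0.
have l1 := L1_ge0 feas; have [l2 _] := L2_ge feas t0R.
(* Without a successful phase the poise is 0. This covers [R = [set r]], where the LP value may
   vanish and [guess_le] does not apply. *)
have [p0|ph] := li_phases inv.
  move: poiseL; rewrite p0 muln0 leqn0 => /eqP ->.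
  by apply: mulr_ge0; rewrite ?ler0n // mulr_ge0 ?ler0n ?addr_ge0.
have pu : p <= 48 * u by have := decay_bound (isT : 0 < 47) ku ph; lia.
have [a aT] : exists a, a \in terminals i.
  case: (terminals i) ph => [|a s] ph; last by exists a; exact: mem_head.
  by move: ph; rewrite mul0n leqn0 expn_eq0.
have [t [tR tr]] : exists t : 'I_n, t \in R /\ t != r.
  have an := terminals_lt aT; exists (Ordinal an).
  by apply/andP; rewrite -(mem_terminals E r R x y L1 L2 ys).
have hL := guess_le feas tR tr; rewrite -/L in hL.
apply: (@le_trans _ _ (67 * L * (48 * u))%:R%R).
  by rewrite ler_nat; apply: leq_trans poiseL _; rewrite leq_mul2l pu orbT.
exact: scaled_le hC hL.
Qed.
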